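(* Let $\varphi:\mathbb D\to\mathbb D$ be a parabolic holomorphic self-map of positive hyperbolic step and let $\psi_1,\psi_2\in\mathcal Z_\forall(\varphi)$. Then $\psi_1\circ\psi_2=\psi_2\circ\psi_1$ if and only if at least one of the following three conditions holds: (a) $\beta_{\varphi,\psi_1}=\beta_{\varphi,\psi_2}$; (b) $c_{\varphi,\psi_1}=p/q\in\mathbb Q$, where $p\in\mathbb Z$ and $q\in\mathbb N$ are relatively prime, and $\beta_{\varphi,\psi_2}(w+1/q)=\beta_{\varphi,\psi_2}(w)+1/q$ for all $w\in S_\varphi$; (c) condition (b) holds with $\psi_1$ and $\psi_2$ interchanged.
   Context: $\mathbb D$ is the open unit disc, $\mathbb H=\{w\in\mathbb C:\operatorname{Im}w>0\}$. A holomorphic self-map $\varphi$ of $\mathbb D$ is parabolic if its Denjoy–Wolff point (locally uniform limit of the iterates) $\tau$ lies on $\partial\mathbb D$ and the angular derivative satisfies $\varphi'(\tau)=1$. It is of positive hyperbolic step if $\lim_{n}\rho_{\mathbb D}(\varphi^{\circ n}(z_0),\varphi^{\circ(n+1)}(z_0))>0$ for some (equivalently, every) $z_0\in\mathbb D$, where $\rho_{\mathbb D}$ is the hyperbolic distance. The centralizer $\mathcal Z_\forall(\varphi)$ is the set of all holomorphic $\psi:\mathbb D\to\mathbb D$ with $\psi\circ\varphi=\varphi\circ\psi$. Canonical model. A domain $V\subset\mathbb D$ is $\varphi$-absorbing if $\varphi(V)\subset V$ and $\mathbb D=\bigcup_{n}(\varphi^{\circ n})^{-1}(V)$. For $\varphi$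 parabolic of positive hyperbolic step there is a unique triple $(S_\varphi,h_\varphi,z\mapsto z+1)$, the canonical holomorphic model, with $S_\varphi\in\{\mathbb H,-\mathbb H\}$, $h_\varphi:\mathbb D\to S_\varphi$ holomorphic, $h_\varphi\circ\varphi=h_\varphi+1$, $S_\varphi=\bigcup_{n\ge0}(h_\varphi(\mathbb D)-n)$, $h_\varphi$ injective on some $\varphi$-absorbing domain, and $\operatorname{Re}h_\varphi(0)=0$. $h_\varphi$ is called the Koenigs function. Simultaneous linearization coefficient and function. For $\varphi$ parabolic of positive hyperbolic step and $\psi\in\mathcal Z_\forall(\varphi)$, consider for a constant $c\in\mathbb C$ and a holomorphic $\beta:S_\varphi\to\mathbb C$ the system: $\beta(w+1)=\beta(w)+1$ for all $w\in S_\varphi$; $\beta\circ h_\varphi\circ\varphi=\beta\circ h_\varphi+1$; $\beta\circ h_\varphi\circ\psi=\beta\circ h_\varphi+c$. There is a unique $c=c_{\varphi,\psi}\in\mathbb C$ for which a holomorphic solution $\beta$ exists; it is called the simultaneous linearization coefficient of $\psi$ w.r.t. $\varphi$. If $c_{\varphi,\psi}\notin\mathbb Q$, the simultaneous linearization function $\beta_{\varphi,\psi}$ is the unique holomorphic solution $\beta:S_\varphi\to\mathbb C$ of the system with $c=c_{\varphi,\psi}$ satisfying $\beta(w)-w\to0$ as $|\operatorname{Im}w|\to+\infty$, $w\in S_\varphi$; if $c_{\varphi,\psi}\in\mathbb Q$, one sets $\beta_{\varphi,\psi}:=\mathrm{id}_{S_\varphi}$. *)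

(* Defs.v *)
From Stdlib Require Import Reals ZArith Znumtheory.
From Coquelicot Require Import Coquelicot.

Open Scope C_scope.

(* Maps between subsets of the plane are total functions [C -> C]; every
   condition below only involves their values on the relevant open set. *)

Definition Disc (z : C) : Prop := (Cmod z < 1)%R.

Definition upper_half_plane (w : C) : Prop := (0 < Im w)%R.

Definition lower_half_plane (w : C) : Prop := (Im w < 0)%R.

Definition planar_domain (V : C -> Prop) : Prop :=
  open V /\
  (exists z, V z) /\
  (forall A B : C -> Prop, open A -> open B ->
     (forall z, V z -> A z \/ B z) ->
     (forall z, ~ (V z /\ A z /\ B z)) ->
     (forall z, V z -> A z) \/ (forall z, V z -> B z)).

(* Complex differentiability: the scalar field of [ex_derive] is [C]. *)
Definition holomorphic_on (U : C -> Prop) (f : C -> C) : Prop :=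
  forall z, U z -> @ex_derive C_AbsRing C_NormedModule f z.

Definition holomorphic_self_map (f : C -> C) : Prop :=
  holomorphic_on Disc f /\ forall z, Disc z -> Disc (f z).

Definition iterate (f : C -> C) (n : nat) (z : C) : C := Nat.iter n f z.

Definition is_denjoy_wolff_point (f : C -> C) (tau : C) : Prop :=
  forall z0, Disc z0 ->
    exists r : R, (0 < r)%R /\
      forall eps : R, (0 < eps)%R ->
        exists N : nat, forall n z, (N <= n)%nat ->
          Disc z -> (Cmod (z - z0) < r)%R ->
          (Cmod (iterate f n z - tau) < eps)%R.

Definition stolz_region (tau : C) (M : R) (z : C) : Prop :=
  Disc z /\ (Cmod (z - tau) < M * (1 - Cmod z))%R.

Definition is_angular_limit (f : C -> C) (tau l : C) : Prop :=
  forall M : R, (1 < M)%R ->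
    filterlim f (within (stolz_region tau M) (locally tau)) (locally l).

Definition is_angular_derivative (f : C -> C) (tau d : C) : Prop :=
  exists l : C,
    is_angular_limit f tau l /\
    is_angular_limit (fun z => (f z - l) / (z - tau)) tau d.

Definition parabolic (f : C -> C) : Prop :=
  exists tau : C,
    Cmod tau = 1%R /\ is_denjoy_wolff_point f tau /\
    is_angular_derivative f tau 1.

(* Normalized to have density [1 / (1 - |z|^2)]; only the positivity of a
   limit of distances is used, which does not depend on the normalization. *)
Definition hyperbolic_distance (z w : C) : R :=
  let t := Cmod ((z - w) / (1 - Cconj w * z)) in
  (/ 2 * ln ((1 + t) / (1 - t)))%R.

Definition positive_hyperbolic_step (f : C -> C) : Prop :=
  exists z0 : C, Disc z0 /\
    exists l : R, (0 < l)%R /\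
      is_lim_seq
        (fun n => hyperbolic_distance (iterate f n z0) (iterate f (S n) z0)) l.

Definition in_centralizer (phi psi : C -> C) : Prop :=
  holomorphic_self_map psi /\
  forall z, Disc z -> psi (phi z) = phi (psi z).

Definition absorbing_domain (phi : C -> C) (V : C -> Prop) : Prop :=
  planar_domain V /\
  (forall z, V z -> Disc z) /\
  (forall z, V z -> V (phi z)) /\
  (forall z, Disc z -> exists n, V (iterate phi n z)).

(* The canonical holomorphic model [(Sphi, h, z |-> z + 1)]. *)
Record is_canonical_model (phi : C -> C) (Sphi : C -> Prop) (h : C -> C)
  : Prop := {
  model_base : Sphi = upper_half_plane \/ Sphi = lower_half_plane;
  model_holomorphic : holomorphic_on Disc h;
  model_maps_to : forall z, Disc z -> Sphi (h z);
  model_abel : forall z, Disc z -> h (phi z) = h z + 1;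
  model_exhausts : forall w : C,
    Sphi w <-> exists (n : nat) (z : C), Disc z /\ w = h z - INR n;
  model_injective : exists V : C -> Prop,
    absorbing_domain phi V /\
    forall z1 z2, V z1 -> V z2 -> h z1 = h z2 -> z1 = z2;
  model_normalized : Re (h 0) = 0%R
}.

Record solves_linearization_system (phi psi : C -> C) (Sphi : C -> Prop)
  (h : C -> C) (c : C) (beta : C -> C) : Prop := {
  lin_holomorphic : holomorphic_on Sphi beta;
  lin_translation : forall w, Sphi w -> beta (w + 1) = beta w + 1;
  lin_phi : forall z, Disc z -> beta (h (phi z)) = beta (h z) + 1;
  lin_psi : forall z, Disc z -> beta (h (psi z)) = beta (h z) + c
}.

(* "[c] is the coefficient of [psi] with respect to [phi]": the coefficient is
   the only [c] with this property, and this uniqueness is not assumed. *)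
Definition is_linearization_coefficient (phi psi : C -> C) (Sphi : C -> Prop)
  (h : C -> C) (c : C) : Prop :=
  exists beta : C -> C, solves_linearization_system phi psi Sphi h c beta.

Definition rational (c : C) : Prop :=
  exists (p : Z) (q : nat), (0 < q)%nat /\ c = RtoC (IZR p / INR q).

Definition tangent_to_identity_at_infinity (Sphi : C -> Prop) (beta : C -> C)
  : Prop :=
  forall eps : R, (0 < eps)%R ->
    exists M : R, forall w, Sphi w -> (M < Rabs (Im w))%R ->
      (Cmod (beta w - w) < eps)%R.

(* [c] is meant to be the coefficient of [psi]; [beta] is determined only on
   [Sphi], so that equality of such functions means equality on [Sphi]. *)
Definition is_linearization_function (phi psi : C -> C) (Sphi : C -> Prop)
  (h : C -> C) (c : C) (beta : C -> C) : Prop :=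
  (rational c -> forall w, Sphi w -> beta w = w) /\
  (~ rational c ->
     solves_linearization_system phi psi Sphi h c beta /\
     tangent_to_identity_at_infinity Sphi beta).

Definition rational_with_compatible_shift (Sphi : C -> Prop) (c : C)
  (beta : C -> C) : Prop :=
  exists (p : Z) (q : nat),
    (0 < q)%nat /\ rel_prime p (Z.of_nat q) /\
    c = RtoC (IZR p / INR q) /\
    forall w, Sphi w ->
      beta (w + RtoC (1 / INR q)) = beta w + RtoC (1 / INR q).

(* Main.v *)
(* Every [psi] in the centralizer descends through the Koenigs function to a holomorphic self-map
   [g] of the half-plane commuting with [w |-> w + 1], and [psi1], [psi2] commute iff [g1], [g2] do.
   By Schwarz-Pick [Im (g w) >= Im w], and the displacement [g w - w] tends to a constant [k] at
   infinity; if [k] is real then [g] is the translation by [k].  If [c] is rational, [g] must be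
   the translation by [c]; otherwise [k = c], and a periodic [g]-invariant holomorphic function
   tending to 0 at infinity vanishes.  Hence linearizations tangent to the identity are unique,
   which gives the forward implication, and they are injective near infinity, which gives the
   converse there; the identity theorem extends it to the disc.  The complex analysis this needs
   rests on Goursat's theorem for triangles. *)
Require Import Defs.
From Stdlib Require Import Reals ZArith Znumtheory Lra Lia Psatz.
From Stdlib Require Import Classical ClassicalEpsilon.
From Coquelicot Require Import Coquelicot.

Open Scope C_scope.

(** The delicate claim is that a rational coefficient [c = p / q] forces a translation. The
    linearizer that witnesses the coefficient is arbitrary there, with no control at infinity, so
    [k] cannot be compared with [c] directly. If [Im k > 0], this [beta] is invariant under [g]
    iterated [q] times and followed by the translation by [- p]. That map climbs by a nearly
    constant amount, so at large heights [beta] takes only values already taken on one window of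
    bounded height, where the periodicity of [beta w - w] bounds [Im beta]. At a point where
    [Im beta] is within 1 of its supremum, Harnack's inequality contradicts
    [beta (w + 1) = beta w + 1]. Hence [k] is real.

    The Koenigs function is injective only on an absorbing domain. An equality between values of [h]
    is therefore first pushed forward by iterating [phi], which commutes with each [psi]; this is
    what makes [g] well defined and holomorphic. *)

Definition is_cderive (f : C -> C) (z l : C) : Prop :=
  @is_derive C_AbsRing C_NormedModule f z l.

Definition is_path_derive (g : R -> C) (t : R) (l : C) : Prop :=
  @is_derive R_AbsRing C_R_NormedModule g t l.

Definition ccontinuous (f : C -> C) (z : C) : Prop :=
  forall eps : R, (0 < eps)%R -> exists d : R, (0 < d)%R /\
    forall w, (Cmod (w - z) < d)%R -> (Cmod (f w - f z) < eps)%R.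

(** * Moduli, and derivatives and continuity in epsilon form *)

Lemma Rlt_Rmin_l x a b : (x < Rmin a b)%R -> (x < a)%R.
Proof. intros H. eapply Rlt_le_trans; [exact H|apply Rmin_l]. Qed.

Lemma Rlt_Rmin_r x a b : (x < Rmin a b)%R -> (x < b)%R.
Proof. intros H. eapply Rlt_le_trans; [exact H|apply Rmin_r]. Qed.

Lemma Cmod_sub_sym a b : Cmod (a - b) = Cmod (b - a).
Proof. rewrite <- Cmod_opp. f_equal. ring. Qed.

Lemma Cmod_sub_triangle b a c : (Cmod (a - c) <= Cmod (a - b) + Cmod (b - c))%R.
Proof. replace (a - c) with ((a - b) + (b - c)) by ring. apply Cmod_triangle. Qed.

Lemma Cmod_triangle_sub a b : (Cmod (a - b) <= Cmod a + Cmod b)%R.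
Proof. rewrite <- (Cmod_opp b). apply Cmod_triangle. Qed.

Lemma Cmod_triangle_rev a b : (Cmod a - Cmod b <= Cmod (a - b))%R.
Proof.
  pose proof (Cmod_triangle (a - b) b) as H.
  replace (a - b + b) with a in H by ring. lra.
Qed.

Lemma Cmod_sub_diag a : Cmod (a - a) = 0%R.
Proof. replace (a - a) with (RtoC 0) by ring. apply Cmod_0. Qed.

Lemma Cmod_sub_eq_0 a b : Cmod (a - b) = 0%R -> a = b.
Proof. intros H. apply Cmod_eq_0 in H. replace a with (a - b + b) by ring. rewrite H. ring. Qed.

Lemma Cmod_sub_gt_0 a b : a <> b -> (0 < Cmod (a - b))%R.
Proof.
  intros H. destruct (Cmod_ge_0 (a - b)) as [H1|H1]; auto.
  exfalso. apply H. now apply Cmod_sub_eq_0.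
Qed.

Lemma Csub_neq_0 a b : a <> b -> a - b <> 0.
Proof. intros H. apply Cmod_gt_0. now apply Cmod_sub_gt_0. Qed.

Lemma im_le_Cmod c : (Rabs (Im c) <= Cmod c)%R.
Proof. eapply Rle_trans; [apply Rmax_r | apply (Rmax_Cmod c)]. Qed.

Lemma Cmod_le_Re_Im c : (Cmod c <= Rabs (Re c) + Rabs (Im c))%R.
Proof.
  destruct c as [x y]. simpl Re. simpl Im.
  replace (x, y) with (RtoC x + Ci * RtoC y) by (unfold RtoC, Ci; apply injective_projections; simpl; ring).
  eapply Rle_trans; [apply Cmod_triangle|].
  rewrite Cmod_mult, Cmod_Ci, !Cmod_R. lra.
Qed.

Lemma locally_C_eps (z : C) (P : C -> Prop) :
  @locally (AbsRing_UniformSpace C_AbsRing) z P <->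
  exists d : R, (0 < d)%R /\ forall w, (Cmod (w - z) < d)%R -> P w.
Proof.
  split.
  - intros [d H]. exists d. split; [apply cond_pos|]. intros w Hw. apply H. exact Hw.
  - intros (d & Hd & H). exists (mkposreal d Hd). intros w Hw. apply H. exact Hw.
Qed.

(** The product structure on [C] has square balls. It is the one that [open] refers to in
    [planar_domain], while all estimates below use round discs. *)
Lemma locally_C_iff (z : C) (P : C -> Prop) :
  @locally C_UniformSpace z P <->
  exists d : R, (0 < d)%R /\ forall w, (Cmod (w - z) < d)%R -> P w.
Proof. rewrite <- locally_C_eps. apply locally_C. Qed.

Lemma is_cderive_eps f z l :
  is_cderive f z l <->
  forall eps : R, (0 < eps)%R -> exists d : R, (0 < d)%R /\
    forall w, (Cmod (w - z) < d)%R ->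
      (Cmod (f w - f z - l * (w - z)) <= eps * Cmod (w - z))%R.
Proof.
  split.
  - intros [_ H] eps Heps.
    specialize (H z (fun P HP => HP) (mkposreal eps Heps)).
    apply locally_C_eps in H. destruct H as (d & Hd & H).
    exists d. split; auto. intros w Hw. specialize (H w Hw).
    replace (f w - f z - l * (w - z)) with (f w - f z - (w - z) * l) by ring. exact H.
  - intros H. split; [apply is_linear_scal_l|].
    intros x Hx. apply (@is_filter_lim_locally_unique C_AbsRing (AbsRing_NormedModule C_AbsRing)) in Hx. subst x.
    intros [eps Heps]. apply locally_C_eps. destruct (H eps Heps) as (d & Hd & H').
    exists d. split; auto. intros w Hw. specialize (H' w Hw).
    replace (f w - f z - l * (w - z)) with (f w - f z - (w - z) * l) in H' by ring. exact H'.
Qed.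

Lemma is_path_derive_eps (g : R -> C) t l :
  is_path_derive g t l <->
  forall eps : R, (0 < eps)%R -> exists d : R, (0 < d)%R /\
    forall s, (Rabs (s - t) < d)%R ->
      (Cmod (g s - g t - RtoC (s - t) * l) <= eps * Rabs (s - t))%R.
Proof.
  assert (E : forall s, @scal R_AbsRing C_R_NormedModule (s - t)%R l = RtoC (s - t) * l).
  { intros s. destruct l as [x y]. unfold RtoC. apply injective_projections; simpl;
    unfold scal, mult; simpl; unfold mult; simpl; ring. }
  split.
  - intros [_ H] eps Heps.
    specialize (H t (fun P HP => HP) (mkposreal eps Heps)).
    destruct H as [d H].
    exists d. split; [apply cond_pos|]. intros s Hs. specialize (H s Hs).
    rewrite <- E, Cmod_norm. exact H.
  - intros H. split; [apply is_linear_scal_l|].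
    intros x Hx. apply (@is_filter_lim_locally_unique R_AbsRing (AbsRing_NormedModule R_AbsRing)) in Hx. subst x.
    intros [eps Heps]. destruct (H eps Heps) as (d & Hd & H').
    exists (mkposreal d Hd). intros s Hs. specialize (H' s Hs).
    rewrite <- E, Cmod_norm in H'. exact H'.
Qed.

Lemma is_cderive_ccontinuous f z l : is_cderive f z l -> ccontinuous f z.
Proof.
  intros H eps Heps. apply is_cderive_eps with (eps := 1%R) in H; [|lra].
  destruct H as (d & Hd & H).
  exists (Rmin d (eps / (2 + Cmod l))).
  pose proof (Cmod_ge_0 l) as Hl.
  assert (0 < eps / (2 + Cmod l))%R by (apply Rdiv_lt_0_compat; lra).
  split; [apply Rmin_glb_lt; auto|].
  intros w Hw.
  assert (H1 : (Cmod (w - z) < d)%R) by (exact (Rlt_Rmin_l _ _ _ Hw)).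
  assert (H2 : (Cmod (w - z) < eps / (2 + Cmod l))%R) by (exact (Rlt_Rmin_r _ _ _ Hw)).
  specialize (H w H1).
  replace (f w - f z) with ((f w - f z - l * (w - z)) + l * (w - z)) by ring.
  eapply Rle_lt_trans; [apply Cmod_triangle|]. rewrite Cmod_mult.
  apply Rmult_lt_compat_r with (r := (2 + Cmod l)%R) in H2; [|lra].
  unfold Rdiv in H2. rewrite Rmult_assoc, Rinv_l, Rmult_1_r in H2 by lra.
  pose proof (Cmod_ge_0 (w - z)). nra.
Qed.

Lemma is_cderive_eq f z l l' : is_cderive f z l -> l = l' -> is_cderive f z l'.
Proof. now intros H <-. Qed.

(** The two modules have the same operations and norm but are different terms: [holomorphic_on] uses
    [C_NormedModule], while the product and chain rules want the ring as a module over itself. *)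
Lemma is_derive_C_AbsRing f z l :
  is_cderive f z l <-> @is_derive C_AbsRing (AbsRing_NormedModule C_AbsRing) f z l.
Proof.
  split; intros H; (split; [apply is_linear_scal_l|]); destruct H as [_ H];
  intros x Hx eps; exact (H x Hx eps).
Qed.

Lemma is_cderive_const c z : is_cderive (fun _ => c) z 0.
Proof. apply (@is_derive_const C_AbsRing C_NormedModule). Qed.

Lemma is_cderive_id z : is_cderive (fun w => w) z 1.
Proof. apply is_derive_C_AbsRing, (@is_derive_id C_AbsRing). Qed.

Lemma is_cderive_plus f g z a b :
  is_cderive f z a -> is_cderive g z b -> is_cderive (fun w => f w + g w) z (a + b).
Proof. intros. now apply (@is_derive_plus C_AbsRing C_NormedModule). Qed.

Lemma is_cderive_minus f g z a b :
  is_cderive f z a -> is_cderive g z b -> is_cderive (fun w => f w - g w) z (a - b).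
Proof. intros. now apply (@is_derive_minus C_AbsRing C_NormedModule). Qed.

Lemma is_cderive_sub_const a z : is_cderive (fun w => w - a) z (1 - 0).
Proof. apply is_cderive_minus; [apply is_cderive_id|apply is_cderive_const]. Qed.

Lemma is_cderive_opp f z a :
  is_cderive f z a -> is_cderive (fun w => - f w) z (- a).
Proof. intros. now apply (@is_derive_opp C_AbsRing C_NormedModule). Qed.

Lemma is_cderive_mult f g z a b :
  is_cderive f z a -> is_cderive g z b ->
  is_cderive (fun w => f w * g w) z (a * g z + f z * b).
Proof.
  intros Hf Hg. apply is_derive_C_AbsRing.
  apply (@is_derive_mult C_AbsRing f g); try now apply is_derive_C_AbsRing.
  intros; apply Cmult_comm.
Qed.

Lemma is_cderive_comp f g z a b :
  is_cderive f (g z) a -> is_cderive g z b -> is_cderive (fun w => f (g w)) z (b * a).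
Proof.
  intros Hf Hg. apply (@is_derive_comp C_AbsRing C_NormedModule f g); auto.
  now apply is_derive_C_AbsRing.
Qed.

Lemma is_cderive_ext_near f g z l :
  (exists d, (0 < d)%R /\ forall w, (Cmod (w - z) < d)%R -> f w = g w) ->
  is_cderive f z l -> is_cderive g z l.
Proof.
  intros H. apply (@is_derive_ext_loc C_AbsRing C_NormedModule).
  now apply locally_C_eps.
Qed.

Lemma is_cderive_inv_at (z : C) : z <> 0 -> is_cderive (fun w => / w) z (- / (z * z)).
Proof.
  intros Hz. apply is_cderive_eps. intros eps Heps.
  assert (Hm := proj1 (Cmod_gt_0 z) Hz).
  set (m := Cmod z) in *.
  (* The remainder is [(w - z)^2 / (w * z^2)]. The first entry keeps [Cmod w] above [m / 2]; the
     second then brings the remainder below [eps * Cmod (w - z)]. *)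
  exists (Rmin (m / 2) (eps * (m * m * m) / 2)).
  assert (0 < m * m * m)%R by (repeat apply Rmult_lt_0_compat; lra).
  split; [apply Rmin_glb_lt; nra|].
  intros w Hw.
  assert (H1 : (Cmod (w - z) < m / 2)%R) by (exact (Rlt_Rmin_l _ _ _ Hw)).
  assert (H2 : (Cmod (w - z) < eps * (m * m * m) / 2)%R) by (exact (Rlt_Rmin_r _ _ _ Hw)).
  assert (H3 : (m / 2 < Cmod w)%R).
  { pose proof (Cmod_triangle_rev z w). rewrite Cmod_sub_sym in H0. fold m in H0. lra. }
  assert (Hw0 : w <> 0) by (apply Cmod_gt_0; lra).
  replace (/ w - / z - - / (z * z) * (w - z)) with ((w - z) * (w - z) / (w * (z * z))) by (field; auto).
  rewrite Cmod_div by (repeat apply Cmult_neq_0; auto).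
  rewrite !Cmod_mult. fold m.
  set (x := Cmod (w - z)) in *. set (y := Cmod w) in *.
  assert (0 <= x)%R by apply Cmod_ge_0.
  apply Rmult_le_reg_r with (y * (m * m))%R; [repeat apply Rmult_lt_0_compat; lra|].
  unfold Rdiv at 1. rewrite Rmult_assoc, Rinv_l by (repeat apply Rmult_integral_contrapositive_currified; lra).
  assert (eps * (m * m * m) / 2 <= eps * (y * (m * m)))%R.
  { assert (0 < eps * (m*m))%R by (repeat apply Rmult_lt_0_compat; lra). nra. }
  nra.
Qed.

Lemma is_cderive_div (f g : C -> C) (z a b : C) :
  g z <> 0 -> is_cderive f z a -> is_cderive g z b ->
  is_cderive (fun w => f w / g w) z ((a * g z - f z * b) / (g z * g z)).
Proof.
  intros Hz Hf Hg.
  eapply is_cderive_eq.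
  - apply (is_cderive_mult f (fun w => / g w)); [exact Hf|].
    apply (is_cderive_comp (fun w => / w) g); [apply is_cderive_inv_at; auto|exact Hg].
  - field; auto.
Qed.

Lemma is_path_derive_comp F (g : R -> C) t l v :
  is_cderive F (g t) l -> is_path_derive g t v ->
  is_path_derive (fun s => F (g s)) t (l * v).
Proof.
  intros HF Hg. apply is_path_derive_eps. intros eps Heps.
  assert (Hl := Cmod_ge_0 l). assert (Hv := Cmod_ge_0 v).
  destruct (proj1 (is_cderive_eps _ _ _) HF (eps / (2 * (1 + Cmod v)))%R) as (d1 & Hd1 & H1).
  { apply Rdiv_lt_0_compat; lra. }
  (* The cap 1 gives the Lipschitz bound [(1 + Cmod v) * x] on the increment of [g], at which the
     error of [F] is evaluated; the other entry keeps the error of [g] small after multiplication by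
     [l]. *)
  destruct (proj1 (is_path_derive_eps _ _ _) Hg (Rmin 1 (eps / (2 * (1 + Cmod l))))%R) as (d2 & Hd2 & H2).
  { apply Rmin_glb_lt; [lra|]. apply Rdiv_lt_0_compat; lra. }
  exists (Rmin d2 (d1 / (1 + Cmod v))).
  split; [apply Rmin_glb_lt; auto; apply Rdiv_lt_0_compat; lra|].
  intros s Hs.
  assert (Hs2 : (Rabs (s - t) < d2)%R) by (exact (Rlt_Rmin_l _ _ _ Hs)).
  assert (Hs1 : (Rabs (s - t) < d1 / (1 + Cmod v))%R) by (exact (Rlt_Rmin_r _ _ _ Hs)).
  specialize (H2 s Hs2).
  set (x := Rabs (s - t)) in *. assert (Hx : (0 <= x)%R) by apply Rabs_pos.
  assert (Ha : (Cmod (g s - g t) <= (1 + Cmod v) * x)%R).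
  { replace (g s - g t) with ((g s - g t - RtoC (s - t) * v) + RtoC (s - t) * v) by ring.
    eapply Rle_trans; [apply Cmod_triangle|]. rewrite Cmod_mult, Cmod_R. fold x.
    assert (Rmin 1 (eps / (2 * (1 + Cmod l))) <= 1)%R by apply Rmin_l. nra. }
  assert (Hb : (Cmod (g s - g t) < d1)%R).
  { eapply Rle_lt_trans; [exact Ha|]. apply Rmult_lt_reg_r with (/ (1 + Cmod v))%R.
    apply Rinv_0_lt_compat; lra.
    replace ((1 + Cmod v) * x * / (1 + Cmod v))%R with x by (field; lra). exact Hs1. }
  specialize (H1 _ Hb).
  replace (F (g s) - F (g t) - RtoC (s - t) * (l * v)) with
    ((F (g s) - F (g t) - l * (g s - g t)) + l * (g s - g t - RtoC (s - t) * v)) by ring.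
  eapply Rle_trans; [apply Cmod_triangle|]. rewrite Cmod_mult.
  assert (Hc : (eps / (2 * (1 + Cmod v)) * Cmod (g s - g t) <= eps / 2 * x)%R).
  { replace (eps / 2 * x)%R with (eps / (2 * (1 + Cmod v)) * ((1 + Cmod v) * x))%R by (field; lra).
    apply Rmult_le_compat_l; auto. apply Rlt_le, Rdiv_lt_0_compat; lra. }
  assert (Hd : (Cmod l * Cmod (g s - g t - RtoC (s - t) * v) <= eps / 2 * x)%R).
  { apply Rle_trans with (Cmod l * (eps / (2 * (1 + Cmod l)) * x))%R.
    - apply Rmult_le_compat_l; auto. eapply Rle_trans; [exact H2|].
      apply Rmult_le_compat_r; auto. apply Rmin_r.
    - replace (eps / 2 * x)%R with ((1 + Cmod l) * (eps / (2 * (1 + Cmod l)) * x))%R by (field; lra).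
      apply Rmult_le_compat_r; [|lra]. apply Rmult_le_pos; auto.
      apply Rlt_le, Rdiv_lt_0_compat; lra. }
  lra.
Qed.

Lemma is_path_derive_pair (u v : R -> R) t a b :
  is_derive u t a -> is_derive v t b -> is_path_derive (fun s => (u s, v s)) t (a, b).
Proof.
  assert (E : forall (u : R -> R) a, is_derive u t a -> forall eps, (0 < eps)%R ->
    exists d, (0 < d)%R /\ forall s, (Rabs (s - t) < d)%R ->
      (Rabs (u s - u t - (s - t) * a) <= eps * Rabs (s - t))%R).
  { clear. intros u a [_ H] eps Heps.
    destruct (H t (fun P HP => HP) (mkposreal eps Heps)) as [d H'].
    exists d. split; [apply cond_pos|]. intros s Hs. exact (H' s Hs). }
  intros Hu Hv. apply is_path_derive_eps. intros eps Heps.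
  destruct (E u a Hu (eps / 2)%R) as (d1 & Hd1 & H1); [lra|].
  destruct (E v b Hv (eps / 2)%R) as (d2 & Hd2 & H2); [lra|].
  exists (Rmin d1 d2). split; [now apply Rmin_glb_lt|].
  intros s Hs.
  assert (Hs1 : (Rabs (s - t) < d1)%R) by (exact (Rlt_Rmin_l _ _ _ Hs)).
  assert (Hs2 : (Rabs (s - t) < d2)%R) by (exact (Rlt_Rmin_r _ _ _ Hs)).
  specialize (H1 s Hs1). specialize (H2 s Hs2).
  eapply Rle_trans; [apply Cmod_le_Re_Im|].
  match goal with |- (Rabs ?X + Rabs ?Y <= _)%R =>
    replace X with (u s - u t - (s - t) * a)%R by (simpl; ring);
    replace Y with (v s - v t - (s - t) * b)%R by (simpl; ring) end.
  lra.
Qed.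

Lemma is_path_derive_line a b t : is_path_derive (fun s => a + RtoC s * b) t b.
Proof.
  apply is_path_derive_eps. intros eps Heps. exists 1%R. split; [lra|]. intros s _.
  replace (a + s * b - (a + t * b) - (s - t)%R * b) with (RtoC 0).
  - rewrite Cmod_0. apply Rmult_le_pos; [lra|apply Rabs_pos].
  - rewrite RtoC_minus. ring.
Qed.

Definition path_continuous_at (g : R -> C) (t : R) : Prop :=
  forall eps, (0 < eps)%R -> exists d, (0 < d)%R /\
    forall s, (Rabs (s - t) < d)%R -> (Cmod (g s - g t) < eps)%R.

Definition path_continuous (g : R -> C) : Prop := forall t, path_continuous_at g t.

Lemma continuous_R_C (g : R -> C) t :
  path_continuous_at g t ->
  @continuous R_UniformSpace (CompleteNormedModule.UniformSpace R_AbsRing C_R_CompleteNormedModule) g t.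
Proof.
  intros H P [eps HP]. destruct (H eps (cond_pos eps)) as (d & Hd & H').
  exists (mkposreal d Hd). intros s Hs. apply HP. specialize (H' s Hs).
  pose proof (re_le_Cmod (g s - g t)) as Hr. pose proof (im_le_Cmod (g s - g t)) as Hi.
  split; unfold ball; simpl; unfold AbsRing_ball, abs, minus, plus, opp; simpl;
    unfold Re, Im in *; simpl in *; eapply Rle_lt_trans; try eassumption; lra.
Qed.

Lemma is_path_derive_continuous (g : R -> C) t l :
  is_path_derive g t l -> path_continuous_at g t.
Proof.
  intros H eps Heps. apply is_path_derive_eps with (eps := 1%R) in H; [|lra].
  destruct H as (d & Hd & H). assert (Hl := Cmod_ge_0 l).
  exists (Rmin d (eps / (2 + Cmod l))).
  split; [apply Rmin_glb_lt; auto; apply Rdiv_lt_0_compat; lra|].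
  intros s Hs.
  assert (H1 : (Rabs (s - t) < d)%R) by (exact (Rlt_Rmin_l _ _ _ Hs)).
  assert (H2 : (Rabs (s - t) < eps / (2 + Cmod l))%R) by (exact (Rlt_Rmin_r _ _ _ Hs)).
  specialize (H s H1).
  replace (g s - g t) with ((g s - g t - RtoC (s - t) * l) + RtoC (s - t) * l) by ring.
  eapply Rle_lt_trans; [apply Cmod_triangle|]. rewrite Cmod_mult, Cmod_R.
  apply Rmult_lt_compat_r with (r := (2 + Cmod l)%R) in H2; [|lra].
  unfold Rdiv in H2. rewrite Rmult_assoc, Rinv_l, Rmult_1_r in H2 by lra.
  pose proof (Rabs_pos (s - t)). nra.
Qed.

Lemma continuous_comp_path (f : C -> C) (g : R -> C) t :
  ccontinuous f (g t) -> path_continuous_at g t -> path_continuous_at (fun s => f (g s)) t.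
Proof.
  intros Hf Hg eps Heps. destruct (Hf eps Heps) as (d & Hd & H).
  destruct (Hg d Hd) as (d' & Hd' & H'). exists d'. split; auto.
Qed.

(** * Segment integrals and Goursat's theorem *)

Definition Cint (g : R -> C) (a b : R) : C := @RInt C_R_CompleteNormedModule g a b.

Definition segment_point (a b : C) (t : R) : C := a + RtoC t * (b - a).

Definition segment_integral (f : C -> C) (a b : C) : C :=
  Cint (fun t => f (segment_point a b t) * (b - a)) 0 1.

Definition continuous_on_segment (f : C -> C) (a b : C) : Prop :=
  forall t, (0 <= t <= 1)%R -> ccontinuous f (segment_point a b t).

Lemma is_path_derive_segment a b t : is_path_derive (segment_point a b) t (b - a).
Proof. apply is_path_derive_line. Qed.

Lemma ccontinuous_mult_const f c z : ccontinuous f z -> ccontinuous (fun w => f w * c) z.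
Proof.
  intros H eps Heps. assert (Hc := Cmod_ge_0 c).
  destruct (H (eps / (1 + Cmod c))%R) as (d & Hd & H'); [apply Rdiv_lt_0_compat; lra|].
  exists d. split; auto. intros w Hw. specialize (H' w Hw).
  replace (f w * c - f z * c) with ((f w - f z) * c) by ring. rewrite Cmod_mult.
  apply Rmult_lt_compat_r with (r := (1 + Cmod c)%R) in H'; [|lra].
  unfold Rdiv in H'. rewrite Rmult_assoc, Rinv_l, Rmult_1_r in H' by lra.
  pose proof (Cmod_ge_0 (f w - f z)). nra.
Qed.

Lemma segment_integrable f a b :
  continuous_on_segment f a b ->
  @ex_RInt C_R_NormedModule (fun t => f (segment_point a b t) * (b - a)) 0 1.
Proof.
  intros H. apply (@ex_RInt_continuous C_R_CompleteNormedModule). intros t Ht.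
  rewrite Rmin_left, Rmax_right in Ht by lra.
  apply continuous_R_C.
  apply (continuous_comp_path (fun w => f w * (b - a)) (segment_point a b)).
  - now apply ccontinuous_mult_const, H.
  - eapply is_path_derive_continuous, is_path_derive_segment.
Qed.

Lemma segment_integral_correct f a b :
  continuous_on_segment f a b ->
  @is_RInt C_R_NormedModule (fun t => f (segment_point a b t) * (b - a)) 0 1
    (segment_integral f a b).
Proof. intros H. apply (@RInt_correct C_R_CompleteNormedModule). now apply segment_integrable. Qed.

Lemma segment_integral_primitive G g a b :
  continuous_on_segment g a b ->
  (forall t, (0 <= t <= 1)%R -> is_cderive G (segment_point a b t) (g (segment_point a b t))) ->
  @is_RInt C_R_NormedModule (fun t => g (segment_point a b t) * (b - a)) 0 1 (G b - G a).
Proof.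
  intros Hc Hd.
  replace (G b - G a) with (G (segment_point a b 1) - G (segment_point a b 0)).
  2: { unfold segment_point. f_equal; [|f_equal]; f_equal; ring. }
  apply (@is_RInt_derive C_R_CompleteNormedModule (fun t => G (segment_point a b t))).
  - intros t Ht. rewrite Rmin_left, Rmax_right in Ht by lra.
    apply is_path_derive_comp; [now apply Hd | apply is_path_derive_segment].
  - intros t Ht. rewrite Rmin_left, Rmax_right in Ht by lra.
    apply continuous_R_C.
    apply (continuous_comp_path (fun w => g w * (b - a)) (segment_point a b)).
    + now apply ccontinuous_mult_const, Hc.
    + eapply is_path_derive_continuous, is_path_derive_segment.
Qed.

(** The main way of estimating an integral here: compare the integrand with a [g] whose primitive is
    known. In Goursat's theorem [g] is affine, in the construction of primitives it is constant. *)
Lemma segment_integral_near_primitive f G g a b M :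
  continuous_on_segment f a b -> continuous_on_segment g a b ->
  (forall t, (0 <= t <= 1)%R -> is_cderive G (segment_point a b t) (g (segment_point a b t))) ->
  (forall t, (0 <= t <= 1)%R -> (Cmod (f (segment_point a b t) - g (segment_point a b t)) <= M)%R) ->
  (Cmod (segment_integral f a b - (G b - G a)) <= M * Cmod (b - a))%R.
Proof.
  intros Hf Hg HG HM.
  pose proof (@is_RInt_minus C_R_NormedModule _ _ _ _ _ _
    (segment_integral_correct f a b Hf) (segment_integral_primitive G g a b Hg HG)) as H.
  apply (norm_RInt_le_const _ _ _ _ (M * Cmod (b - a))) in H; [|lra|].
  - rewrite Cmod_norm. rewrite Rminus_0_r, Rmult_1_l in H. exact H.
  - intros t Ht. rewrite <- Cmod_norm.
    change (Cmod (f (segment_point a b t) * (b - a) - g (segment_point a b t) * (b - a))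
      <= M * Cmod (b - a))%R.
    replace (f (segment_point a b t) * (b - a) - g (segment_point a b t) * (b - a))
      with ((f (segment_point a b t) - g (segment_point a b t)) * (b - a)) by ring.
    rewrite Cmod_mult. apply Rmult_le_compat_r; [apply Cmod_ge_0|auto].
Qed.

Lemma segment_integral_reverse f a b :
  continuous_on_segment f a b ->
  segment_integral f b a = - segment_integral f a b.
Proof.
  intros H. unfold segment_integral, Cint at 1.
  set (g := fun t : R => f (segment_point a b t) * (b - a)).
  pose proof (@opp_RInt_swap C_R_CompleteNormedModule g 0 1 (segment_integrable f a b H)) as Hs.
  pose proof (@RInt_comp_lin C_R_CompleteNormedModule g (-1) 1 0 1) as Hl.
  replace (-1 * 0 + 1)%R with 1%R in Hl by ring. replace (-1 * 1 + 1)%R with 0%R in Hl by ring.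
  etransitivity; [|symmetry; exact Hs].
  etransitivity; [|apply Hl, (@ex_RInt_swap C_R_NormedModule), segment_integrable, H].
  apply (@RInt_ext C_R_CompleteNormedModule).
  intros t _. unfold g, segment_point.
  replace (a + RtoC (-1 * t + 1) * (b - a)) with (b + t * (a - b))
    by (rewrite RtoC_plus, RtoC_mult,  ?RtoC_opp; change (RtoC (-1)) with (RtoC (Ropp 1)); rewrite RtoC_opp; ring).
  apply injective_projections; simpl; unfold scal; simpl; unfold mult; simpl; ring.
Qed.

Definition midpoint (a b : C) : C := (a + b) / 2.

Lemma segment_point_midpoint_l a b t : segment_point a (midpoint a b) t = segment_point a b (t / 2).
Proof. unfold segment_point, midpoint. rewrite RtoC_div by lra. field. Qed.

Lemma segment_point_midpoint_r a b t :
  segment_point (midpoint a b) b t = segment_point a b (t / 2 + 1 / 2).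
Proof. unfold segment_point, midpoint. rewrite RtoC_plus, !RtoC_div by lra. field. Qed.

Lemma segment_integral_midpoint f a b :
  continuous_on_segment f a b ->
  segment_integral f a b = segment_integral f a (midpoint a b) + segment_integral f (midpoint a b) b.
Proof.
  intros H.
  set (g := fun t : R => f (segment_point a b t) * (b - a)).
  assert (Hi : @ex_RInt C_R_NormedModule g 0 1) by now apply segment_integrable.
  assert (H1 : @ex_RInt C_R_NormedModule g 0 (1/2))
    by (apply (@ex_RInt_Chasles_1 C_R_CompleteNormedModule) with 1%R; [lra|auto]).
  assert (H2 : @ex_RInt C_R_NormedModule g (1/2) 1)
    by (apply (@ex_RInt_Chasles_2 C_R_CompleteNormedModule) with 0%R; [lra|auto]).
  assert (S : forall (x : C), @scal R_AbsRing C_R_NormedModule (1/2)%R x = RtoC (1/2) * x).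
  { intros [x y]. unfold RtoC. apply injective_projections; simpl;
    unfold scal, mult; simpl; unfold mult; simpl; ring. }
  pose proof (@RInt_comp_lin C_R_CompleteNormedModule g (1/2) 0 0 1) as Hl.
  replace (1/2 * 0 + 0)%R with 0%R in Hl by ring. replace (1/2 * 1 + 0)%R with (1/2)%R in Hl by ring.
  pose proof (@RInt_comp_lin C_R_CompleteNormedModule g (1/2) (1/2) 0 1) as Hr.
  replace (1/2 * 0 + 1/2)%R with (1/2)%R in Hr by ring. replace (1/2 * 1 + 1/2)%R with 1%R in Hr by field.
  etransitivity; [symmetry; apply (@RInt_Chasles C_R_CompleteNormedModule g 0 (1/2) 1 H1 H2)|].
  rewrite <- Hl, <- Hr by auto. unfold segment_integral, Cint.
  apply (f_equal2 Cplus); apply (@RInt_ext C_R_CompleteNormedModule); intros t _;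
    (etransitivity; [apply S|]); unfold g.
  - rewrite segment_point_midpoint_l.
    replace (1/2 * t + 0)%R with (t/2)%R by field.
    match goal with |- @eq _ ?x ?y => change (@eq C x y) end.
    unfold midpoint. rewrite RtoC_div by lra. field.
  - rewrite segment_point_midpoint_r.
    replace (1/2 * t + 1/2)%R with (t/2 + 1/2)%R by field.
    match goal with |- @eq _ ?x ?y => change (@eq C x y) end.
    unfold midpoint. rewrite RtoC_div by lra. field.
Qed.

Lemma real_sequence_geometric_limit (x : nat -> R) (p : R) :
  (forall n, (Rabs (x (S n) - x n) <= p / 2 ^ n)%R) ->
  exists l : R, forall n, (Rabs (x n - l) <= 2 * p / 2 ^ n)%R.
Proof.
  intros H.
  assert (Hpow : forall n, (0 < 2 ^ n)%R) by (intros; apply pow_lt; lra).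
  assert (Hp : (0 <= p)%R).
  { specialize (H O). simpl in H. pose proof (Rabs_pos (x 1%nat - x 0%nat)). lra. }
  (* Keeping the subtracted tail of the geometric series makes the induction on [k] close; it is
     dropped in [Hb]. *)
  assert (Hnk : forall n k, (Rabs (x (n + k)%nat - x n) <= 2 * p / 2 ^ n - 2 * p / 2 ^ (n + k))%R).
  { intros n k. induction k.
    - rewrite Nat.add_0_r, Rminus_diag, Rabs_R0. lra.
    - rewrite Nat.add_succ_r.
      replace (x (S (n + k)) - x n)%R with ((x (S (n + k)) - x (n + k)%nat) + (x (n + k)%nat - x n))%R by ring.
      eapply Rle_trans; [apply Rabs_triang|]. specialize (H (n + k)%nat).
      replace (2 * p / 2 ^ S (n + k))%R with (2 * p / 2 ^ (n + k) - p / 2 ^ (n + k))%R.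
      lra. simpl. field. apply Rgt_not_eq, Hpow. }
  assert (Hb : forall n k, (Rabs (x (n + k)%nat - x n) <= 2 * p / 2 ^ n)%R).
  { intros n k. specialize (Hnk n k).
    assert (0 <= 2 * p / 2 ^ (n + k))%R by (apply Rdiv_le_0_compat; [lra|apply Hpow]). lra. }
  assert (Hc : ex_finite_lim_seq x).
  { apply ex_lim_seq_cauchy_corr. intros [eps Heps]. simpl.
    destruct (pow_lt_1_zero (1/2) ltac:(rewrite Rabs_right; lra) (eps / (4 * (p + 1)))%R) as [N HN].
    { apply Rdiv_lt_0_compat; lra. }
    exists N. intros n m Hn Hm.
    specialize (HN N (Nat.le_refl N)).
    replace ((1/2) ^ N)%R with (/ 2 ^ N)%R in HN
      by (unfold Rdiv; rewrite Rmult_1_l, <- pow_inv by lra; reflexivity).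
    rewrite Rabs_right in HN by (apply Rle_ge, Rlt_le, Rinv_0_lt_compat, Hpow).
    pose proof (Hb N (n - N)%nat) as H1. pose proof (Hb N (m - N)%nat) as H2.
    replace (N + (n - N))%nat with n in H1 by lia. replace (N + (m - N))%nat with m in H2 by lia.
    replace (x n - x m)%R with ((x n - x N) - (x m - x N))%R by ring.
    assert (Hlt : (4 * p * / 2 ^ N < eps)%R).
    { apply Rle_lt_trans with (4 * (p + 1) * / 2 ^ N)%R.
      - apply Rmult_le_compat_r; [apply Rlt_le, Rinv_0_lt_compat, Hpow|lra].
      - apply Rmult_lt_compat_l with (r := (4 * (p + 1))%R) in HN; [|lra].
        replace (4 * (p + 1) * (eps / (4 * (p + 1))))%R with eps in HN by (field; lra). exact HN. }
    unfold Rdiv in H1, H2.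
    assert (T := Rabs_triang (x n - x N) (- (x m - x N))). rewrite Rabs_Ropp in T.
    unfold Rminus at 1. lra. }
  destruct Hc as [l Hl]. exists l. intros n.
  assert (Hlim : is_lim_seq (fun k => Rabs (x (n + k)%nat - x n)) (Rabs (l - x n))).
  { apply (is_lim_seq_abs _ (Finite (l - x n))). apply is_lim_seq_minus'; [|apply is_lim_seq_const].
    apply (is_lim_seq_ext (fun k => x (k + n)%nat)); [intros k; f_equal; lia|].
    now apply is_lim_seq_incr_n. }
  rewrite Rabs_minus_sym.
  exact (is_lim_seq_le _ _ _ _ (Hb n) Hlim (is_lim_seq_const _)).
Qed.

Lemma sequence_geometric_limit (x : nat -> C) (p : R) :
  (forall n, (Cmod (x (S n) - x n) <= p / 2 ^ n)%R) ->
  exists l : C, forall n, (Cmod (x n - l) <= 4 * p / 2 ^ n)%R.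
Proof.
  intros H.
  destruct (real_sequence_geometric_limit (fun n => Re (x n)) p) as [a Ha].
  { intros n. eapply Rle_trans; [|apply H]. apply (re_le_Cmod (x (S n) - x n)). }
  destruct (real_sequence_geometric_limit (fun n => Im (x n)) p) as [b Hb].
  { intros n. eapply Rle_trans; [|apply H]. apply (im_le_Cmod (x (S n) - x n)). }
  exists (a, b). intros n. eapply Rle_trans; [apply Cmod_le_Re_Im|].
  specialize (Ha n). specialize (Hb n).
  replace (4 * p / 2 ^ n)%R with (2 * p / 2 ^ n + 2 * p / 2 ^ n)%R by (unfold Rdiv; ring).
  apply Rplus_le_compat; assumption.
Qed.

(** These two closure properties are what the bisection argument uses: midpoints stay in [K], and so
    does the limit of the chosen triangles, where [f] must be differentiable. *)
Record closed_convex (K : C -> Prop) : Prop := {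
  closed_convex_segment : forall a b t, K a -> K b -> (0 <= t <= 1)%R -> K (segment_point a b t);
  closed_convex_limit : forall (x : nat -> C) l, (forall n, K (x n)) ->
    (forall eps, (0 < eps)%R -> exists n, (Cmod (x n - l) < eps)%R) -> K l
}.

Definition triangle_integral (f : C -> C) (t : C * C * C) : C :=
  let '(a, b, c) := t in segment_integral f a b + segment_integral f b c + segment_integral f c a.

Definition perimeter (t : C * C * C) : R :=
  let '(a, b, c) := t in (Cmod (b - a) + Cmod (c - b) + Cmod (a - c))%R.

Definition triangle_in (K : C -> Prop) (t : C * C * C) : Prop :=
  let '(a, b, c) := t in K a /\ K b /\ K c.

Lemma continuous_on_segment_in_convex K f a b :
  closed_convex K -> (forall z, K z -> ccontinuous f z) -> K a -> K b ->
  continuous_on_segment f a b.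
Proof. intros HK Hf Ha Hb t Ht. apply Hf. now apply closed_convex_segment. Qed.

Lemma midpoint_in K a b : closed_convex K -> K a -> K b -> K (midpoint a b).
Proof.
  intros HK Ha Hb.
  replace (midpoint a b) with (segment_point a b (1/2)).
  - apply closed_convex_segment; auto; lra.
  - unfold segment_point, midpoint. rewrite RtoC_div by lra. field.
Qed.

Lemma midpoint_sym a b : midpoint a b = midpoint b a.
Proof. unfold midpoint. f_equal. ring. Qed.

Lemma triangle_integral_split K f a b c :
  closed_convex K -> (forall z, K z -> ccontinuous f z) -> K a -> K b -> K c ->
  triangle_integral f (a, b, c) =
  triangle_integral f (a, midpoint a b, midpoint a c) +
  triangle_integral f (b, midpoint b c, midpoint b a) +
  triangle_integral f (c, midpoint c a, midpoint c b) +
  triangle_integral f (midpoint a b, midpoint b c, midpoint a c).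
Proof.
  intros HK Hf Ha Hb Hc. unfold triangle_integral.
  assert (Hm : forall x y, K x -> K y -> K (midpoint x y)) by (intros; now apply midpoint_in).
  assert (Hs : forall x y, K x -> K y -> continuous_on_segment f x y)
    by (intros; now apply continuous_on_segment_in_convex with K).
  rewrite (segment_integral_midpoint f a b), (segment_integral_midpoint f b c),
    (segment_integral_midpoint f c a) by auto.
  rewrite (midpoint_sym b a), (midpoint_sym c a), (midpoint_sym c b).
  rewrite (segment_integral_reverse f (midpoint a b) (midpoint a c)) by auto.
  rewrite (segment_integral_reverse f (midpoint a b) (midpoint b c)) by auto.
  rewrite (segment_integral_reverse f (midpoint b c) (midpoint a c)) by auto.
  ring.
Qed.

Lemma Cmod_half_sub a b c : Cmod (midpoint a b - midpoint a c) = (Cmod (b - c) / 2)%R.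
Proof.
  unfold midpoint. replace ((a + b) / 2 - (a + c) / 2) with ((b - c) / 2) by field.
  rewrite Cmod_div by (intros E; apply RtoC_inj in E; lra). rewrite Cmod_R, Rabs_right; lra.
Qed.

Lemma Cmod_midpoint_sub a b : Cmod (midpoint a b - a) = (Cmod (b - a) / 2)%R.
Proof.
  unfold midpoint. replace ((a + b) / 2 - a) with ((b - a) / 2) by field.
  rewrite Cmod_div by (intros E; apply RtoC_inj in E; lra). rewrite Cmod_R, Rabs_right; lra.
Qed.

(** Among the four triangles cut out by the midpoints, one carries at least a quarter of the
    integral. The bound on the first vertices stands in for nestedness: together with the halved
    perimeters it makes them converge. *)
Lemma goursat_step K f t :
  closed_convex K -> (forall z, K z -> ccontinuous f z) -> triangle_in K t ->
  exists t', triangle_in K t' /\ perimeter t' = (perimeter t / 2)%R /\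
    (Cmod (fst (fst t') - fst (fst t)) <= perimeter t)%R /\
    (Cmod (triangle_integral f t) <= 4 * Cmod (triangle_integral f t'))%R.
Proof.
  intros HK Hf. destruct t as [[a b] c]. intros (Ha & Hb & Hc).
  pose proof (triangle_integral_split K f a b c HK Hf Ha Hb Hc) as E.
  assert (Hm : forall x y, K x -> K y -> K (midpoint x y)) by (intros; now apply midpoint_in).
  set (t1 := (a, midpoint a b, midpoint a c)) in *.
  set (t2 := (b, midpoint b c, midpoint b a)) in *.
  set (t3 := (c, midpoint c a, midpoint c b)) in *.
  set (t4 := (midpoint a b, midpoint b c, midpoint a c)) in *.
  assert (Hle : (Cmod (triangle_integral f (a, b, c)) <= Cmod (triangle_integral f t1) +
    Cmod (triangle_integral f t2) + Cmod (triangle_integral f t3) + Cmod (triangle_integral f t4))%R).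
  { rewrite E. eapply Rle_trans; [apply Cmod_triangle|]. apply Rplus_le_compat_r.
    eapply Rle_trans; [apply Cmod_triangle|]. apply Rplus_le_compat_r. apply Cmod_triangle. }
  assert (D : exists t', (t' = t1 \/ t' = t2 \/ t' = t3 \/ t' = t4) /\
    (Cmod (triangle_integral f (a, b, c)) <= 4 * Cmod (triangle_integral f t'))%R).
  { destruct (Rle_dec (Cmod (triangle_integral f (a, b, c))) (4 * Cmod (triangle_integral f t1))); [eauto|].
    destruct (Rle_dec (Cmod (triangle_integral f (a, b, c))) (4 * Cmod (triangle_integral f t2))); [eauto|].
    destruct (Rle_dec (Cmod (triangle_integral f (a, b, c))) (4 * Cmod (triangle_integral f t3))); [eauto 6|].
    exists t4. split; [auto|lra]. }
  destruct D as (t' & Ht' & D). exists t'.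
  pose proof (Cmod_ge_0 (b - a)). pose proof (Cmod_ge_0 (c - b)). pose proof (Cmod_ge_0 (a - c)).
  split; [|split; [|split; [|exact D]]];
  destruct Ht' as [-> | [-> | [-> | ->]]]; unfold t1, t2, t3, t4, triangle_in, perimeter; simpl fst;
    try solve [repeat split; auto];
    rewrite ?(midpoint_sym b a), ?(midpoint_sym c a), ?(midpoint_sym c b).
  - rewrite Cmod_midpoint_sub, Cmod_half_sub, (Cmod_sub_sym a (midpoint a c)), Cmod_midpoint_sub,
      (Cmod_sub_sym c a). lra.
  - rewrite (midpoint_sym a b), Cmod_midpoint_sub, Cmod_half_sub, (Cmod_sub_sym b (midpoint b a)),
      Cmod_midpoint_sub, (Cmod_sub_sym a b). lra.
  - rewrite (midpoint_sym a c), (midpoint_sym b c), Cmod_midpoint_sub, Cmod_half_sub,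
      (Cmod_sub_sym c (midpoint c b)), Cmod_midpoint_sub, (Cmod_sub_sym b a), (Cmod_sub_sym b c). lra.
  - rewrite Cmod_half_sub, (midpoint_sym a b), Cmod_half_sub.
    rewrite (midpoint_sym a c), (midpoint_sym b c), Cmod_half_sub, (Cmod_sub_sym c a), (Cmod_sub_sym b c),
      (Cmod_sub_sym b a). lra.
  - rewrite (Cmod_sub_diag a). lra.
  - lra.
  - rewrite (Cmod_sub_sym c a). lra.
  - rewrite Cmod_midpoint_sub. lra.
Qed.

Lemma segment_point_close a b t l :
  (0 <= t <= 1)%R -> (Cmod (segment_point a b t - l) <= Cmod (a - l) + Cmod (b - a))%R.
Proof.
  intros Ht. unfold segment_point.
  replace (a + t * (b - a) - l) with ((a - l) + t * (b - a)) by ring.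
  eapply Rle_trans; [apply Cmod_triangle|]. rewrite Cmod_mult, Cmod_R, Rabs_right by lra.
  pose proof (Cmod_ge_0 (b - a)). nra.
Qed.

Lemma is_cderive_quadratic c L l w :
  is_cderive (fun w => c * w + L / 2 * ((w - l) * (w - l))) w (c + L * (w - l)).
Proof.
  eapply is_cderive_eq.
  - apply is_cderive_plus.
    + apply (is_cderive_mult (fun _ => c) (fun w => w)); [apply is_cderive_const|apply is_cderive_id].
    + apply (is_cderive_mult (fun _ => L / 2) (fun w => (w - l) * (w - l))); [apply is_cderive_const|].
      exact (is_cderive_mult _ _ _ _ _ (is_cderive_sub_const _ _) (is_cderive_sub_const _ _)).
  - cbv beta. field.
Qed.

Lemma ccontinuous_affine c L l w : ccontinuous (fun w => c + L * (w - l)) w.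
Proof.
  eapply is_cderive_ccontinuous. apply is_cderive_plus; [apply is_cderive_const|].
  apply (is_cderive_mult (fun _ => L) (fun w => w - l)); [apply is_cderive_const|].
  apply is_cderive_sub_const.
Qed.

Theorem goursat K f a b c :
  closed_convex K -> (forall z, K z -> exists l, is_cderive f z l) -> K a -> K b -> K c ->
  triangle_integral f (a, b, c) = 0.
Proof.
  intros HK Hf Ha Hb Hc.
  assert (Hcont : forall z, K z -> ccontinuous f z).
  { intros z Hz. destruct (Hf z Hz) as [l Hl]. now apply is_cderive_ccontinuous with l. }
  set (good := fun t t' => triangle_in K t' /\ perimeter t' = (perimeter t / 2)%R /\
    (Cmod (fst (fst t') - fst (fst t)) <= perimeter t)%R /\
    (Cmod (triangle_integral f t) <= 4 * Cmod (triangle_integral f t'))%R).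
  set (next := fun t => epsilon (inhabits t) (good t)).
  assert (Hnext : forall t, triangle_in K t -> good t (next t)).
  { intros t Ht. apply epsilon_spec. now apply goursat_step. }
  set (tri := fun n => Nat.iter n next (a, b, c)).
  assert (Hin : forall n, triangle_in K (tri n)).
  { induction n; [simpl; auto|]. simpl. now apply Hnext. }
  set (p := perimeter (a, b, c)).
  assert (Hper : forall n, perimeter (tri n) = (p / 2 ^ n)%R).
  { induction n; [simpl; unfold p, perimeter; field|].
    change (tri (S n)) with (next (tri n)).
    destruct (Hnext _ (Hin n)) as (_ & -> & _). rewrite IHn. simpl. field. apply pow_nonzero. lra. }
  assert (Hint : forall n, (Cmod (triangle_integral f (a, b, c)) <= 4 ^ n * Cmod (triangle_integral f (tri n)))%R).
  { induction n; [simpl pow; simpl tri; lra|].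
    change (tri (S n)) with (next (tri n)).
    destruct (Hnext _ (Hin n)) as (_ & _ & _ & H). eapply Rle_trans; [exact IHn|].
    simpl pow. replace (4 * 4 ^ n * Cmod (triangle_integral f (next (tri n))))%R
      with (4 ^ n * (4 * Cmod (triangle_integral f (next (tri n)))))%R by ring.
    apply Rmult_le_compat_l; auto. apply pow_le; lra. }
  destruct (sequence_geometric_limit (fun n => fst (fst (tri n))) p) as [l Hl].
  { intros n. rewrite <- Hper. change (tri (S n)) with (next (tri n)). apply (Hnext _ (Hin n)). }
  assert (Hp0 : (0 <= p)%R).
  { unfold p, perimeter. pose proof (Cmod_ge_0 (b - a)). pose proof (Cmod_ge_0 (c - b)).
    pose proof (Cmod_ge_0 (a - c)). lra. }
  (* The factor 5 comes from the distance of the first vertex to [l], at most [4 * p / 2 ^ n], plus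
     the perimeter [p / 2 ^ n]. *)
  assert (Hsmall : forall d, (0 < d)%R -> exists n, (5 * (p / 2 ^ n) < d)%R).
  { intros d Hd.
    destruct (pow_lt_1_zero (1/2) ltac:(rewrite Rabs_right; lra) (d / (5 * (p + 1)))%R) as [N HN].
    { apply Rdiv_lt_0_compat; lra. }
    exists N. specialize (HN N (Nat.le_refl N)).
    replace ((1/2) ^ N)%R with (/ 2 ^ N)%R in HN
      by (unfold Rdiv; rewrite Rmult_1_l, <- pow_inv by lra; reflexivity).
    assert (0 < / 2 ^ N)%R by (apply Rinv_0_lt_compat, pow_lt; lra).
    rewrite Rabs_right in HN by lra.
    apply Rmult_lt_compat_l with (r := (5 * (p + 1))%R) in HN; [|lra].
    replace (5 * (p + 1) * (d / (5 * (p + 1))))%R with d in HN by (field; lra).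
    unfold Rdiv. nra. }
  assert (HKl : K l).
  { apply (closed_convex_limit K HK (fun n => fst (fst (tri n)))).
    - intros n. specialize (Hin n). destruct (tri n) as [[x y] z]. apply Hin.
    - intros eps Heps. destruct (Hsmall eps Heps) as [n Hn]. exists n.
      eapply Rle_lt_trans; [apply Hl|]. eapply Rle_lt_trans; [|exact Hn].
      replace (4 * p / 2 ^ n)%R with (4 * (p / 2 ^ n))%R by (unfold Rdiv; ring).
      assert (0 <= p / 2 ^ n)%R by (apply Rdiv_le_0_compat; [lra|apply pow_lt; lra]). lra. }
  destruct (Hf l HKl) as [L HL].
  assert (Hmain : forall eps, (0 < eps)%R -> (Cmod (triangle_integral f (a, b, c)) <= eps * (5 * p * p))%R).
  { intros eps Heps.
    destruct (proj1 (is_cderive_eps _ _ _) HL eps Heps) as (d & Hd & Hdiff).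
    destruct (Hsmall d Hd) as [n Hn].
    eapply Rle_trans; [apply (Hint n)|].
    specialize (Hl n). specialize (Hin n). specialize (Hper n).
    destruct (tri n) as [[x y] z]. destruct Hin as (Hx & Hy & Hz). simpl fst in Hl.
    unfold perimeter in Hper. set (pn := (p / 2 ^ n)%R) in *.
    replace (4 * p / 2 ^ n)%R with (4 * pn)%R in Hl by (unfold pn, Rdiv; ring).
    pose proof (Cmod_ge_0 (y - x)). pose proof (Cmod_ge_0 (z - y)). pose proof (Cmod_ge_0 (x - z)).
    (* A primitive of the first-order approximation of [f] at [l]. Its increments cancel around the
       triangle, so only the error [eps * (5 * pn)] along the perimeter [pn] remains, and [pn * pn]
       absorbs the factor [4 ^ n]. *)
    set (P := fun w => f l * w + L / 2 * ((w - l) * (w - l))).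
    assert (Hseg : forall u v, K u -> K v ->
      (Cmod (u - l) + Cmod (v - u) <= 5 * pn)%R ->
      (Cmod (segment_integral f u v - (P v - P u)) <= eps * (5 * pn) * Cmod (v - u))%R).
    { intros u v Hu Hv Huv.
      apply segment_integral_near_primitive with (g := fun w => f l + L * (w - l)).
      - now apply continuous_on_segment_in_convex with K.
      - intros t _. apply ccontinuous_affine.
      - intros t _. apply is_cderive_quadratic.
      - intros t Ht. set (w := segment_point u v t).
        assert (Hw : (Cmod (w - l) <= 5 * pn)%R).
        { eapply Rle_trans; [apply segment_point_close; auto|exact Huv]. }
        replace (f w - (f l + L * (w - l))) with (f w - f l - L * (w - l)) by ring.
        eapply Rle_trans; [apply Hdiff; lra|]. apply Rmult_le_compat_l; lra. }
    pose proof (Hseg x y Hx Hy ltac:(lra)) as H1x.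
    pose proof (Hseg y z Hy Hz ltac:(pose proof (Cmod_sub_triangle x y l); lra)) as H1y.
    assert (Hxz : (Cmod (z - x) <= Cmod (y - x) + Cmod (z - y))%R).
    { rewrite Rplus_comm. apply Cmod_sub_triangle. }
    rewrite (Cmod_sub_sym x z) in *.
    pose proof (Hseg z x Hz Hx ltac:(rewrite ?(Cmod_sub_sym x z); pose proof (Cmod_sub_triangle x z l); lra)) as H1z.
    assert (Ht : (Cmod (triangle_integral f (x, y, z)) <= eps * (5 * pn) * pn)%R).
    { unfold triangle_integral.
      replace (segment_integral f x y + segment_integral f y z + segment_integral f z x) with
        ((segment_integral f x y - (P y - P x)) + (segment_integral f y z - (P z - P y)) +
         (segment_integral f z x - (P x - P z))) by ring.
      eapply Rle_trans; [apply Cmod_triangle|].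
      eapply Rle_trans; [apply Rplus_le_compat_r, Cmod_triangle|].
      replace (eps * (5 * pn) * pn)%R with
        (eps * (5 * pn) * (Cmod (y - x) + Cmod (z - y) + Cmod (z - x)))%R by (rewrite Hper; ring).
      rewrite (Cmod_sub_sym x z) in H1z. lra. }
    apply Rle_trans with (4 ^ n * (eps * (5 * pn) * pn))%R.
    - apply Rmult_le_compat_l; [apply pow_le; lra|exact Ht].
    - apply Req_le. unfold pn. replace 4%R with (2 * 2)%R by ring. rewrite Rpow_mult_distr.
      field. apply pow_nonzero. lra. }
  apply Cmod_eq_0. apply Rle_antisym; [|apply Cmod_ge_0].
  apply Rnot_lt_le. intros Hlt.
  set (T := Cmod (triangle_integral f (a, b, c))) in *.
  assert (Hq : (0 < 10 * p * p + 1)%R) by nra.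
  (* This choice of [eps] is positive even when [p = 0] and makes the bound smaller than [T]. *)
  specialize (Hmain (T / (10 * p * p + 1))%R ltac:(apply Rdiv_lt_0_compat; auto)).
  apply Rmult_le_compat_r with (r := (10 * p * p + 1)%R) in Hmain; [|lra].
  replace (T / (10 * p * p + 1) * (5 * p * p) * (10 * p * p + 1))%R with (T * (5 * p * p))%R in Hmain by (field; lra).
  nra.
Qed.

(** * Primitives *)

Definition cdisc (a : C) (R : R) (z : C) : Prop := (Cmod (z - a) < R)%R.

Definition copen (U : C -> Prop) : Prop :=
  forall z, U z -> exists d, (0 < d)%R /\ forall w, (Cmod (w - z) < d)%R -> U w.

(** Goursat's theorem lives on closed convex sets, the functions on open ones. This notion joins the
    two and covers discs and half-planes at once, so that primitives exist on both. *)
Record convexly_exhausted (U : C -> Prop) : Prop := {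
  exhausted_open : copen U;
  exhausted_triangle : forall a b c, U a -> U b -> U c ->
    exists K, closed_convex K /\ (forall z, K z -> U z) /\ K a /\ K b /\ K c
}.

Lemma closed_ball_convex a r : closed_convex (fun z => (Cmod (z - a) <= r)%R).
Proof.
  split.
  - intros x y t Hx Hy Ht. unfold segment_point.
    replace (x + t * (y - x) - a) with (RtoC (1 - t) * (x - a) + RtoC t * (y - a))
      by (rewrite RtoC_minus; ring).
    eapply Rle_trans; [apply Cmod_triangle|]. rewrite !Cmod_mult, !Cmod_R, (Rabs_right (1 - t)), (Rabs_right t) by lra.
    pose proof (Rmult_le_compat_l (1 - t) _ _ ltac:(lra) Hx).
    pose proof (Rmult_le_compat_l t _ _ ltac:(lra) Hy). lra.
  - intros x l Hx Hl. apply Rnot_lt_le. intros H.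
    destruct (Hl (Cmod (l - a) - r)%R ltac:(lra)) as [n Hn].
    pose proof (Cmod_sub_triangle (x n) l a). rewrite (Cmod_sub_sym l (x n)) in H0. specialize (Hx n). lra.
Qed.

Lemma cdisc_exhausted a R : convexly_exhausted (cdisc a R).
Proof.
  split.
  - intros z Hz. exists (R - Cmod (z - a))%R. unfold cdisc in *. split; [lra|].
    intros w Hw. pose proof (Cmod_sub_triangle z w a). lra.
  - intros x y z Hx Hy Hz.
    exists (fun w => (Cmod (w - a) <= Rmax (Cmod (x - a)) (Rmax (Cmod (y - a)) (Cmod (z - a))))%R).
    split; [apply closed_ball_convex|]. unfold cdisc in *. repeat split.
    + intros w Hw. eapply Rle_lt_trans; [exact Hw|]. repeat apply Rmax_lub_lt; auto.
    + apply Rmax_l.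
    + eapply Rle_trans; [apply Rmax_l|apply Rmax_r].
    + eapply Rle_trans; [apply Rmax_r|apply Rmax_r].
Qed.

Lemma half_plane_exhausted y0 : convexly_exhausted (fun w => (y0 < Im w)%R).
Proof.
  split.
  - intros z Hz. exists (Im z - y0)%R. split; [lra|]. intros w Hw.
    pose proof (im_le_Cmod (w - z)) as H. apply Rabs_le_between in H.
    change (Im (w - z)) with (Im w - Im z)%R in H. lra.
  - intros a b c Ha Hb Hc.
    exists (fun w => (Rmin (Im a) (Rmin (Im b) (Im c)) <= Im w)%R).
    repeat split.
    + intros x y t Hx Hy Ht.
      replace (Im (segment_point x y t)) with ((1 - t) * Im x + t * Im y)%R
        by (unfold segment_point, Im, RtoC; simpl; ring).
      nra.
    + intros x l Hx Hl. apply Rnot_lt_le. intros H.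
      destruct (Hl (Rmin (Im a) (Rmin (Im b) (Im c)) - Im l)%R ltac:(lra)) as [n Hn].
      pose proof (im_le_Cmod (x n - l)) as H0. apply Rabs_le_between in H0.
      change (Im (x n - l)) with (Im (x n) - Im l)%R in H0. specialize (Hx n). lra.
    + intros w Hw. eapply Rlt_le_trans; [|exact Hw]. repeat apply Rmin_glb_lt; auto.
    + apply Rmin_l.
    + eapply Rle_trans; [apply Rmin_r|apply Rmin_l].
    + eapply Rle_trans; [apply Rmin_r|apply Rmin_r].
Qed.

Lemma holomorphic_ccontinuous U f z : holomorphic_on U f -> U z -> ccontinuous f z.
Proof. intros H Hz. destruct (H z Hz) as [l Hl]. now apply is_cderive_ccontinuous with l. Qed.

Lemma ccontinuous_const c z : ccontinuous (fun _ => c) z.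
Proof. exact (is_cderive_ccontinuous _ _ _ (is_cderive_const c z)). Qed.

Lemma segment_point_sub a b t : segment_point a b t - a = t * (b - a).
Proof. unfold segment_point. ring. Qed.

(** The primitive is the segment integral from a fixed base point. Goursat's theorem on the triangle
    [x0], [z], [w] turns its increment into the integral from [z] to [w], where [f] is close to
    [f z]. *)
Lemma primitive_exists U f :
  convexly_exhausted U -> holomorphic_on U f ->
  exists F, forall z, U z -> is_cderive F z (f z).
Proof.
  intros HU Hf.
  destruct (classic (exists x0, U x0)) as [[x0 Hx0]|Hno].
  2: { exists f. intros z Hz. exfalso. eauto. }
  exists (fun z => segment_integral f x0 z). intros z Hz.
  apply is_cderive_eps. intros eps Heps.
  destruct (exhausted_open U HU z Hz) as (d1 & Hd1 & H1).
  destruct (holomorphic_ccontinuous U f z Hf Hz eps Heps) as (d2 & Hd2 & H2).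
  exists (Rmin d1 d2). split; [now apply Rmin_glb_lt|]. intros w Hw.
  assert (Hw1 : (Cmod (w - z) < d1)%R) by (exact (Rlt_Rmin_l _ _ _ Hw)).
  assert (Hw2 : (Cmod (w - z) < d2)%R) by (exact (Rlt_Rmin_r _ _ _ Hw)).
  destruct (exhausted_triangle U HU x0 z w Hx0 Hz (H1 w Hw1)) as (K & HK & HKU & K0 & Kz & Kw).
  assert (HKf : forall x, K x -> ccontinuous f x)
    by (intros x Hx; now apply (holomorphic_ccontinuous U f x Hf), HKU).
  pose proof (goursat K f x0 z w HK (fun x Hx => Hf x (HKU x Hx)) K0 Kz Kw) as G.
  unfold triangle_integral in G.
  rewrite (segment_integral_reverse f x0 w) in G by now apply continuous_on_segment_in_convex with K.
  replace (segment_integral f x0 w - segment_integral f x0 z) with (segment_integral f z w).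
  2: { replace (segment_integral f z w) with
         (segment_integral f x0 z + segment_integral f z w + - segment_integral f x0 w
          + segment_integral f x0 w - segment_integral f x0 z) by ring.
       rewrite G. ring. }
  replace (segment_integral f z w - f z * (w - z)) with
    (segment_integral f z w - (f z * w - f z * z)) by ring.
  apply segment_integral_near_primitive with (G := fun w => f z * w) (g := fun _ => f z).
  - now apply continuous_on_segment_in_convex with K.
  - intros t _. apply ccontinuous_const.
  - intros t _. eapply is_cderive_eq.
    + apply (is_cderive_mult (fun _ => f z) (fun w => w)); [apply is_cderive_const|apply is_cderive_id].
    + ring.
  - intros t Ht. apply Rlt_le, H2. rewrite segment_point_sub, Cmod_mult, Cmod_R, Rabs_right by lra.
    pose proof (Cmod_ge_0 (w - z)). nra.
Qed.

(** This is [segment_integral_near_primitive] with the roles exchanged: the constant [c] is now the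
    integrand and [G] the known primitive. *)
Lemma mean_value_bound G g c a b M :
  continuous_on_segment g a b ->
  (forall t, (0 <= t <= 1)%R -> is_cderive G (segment_point a b t) (g (segment_point a b t))) ->
  (forall t, (0 <= t <= 1)%R -> (Cmod (g (segment_point a b t) - c) <= M)%R) ->
  (Cmod (G b - G a - c * (b - a)) <= M * Cmod (b - a))%R.
Proof.
  intros Hg HG HM.
  assert (Hc : continuous_on_segment (fun _ => c) a b)
    by (intros t _; apply ccontinuous_const).
  assert (E : segment_integral (fun _ => c) a b = c * (b - a)).
  { unfold segment_integral, Cint. rewrite RInt_const.
    destruct (c * (b - a)) as [x y]. apply injective_projections; simpl; unfold scal; simpl;
    unfold mult; simpl; ring. }
  rewrite Cmod_sub_sym, <- E.
  apply segment_integral_near_primitive with (g := g); auto.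
  intros t Ht. rewrite Cmod_sub_sym. auto.
Qed.

Lemma constant_of_zero_derivative U G a b :
  convexly_exhausted U -> (forall z, U z -> is_cderive G z 0) -> U a -> U b -> G a = G b.
Proof.
  intros HU HG Ha Hb.
  destruct (exhausted_triangle U HU a b b Ha Hb Hb) as (K & HK & HKU & Ka & Kb & _).
  symmetry. apply Cmod_sub_eq_0, Rle_antisym; [|apply Cmod_ge_0].
  replace (G b - G a) with (G b - G a - 0 * (b - a)) by ring.
  apply Rle_trans with (0 * Cmod (b - a))%R; [|lra].
  apply mean_value_bound with (g := fun _ => 0).
  - intros t _. apply ccontinuous_const.
  - intros t Ht. apply HG, HKU. now apply closed_convex_segment.
  - intros t _. cbv beta. rewrite (Cmod_sub_diag 0). lra.
Qed.

(** * Cauchy's formula *)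

Definition circle (a : C) (r : R) (t : R) : C := a + (RtoC r) * (cos t, sin t).

Lemma circle_sub a r t : (0 <= r)%R -> Cmod (circle a r t - a) = r.
Proof.
  intros Hr. unfold circle. replace (a + r * (cos t, sin t) - a) with (r * (cos t, sin t)) by ring.
  rewrite Cmod_mult, Cmod_R, Rabs_right by lra.
  replace (Cmod (cos t, sin t)) with 1%R; [ring|].
  unfold Cmod. simpl fst. simpl snd. rewrite <- sqrt_1 at 1. f_equal.
  pose proof (sin2_cos2 t) as H. unfold Rsqr in H. lra.
Qed.

Lemma circle_close a r : circle a r (2 * PI) = circle a r 0.
Proof. unfold circle. now rewrite cos_2PI, sin_2PI, cos_0, sin_0. Qed.

Lemma is_path_derive_circle a r t : is_path_derive (circle a r) t (Ci * (circle a r t - a)).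
Proof.
  assert (H : is_path_derive (fun s => (cos s, sin s)) t (- sin t, cos t)%R).
  { apply is_path_derive_pair; [apply is_derive_cos | apply is_derive_sin]. }
  assert (HF : is_cderive (fun w => a + r * w) (cos t, sin t) r).
  { eapply is_cderive_eq.
    - apply is_cderive_plus; [apply is_cderive_const|].
      apply (is_cderive_mult (fun _ => RtoC r) (fun w => w)); [apply is_cderive_const|apply is_cderive_id].
    - ring. }
  pose proof (is_path_derive_comp (fun w => a + r * w) (fun s => (cos s, sin s)) t _ _ HF H) as H1.
  replace (Ci * (circle a r t - a)) with (RtoC r * (- sin t, cos t)%R); [exact H1|].
  unfold circle, Ci, RtoC. apply injective_projections; simpl; ring.
Qed.

Lemma path_continuous_circle a r : path_continuous (circle a r).
Proof. intros t. eapply is_path_derive_continuous, is_path_derive_circle. Qed.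

Lemma path_continuous_comp f (g : R -> C) :
  (forall t, ccontinuous f (g t)) -> path_continuous g -> path_continuous (fun t => f (g t)).
Proof. intros Hf Hg t. apply continuous_comp_path; auto. Qed.

Lemma path_continuous_mult f g :
  path_continuous f -> path_continuous g -> path_continuous (fun t => f t * g t).
Proof.
  intros Hf Hg t eps Heps.
  pose proof (Cmod_ge_0 (f t)) as H0. pose proof (Cmod_ge_0 (g t)) as H1.
  set (A := (1 + Cmod (f t) + Cmod (g t))%R).
  assert (HA : (0 < eps / (2 * A))%R) by (apply Rdiv_lt_0_compat; unfold A; lra).
  destruct (Hf t (Rmin 1 (eps / (2 * A)))) as (d1 & Hd1 & H3); [apply Rmin_glb_lt; lra|].
  destruct (Hg t (Rmin 1 (eps / (2 * A)))) as (d2 & Hd2 & H4); [apply Rmin_glb_lt; lra|].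
  exists (Rmin d1 d2). split; [now apply Rmin_glb_lt|]. intros s Hs.
  assert (Hs1 : (Rabs (s - t) < d1)%R) by (exact (Rlt_Rmin_l _ _ _ Hs)).
  assert (Hs2 : (Rabs (s - t) < d2)%R) by (exact (Rlt_Rmin_r _ _ _ Hs)).
  specialize (H3 s Hs1). specialize (H4 s Hs2).
  assert (H5 : (Cmod (f s - f t) < eps / (2 * A))%R) by (exact (Rlt_Rmin_r _ _ _ H3)).
  assert (H6 : (Cmod (g s - g t) < eps / (2 * A))%R) by (exact (Rlt_Rmin_r _ _ _ H4)).
  assert (H7 : (Cmod (f s - f t) < 1)%R) by (exact (Rlt_Rmin_l _ _ _ H3)).
  replace (f s * g s - f t * g t) with
    ((f s - f t) * (g s - g t) + (f s - f t) * g t + f t * (g s - g t)) by ring.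
  eapply Rle_lt_trans; [apply Cmod_triangle|].
  eapply Rle_lt_trans; [apply Rplus_le_compat_r, Cmod_triangle|].
  rewrite !Cmod_mult.
  assert (E : (eps / (2 * A) * (2 * A) = eps)%R) by (field; unfold A; lra).
  set (e := (eps / (2 * A))%R) in *. unfold A in E.
  pose proof (Cmod_ge_0 (f s - f t)). pose proof (Cmod_ge_0 (g s - g t)).
  set (x := Cmod (f s - f t)) in *. set (y := Cmod (g s - g t)) in *.
  set (p := Cmod (f t)) in *. set (q := Cmod (g t)) in *.
  assert (x * y <= 1 * y)%R by (apply Rmult_le_compat_r; lra).
  assert (x * q <= e * q)%R by (apply Rmult_le_compat_r; lra).
  assert (p * y <= p * e)%R by (apply Rmult_le_compat_l; lra).
  assert (0 < e)%R by assumption. nra.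
Qed.

Lemma path_continuous_const c : path_continuous (fun _ => c).
Proof.
  intros t eps Heps. exists 1%R. split; [lra|]. intros s _.
  now rewrite (Cmod_sub_diag c).
Qed.

Lemma path_continuous_minus f g :
  path_continuous f -> path_continuous g -> path_continuous (fun t => f t - g t).
Proof.
  intros Hf Hg t eps Heps.
  destruct (Hf t (eps / 2)%R) as (d1 & Hd1 & H1); [lra|].
  destruct (Hg t (eps / 2)%R) as (d2 & Hd2 & H2); [lra|].
  exists (Rmin d1 d2). split; [now apply Rmin_glb_lt|]. intros s Hs.
  specialize (H1 s ltac:(exact (Rlt_Rmin_l _ _ _ Hs))).
  specialize (H2 s ltac:(exact (Rlt_Rmin_r _ _ _ Hs))).
  replace (f s - g s - (f t - g t)) with ((f s - f t) - (g s - g t)) by ring.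
  eapply Rle_lt_trans; [apply Cmod_triangle_sub|]. lra.
Qed.

Lemma path_integrable g a b : path_continuous g -> @ex_RInt C_R_NormedModule g a b.
Proof.
  intros Hg. apply (@ex_RInt_continuous C_R_CompleteNormedModule). intros t _.
  apply continuous_R_C. apply Hg.
Qed.

Lemma Cint_correct g a b : path_continuous g -> @is_RInt C_R_NormedModule g a b (Cint g a b).
Proof. intros Hg. apply (@RInt_correct C_R_CompleteNormedModule). now apply path_integrable. Qed.

Lemma Cint_ext f g a b : (forall t, f t = g t) -> Cint f a b = Cint g a b.
Proof. intros H. apply (@RInt_ext C_R_CompleteNormedModule). intros; apply H. Qed.

Lemma Cint_minus f g a b :
  path_continuous f -> path_continuous g -> Cint (fun t => f t - g t) a b = Cint f a b - Cint g a b.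
Proof.
  intros Hf Hg. apply (@is_RInt_unique C_R_CompleteNormedModule).
  apply (@is_RInt_minus C_R_NormedModule f g); now apply Cint_correct.
Qed.

(** The integral is taken in [C] as a real vector space, so linearity in a complex scalar has to be
    checked on the two components. *)
Lemma Cint_scal c g a b : path_continuous g -> Cint (fun t => c * g t) a b = c * Cint g a b.
Proof.
  intros Hg. apply (@is_RInt_unique C_R_CompleteNormedModule).
  pose proof (Cint_correct g a b Hg) as H.
  pose proof (@is_RInt_fct_extend_fst R_NormedModule R_NormedModule g a b _ H) as H1.
  pose proof (@is_RInt_fct_extend_snd R_NormedModule R_NormedModule g a b _ H) as H2.
  destruct c as [x y].
  apply (@is_RInt_fct_extend_pair R_NormedModule R_NormedModule).
  - apply (is_RInt_minus (fun t => x * fst (g t))%R (fun t => y * snd (g t))%R);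
    apply (is_RInt_scal (V := R_NormedModule)); assumption.
  - apply (is_RInt_plus (fun t => x * snd (g t))%R (fun t => y * fst (g t))%R);
    apply (is_RInt_scal (V := R_NormedModule)); assumption.
Qed.

Definition contour (f : C -> C) (a : C) (r : R) : C :=
  Cint (fun t => f (circle a r t) * (Ci * (circle a r t - a))) 0 (2 * PI).

(** The Cauchy transform of a density in the parameter [t]; the velocity of the circle is part of
    [rho]. Arbitrary densities let one derivative formula serve the winding number, Cauchy's formula
    and difference quotients. *)
Definition cauchy_kernel (rho : R -> C) (a : C) (r : R) (z : C) : C :=
  Cint (fun t => rho t / (circle a r t - z)) 0 (2 * PI).

Lemma contour_primitive F f a r :
  (forall t, is_cderive F (circle a r t) (f (circle a r t))) ->
  (forall t, ccontinuous f (circle a r t)) -> contour f a r = 0.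
Proof.
  intros HF Hf. apply (@is_RInt_unique C_R_CompleteNormedModule).
  replace (RtoC 0) with (F (circle a r (2 * PI)) - F (circle a r 0)) by (rewrite circle_close; ring).
  apply (@is_RInt_derive C_R_CompleteNormedModule (fun t => F (circle a r t))).
  - intros t _. apply is_path_derive_comp; [apply HF|apply is_path_derive_circle].
  - intros t _. apply continuous_R_C.
    apply (path_continuous_mult (fun t => f (circle a r t)) (fun t => Ci * (circle a r t - a))).
    + apply path_continuous_comp; [auto|apply path_continuous_circle].
    + apply (path_continuous_comp (fun w => Ci * (w - a)) (circle a r)).
      * intros s. pose proof (ccontinuous_affine 0 Ci a (circle a r s)) as H.
        intros eps Heps. destruct (H eps Heps) as (d & Hd & H'). exists d. split; auto.
        intros w Hw. specialize (H' w Hw).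
        replace (Ci * (w - a) - Ci * (circle a r s - a)) with
          (0 + Ci * (w - a) - (0 + Ci * (circle a r s - a))) by ring. exact H'.
      * apply path_continuous_circle.
Qed.

Lemma path_continuous_circle_velocity a r : path_continuous (fun t => Ci * (circle a r t - a)).
Proof.
  apply (path_continuous_comp (fun w => Ci * (w - a)) (circle a r)); [|apply path_continuous_circle].
  intros t. eapply is_cderive_ccontinuous.
  apply (is_cderive_mult (fun _ => Ci) (fun w => w - a)); [apply is_cderive_const|].
  apply is_cderive_sub_const.
Qed.

Lemma circle_dist a r t z : (0 <= r)%R -> (r - Cmod (z - a) <= Cmod (circle a r t - z))%R.
Proof.
  intros Hr. pose proof (Cmod_sub_triangle z (circle a r t) a) as H.
  rewrite circle_sub in H by auto. lra.
Qed.

Lemma circle_neq a r t z : (0 <= r)%R -> (Cmod (z - a) < r)%R -> circle a r t - z <> 0.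
Proof. intros Hr Hz. apply Cmod_gt_0. pose proof (circle_dist a r t z Hr). lra. Qed.

Lemma path_continuous_div rho a r z :
  (0 <= r)%R -> (Cmod (z - a) < r)%R -> path_continuous rho ->
  path_continuous (fun t => rho t / (circle a r t - z)).
Proof.
  intros Hr Hz Hrho. apply (path_continuous_mult rho (fun t => / (circle a r t - z))); auto.
  apply (path_continuous_comp (fun w => / (w - z)) (circle a r)); [|apply path_continuous_circle].
  intros t. eapply is_cderive_ccontinuous.
  apply (is_cderive_comp (fun w => / w) (fun w => w - z)).
  - apply is_cderive_inv_at. now apply circle_neq.
  - apply is_cderive_sub_const.
Qed.

Lemma path_continuous_bounded rho : path_continuous rho -> forall a b, (a <= b)%R ->
  exists M, forall t, (a <= t <= b)%R -> (Cmod (rho t) <= M)%R.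
Proof.
  intros H a b Hab.
  destruct (continuity_ab_maj (fun t => Cmod (rho t)) a b Hab) as [m [Hm _]].
  - intros c _. intros eps Heps. destruct (H c eps Heps) as (d & Hd & H'). exists d. split; auto.
    intros x [_ Hx]. simpl. unfold R_dist.
    specialize (H' x Hx). apply Rabs_def1.
    + pose proof (Cmod_triangle_rev (rho x) (rho c)). lra.
    + pose proof (Cmod_triangle_rev (rho c) (rho x)). rewrite Cmod_sub_sym in H0. lra.
  - exists (Cmod (rho m)). exact Hm.
Qed.

Lemma Cint_bound_on g a b M :
  (a <= b)%R -> path_continuous g -> (forall t, (a <= t <= b)%R -> (Cmod (g t) <= M)%R) ->
  (Cmod (Cint g a b) <= (b - a) * M)%R.
Proof.
  intros Hab Hg HM. rewrite Cmod_norm.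
  apply (@norm_RInt_le_const C_R_NormedModule g a b); [lra| |now apply Cint_correct].
  intros t Ht. rewrite <- Cmod_norm. now apply HM.
Qed.

Lemma two_PI_pos : (0 < 2 * PI)%R.
Proof. pose proof PI_RGT_0. lra. Qed.

Lemma is_cderive_cauchy_kernel rho a r z :
  (0 < r)%R -> (Cmod (z - a) < r)%R -> path_continuous rho ->
  is_cderive (cauchy_kernel rho a r) z
    (Cint (fun t => rho t / (circle a r t - z) / (circle a r t - z)) 0 (2 * PI)).
Proof.
  intros Hr Hz Hrho.
  destruct (path_continuous_bounded rho Hrho 0 (2 * PI)) as [M HM].
  { apply Rlt_le, two_PI_pos. }
  (* Half the distance left between [z] and the circle: for [w] within [e] of [z], both
     [circle a r t - z] and [circle a r t - w] have modulus at least [e], whence the bound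
     [M / (e * e * e)] on the second-order remainder. *)
  set (e := ((r - Cmod (z - a)) / 2)%R). assert (He : (0 < e)%R) by (unfold e; lra).
  assert (HM0 : (0 <= M)%R).
  { eapply Rle_trans; [apply (Cmod_ge_0 (rho 0%R))|]. apply HM. pose proof two_PI_pos. lra. }
  set (A := (2 * PI * (M / (e * e * e)))%R).
  assert (HA : (0 <= A)%R).
  { unfold A. apply Rmult_le_pos; [pose proof two_PI_pos; lra|].
    apply Rdiv_le_0_compat; [exact HM0|]. apply Rmult_lt_0_compat; [apply Rmult_lt_0_compat|]; exact He. }
  apply is_cderive_eps. intros eps Heps.
  exists (Rmin e (eps / (A + 1))). split.
  { apply Rmin_glb_lt; auto. apply Rdiv_lt_0_compat; lra. }
  intros w Hw.
  assert (Hw1 : (Cmod (w - z) < e)%R) by (exact (Rlt_Rmin_l _ _ _ Hw)).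
  assert (Hw2 : (Cmod (w - z) < eps / (A + 1))%R) by (exact (Rlt_Rmin_r _ _ _ Hw)).
  assert (Hwa : (Cmod (w - a) < r - e)%R).
  { pose proof (Cmod_sub_triangle z w a). unfold e in *. lra. }
  assert (Hza : (Cmod (z - a) < r - e)%R) by (unfold e in *; lra).
  rewrite Cmult_comm.
  unfold cauchy_kernel.
  assert (P1 : path_continuous (fun t => rho t / (circle a r t - z))) by (apply path_continuous_div; auto; lra).
  assert (P2 : path_continuous (fun t => rho t / (circle a r t - w))) by (apply path_continuous_div; auto; lra).
  assert (P3 : path_continuous (fun t => rho t / (circle a r t - z) / (circle a r t - z)))
    by (apply path_continuous_div; auto; lra).
  assert (P4 : path_continuous (fun t => (w - z) * (rho t / (circle a r t - z) / (circle a r t - z))))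
    by (apply path_continuous_mult; [apply path_continuous_const|auto]).
  assert (P5 := path_continuous_minus _ _ P2 P1).
  rewrite <- Cint_scal, <- !Cint_minus by auto.
  eapply Rle_trans.
  - apply Cint_bound_on with (M := (M / (e * e * e) * (Cmod (w - z) * Cmod (w - z)))%R).
    + apply Rlt_le, two_PI_pos.
    + now apply path_continuous_minus.
    + intros t Ht.
      assert (Nz := circle_neq a r t z ltac:(lra) ltac:(lra)).
      assert (Nw := circle_neq a r t w ltac:(lra) ltac:(lra)).
      pose proof (circle_dist a r t z ltac:(lra)) as Dz.
      pose proof (circle_dist a r t w ltac:(lra)) as Dw.
      replace (rho t / (circle a r t - w) - rho t / (circle a r t - z) -
        (w - z) * (rho t / (circle a r t - z) / (circle a r t - z))) with
        (rho t * ((w - z) * (w - z)) / ((circle a r t - w) * ((circle a r t - z) * (circle a r t - z))))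
        by (field; auto).
      rewrite Cmod_div by (repeat apply Cmult_neq_0; auto).
      rewrite !Cmod_mult.
      set (x := Cmod (circle a r t - w)) in *. set (y := Cmod (circle a r t - z)) in *.
      set (q := (Cmod (w - z) * Cmod (w - z))%R).
      assert (0 <= q)%R by (apply Rmult_le_pos; apply Cmod_ge_0).
      replace (M / (e * e * e) * q)%R with (M * q * / (e * (e * e)))%R by (field; lra).
      apply Rmult_le_compat.
      * apply Rmult_le_pos; auto. apply Cmod_ge_0.
      * apply Rlt_le, Rinv_0_lt_compat. repeat apply Rmult_lt_0_compat; lra.
      * apply Rmult_le_compat_r; auto.
      * apply Rinv_le_contravar; [repeat apply Rmult_lt_0_compat; lra|].
        apply Rmult_le_compat; try lra; [nra|]. apply Rmult_le_compat; lra.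
  - replace ((2 * PI - 0) * (M / (e * e * e) * (Cmod (w - z) * Cmod (w - z))))%R
      with (A * Cmod (w - z) * Cmod (w - z))%R by (unfold A; ring).
    apply Rmult_le_compat_r; [apply Cmod_ge_0|].
    apply Rmult_lt_compat_r with (r := (A + 1)%R) in Hw2; [|lra].
    unfold Rdiv in Hw2. rewrite Rmult_assoc, Rinv_l, Rmult_1_r in Hw2 by lra.
    pose proof (Cmod_ge_0 (w - z)). nra.
Qed.

Lemma is_cderive_unique f z l l' : is_cderive f z l -> is_cderive f z l' -> l = l'.
Proof.
  intros H H'. apply NNPP. intros Hne. apply Cmod_sub_gt_0 in Hne.
  destruct (proj1 (is_cderive_eps _ _ _) H (Cmod (l - l') / 4)%R ltac:(lra)) as (d & Hd & H1).
  destruct (proj1 (is_cderive_eps _ _ _) H' (Cmod (l - l') / 4)%R ltac:(lra)) as (d' & Hd' & H2).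
  set (s := (Rmin d d' / 2)%R).
  assert (Hs : (0 < s)%R) by (unfold s; pose proof (Rmin_glb_lt _ _ _ Hd Hd'); lra).
  pose proof (Rmin_l d d'). pose proof (Rmin_r d d').
  assert (E : Cmod (z + s - z) = s).
  { replace (z + s - z) with (RtoC s) by ring. rewrite Cmod_R, Rabs_right; lra. }
  specialize (H1 (z + s) ltac:(rewrite E; unfold s in *; lra)).
  specialize (H2 (z + s) ltac:(rewrite E; unfold s in *; lra)). rewrite E in H1, H2.
  assert (Hc : (Cmod (l - l') * s <= Cmod (l - l') / 2 * s)%R).
  { rewrite <- E at 1. rewrite <- Cmod_mult.
    replace ((l - l') * (z + s - z)) with
      ((f (z + s) - f z - l' * (z + s - z)) - (f (z + s) - f z - l * (z + s - z))) by ring.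
    eapply Rle_trans; [apply Cmod_triangle_sub|]. lra. }
  nra.
Qed.

Lemma circle_in_disc a r R t : (0 <= r < R)%R -> cdisc a R (circle a r t).
Proof. intros H. unfold cdisc. rewrite circle_sub; lra. Qed.

Lemma is_cderive_inv_sub z w : w - z <> 0 -> is_cderive (fun w => / (w - z)) w (- / ((w - z) * (w - z))).
Proof.
  intros H. eapply is_cderive_eq.
  - apply (is_cderive_comp (fun w => / w) (fun w => w - z)).
    + apply is_cderive_inv_at. exact H.
    + apply is_cderive_sub_const.
  - field. exact H.
Qed.

(** The derivative in [z] is the contour integral of [1 / (v - z)^2], which has a primitive and so
    vanishes. The value is therefore the one at the center, where the integrand is constantly
    [Ci]. *)
Lemma winding_number a r z :
  (0 < r)%R -> (Cmod (z - a) < r)%R ->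
  cauchy_kernel (fun t => Ci * (circle a r t - a)) a r z = 2 * PI * Ci.
Proof.
  intros Hr Hz.
  rewrite (constant_of_zero_derivative (cdisc a r) _ z a (cdisc_exhausted a r)).
  - unfold cauchy_kernel. rewrite (Cint_ext _ (fun _ => Ci)).
    + unfold Cint. rewrite RInt_const. unfold Ci, RtoC.
      apply injective_projections; simpl; unfold scal; simpl; unfold mult; simpl; ring.
    + intros t. field. apply circle_neq; [lra|].
      now rewrite (Cmod_sub_diag a).
  - intros w Hw.
    eapply is_cderive_eq.
    + apply is_cderive_cauchy_kernel; auto. apply path_continuous_circle_velocity.
    + assert (N : forall t, circle a r t - w <> 0) by (intros t; apply circle_neq; [lra|exact Hw]).
      transitivity (contour (fun v => / ((v - w) * (v - w))) a r).
      * apply Cint_ext. intros t. field. apply N.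
      * apply (contour_primitive (fun v => - / (v - w))).
        -- intros t. eapply is_cderive_eq; [apply is_cderive_opp, is_cderive_inv_sub, N|ring].
        -- intros t. eapply is_cderive_ccontinuous.
           apply (is_cderive_comp (fun w => / w) (fun v => (v - w) * (v - w))).
           ++ apply is_cderive_inv_at. apply Cmult_neq_0; apply N.
           ++ exact (is_cderive_mult _ _ _ _ _ (is_cderive_sub_const _ _) (is_cderive_sub_const _ _)).
  - exact Hz.
  - unfold cdisc. now rewrite (Cmod_sub_diag a).
Qed.

(** That the derivative of a holomorphic function is holomorphic is not yet available. For an [F]
    whose derivative [f] is holomorphic by assumption, the quotient extends to [z] by [f z], with
    derivative half that of [f]. *)
Lemma difference_quotient_of_primitive R a F f z :
  (forall w, cdisc a R w -> is_cderive F w (f w)) -> holomorphic_on (cdisc a R) f -> cdisc a R z ->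
  exists q, holomorphic_on (cdisc a R) q /\ forall w, w <> z -> q w = (F w - F z) / (w - z).
Proof.
  intros HF Hf Hz.
  exists (fun w => if excluded_middle_informative (w = z) then f z else (F w - F z) / (w - z)).
  split.
  2: { intros w Hw. now destruct (excluded_middle_informative (w = z)). }
  intros w Hw. destruct (classic (w = z)) as [->|Hne].
  - destruct (Hf z Hz) as [l Hl]. exists (l / 2).
    destruct (exhausted_open _ (cdisc_exhausted a R) z Hz) as (d0 & Hd0 & H0).
    apply is_cderive_eps. intros eps Heps.
    destruct (proj1 (is_cderive_eps _ _ _) Hl eps Heps) as (d & Hd & H).
    exists (Rmin d0 d). split; [now apply Rmin_glb_lt|]. intros v Hv.
    assert (Hv0 : (Cmod (v - z) < d0)%R) by (exact (Rlt_Rmin_l _ _ _ Hv)).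
    assert (Hv1 : (Cmod (v - z) < d)%R) by (exact (Rlt_Rmin_r _ _ _ Hv)).
    destruct (excluded_middle_informative (z = z)) as [_|n]; [|now elim n].
    destruct (excluded_middle_informative (v = z)) as [->|Hvz].
    + replace (f z - f z - l / 2 * (z - z)) with (RtoC 0) by ring. rewrite Cmod_0.
      apply Rmult_le_pos; [lra|apply Cmod_ge_0].
    + pose proof (Cmod_sub_gt_0 v z Hvz) as Hpos.
      assert (Hvz' := Csub_neq_0 v z Hvz).
      (* The second-order Taylor remainder of [F] up to a constant. Its derivative is the
         first-order error of [f], so the mean value bound makes its increment quadratically
         small. *)
      set (G := fun w => F w - (f z * w + l / 2 * ((w - z) * (w - z)))).
      assert (B : (Cmod (G v - G z - 0 * (v - z)) <= eps * Cmod (v - z) * Cmod (v - z))%R).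
      { apply mean_value_bound with (g := fun w => f w - (f z + l * (w - z))).
        - intros t Ht. set (u := segment_point z v t).
          assert (Hu : cdisc a R u).
          { apply H0. unfold u. rewrite segment_point_sub, Cmod_mult, Cmod_R, Rabs_right by lra. nra. }
          destruct (Hf u Hu) as [l' Hl']. eapply is_cderive_ccontinuous.
          apply is_cderive_minus; [exact Hl'|].
          apply is_cderive_plus; [apply is_cderive_const|].
          apply (is_cderive_mult (fun _ => l) (fun w => w - z)); [apply is_cderive_const|].
          apply is_cderive_sub_const.
        - intros t Ht. set (u := segment_point z v t).
          assert (Hu : cdisc a R u).
          { apply H0. unfold u. rewrite segment_point_sub, Cmod_mult, Cmod_R, Rabs_right by lra. nra. }
          apply is_cderive_minus; [now apply HF|]. apply is_cderive_quadratic.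
        - intros t Ht. set (u := segment_point z v t).
          assert (Hu : (Cmod (u - z) <= Cmod (v - z))%R).
          { unfold u. rewrite segment_point_sub, Cmod_mult, Cmod_R, Rabs_right by lra. nra. }
          replace (f u - (f z + l * (u - z)) - 0) with (f u - f z - l * (u - z)) by ring.
          eapply Rle_trans; [apply H; lra|]. apply Rmult_le_compat_l; lra. }
      replace ((F v - F z) / (v - z) - f z - l / 2 * (v - z)) with
        ((G v - G z - 0 * (v - z)) / (v - z)) by (unfold G; field; exact Hvz').
      rewrite Cmod_div by exact Hvz'.
      apply Rmult_le_reg_r with (Cmod (v - z)); auto.
      unfold Rdiv. rewrite Rmult_assoc, Rinv_l by lra. lra.
  - exists ((f w * (w - z) - (F w - F z) * 1) / ((w - z) * (w - z))).
    apply is_cderive_ext_near with (fun v => (F v - F z) / (v - z)).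
    + exists (Cmod (w - z)). split; [now apply Cmod_sub_gt_0|]. intros v Hv.
      destruct (excluded_middle_informative (v = z)) as [->|]; auto.
      rewrite Cmod_sub_sym in Hv. lra.
    + apply (is_cderive_div (fun v => F v - F z) (fun v => v - z)).
      * now apply Csub_neq_0.
      * eapply is_cderive_eq.
        -- apply is_cderive_minus; [now apply HF|apply is_cderive_const].
        -- ring.
      * eapply is_cderive_eq.
        -- apply is_cderive_sub_const.
        -- ring.
Qed.

Lemma contour_holomorphic f a r R :
  (0 < r < R)%R -> holomorphic_on (cdisc a R) f -> contour f a r = 0.
Proof.
  intros Hr Hf. destruct (primitive_exists _ f (cdisc_exhausted a R) Hf) as [F HF].
  apply contour_primitive with F.
  - intros t. apply HF, circle_in_disc. lra.
  - intros t. apply (holomorphic_ccontinuous (cdisc a R)); auto. apply circle_in_disc. lra.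
Qed.

Lemma path_continuous_contour f a r R :
  (0 < r < R)%R -> holomorphic_on (cdisc a R) f ->
  path_continuous (fun t => f (circle a r t) * (Ci * (circle a r t - a))).
Proof.
  intros Hr Hf. apply (path_continuous_mult (fun t => f (circle a r t)) (fun t => Ci * (circle a r t - a))).
  - apply path_continuous_comp; [|apply path_continuous_circle].
    intros t. apply (holomorphic_ccontinuous (cdisc a R)); auto. apply circle_in_disc. lra.
  - apply path_continuous_circle_velocity.
Qed.

(** The contour integral of the holomorphic difference quotient of [F] at [z] vanishes; separating
    its two terms leaves [F z] times the winding number. *)
Lemma cauchy_formula_of_primitive F f a r R z :
  (0 < r < R)%R -> (forall w, cdisc a R w -> is_cderive F w (f w)) ->
  holomorphic_on (cdisc a R) f -> (Cmod (z - a) < r)%R ->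
  cauchy_kernel (fun t => F (circle a r t) * (Ci * (circle a r t - a))) a r z = 2 * PI * Ci * F z.
Proof.
  intros Hr HF Hf Hz.
  assert (HzR : cdisc a R z) by (unfold cdisc; lra).
  destruct (difference_quotient_of_primitive R a F f z HF Hf HzR) as (q & Hq & Eq).
  pose proof (contour_holomorphic q a r R Hr Hq) as H0.
  assert (HFh : holomorphic_on (cdisc a R) F) by (intros w Hw; exists (f w); now apply HF).
  assert (N : forall t, circle a r t - z <> 0) by (intros t; apply circle_neq; lra).
  set (v := fun t => Ci * (circle a r t - a)).
  assert (P1 : path_continuous (fun t => F (circle a r t) * v t / (circle a r t - z)))
    by (apply path_continuous_div; try lra; apply path_continuous_contour with R; auto).
  assert (P2 : path_continuous (fun t => v t / (circle a r t - z)))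
    by (apply path_continuous_div; try lra; apply path_continuous_circle_velocity).
  assert (P3 : path_continuous (fun t => F z * (v t / (circle a r t - z))))
    by (apply (path_continuous_mult (fun _ => F z)); [apply path_continuous_const|exact P2]).
  rewrite <- (winding_number a r z) by lra.
  unfold cauchy_kernel. rewrite (Cmult_comm _ (F z)), <- (Cint_scal (F z)) by exact P2.
  match goal with |- ?X = ?Y => enough (E : X - Y = 0);
    [replace X with (X - Y + Y) by ring; rewrite E; ring|] end.
  rewrite <- Cint_minus by auto. rewrite <- H0. apply Cint_ext. intros t.
  rewrite Eq.
  - unfold v. field. apply N.
  - intros E. apply (N t). rewrite E. ring.
Qed.

(** A primitive [F] of [f] satisfies the formula. Differentiating it in [z] gives a double pole, and
    an integration by parts lowers it: the two kernels differ by the contour integral of the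
    derivative of [F w / (w - z)]. *)
Theorem cauchy_formula f a r R z :
  (0 < r < R)%R -> holomorphic_on (cdisc a R) f -> (Cmod (z - a) < r)%R ->
  cauchy_kernel (fun t => f (circle a r t) * (Ci * (circle a r t - a))) a r z = 2 * PI * Ci * f z.
Proof.
  intros Hr Hf Hz.
  destruct (primitive_exists _ f (cdisc_exhausted a R) Hf) as [F HF].
  assert (HFh : holomorphic_on (cdisc a R) F) by (intros w Hw; exists (f w); now apply HF).
  assert (N : forall t, circle a r t - z <> 0) by (intros t; apply circle_neq; lra).
  set (v := fun t => Ci * (circle a r t - a)).
  assert (PF := path_continuous_contour F a r R Hr HFh).
  assert (Pf := path_continuous_contour f a r R Hr Hf).
  assert (P1 : path_continuous (fun t => f (circle a r t) * v t / (circle a r t - z)))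
    by (apply path_continuous_div; try lra; exact Pf).
  assert (P2 : path_continuous (fun t => F (circle a r t) * v t / (circle a r t - z) / (circle a r t - z)))
    by (repeat (apply path_continuous_div; try lra); exact PF).
  assert (D : 2 * PI * Ci * f z =
    Cint (fun t => F (circle a r t) * v t / (circle a r t - z) / (circle a r t - z)) 0 (2 * PI)).
  { apply is_cderive_unique with (fun w => 2 * PI * Ci * F w) z.
    - eapply is_cderive_eq.
      + apply (is_cderive_mult (fun _ => 2 * PI * Ci) F); [apply is_cderive_const|].
        apply HF. unfold cdisc; lra.
      + ring.
    - apply is_cderive_ext_near with
        (cauchy_kernel (fun t => F (circle a r t) * (Ci * (circle a r t - a))) a r).
      + exists (r - Cmod (z - a))%R. split; [lra|]. intros w Hw.
        apply cauchy_formula_of_primitive with f R; auto.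
        pose proof (Cmod_sub_triangle z w a). lra.
      + apply is_cderive_cauchy_kernel; try lra. exact PF. }
  rewrite D. unfold cauchy_kernel.
  match goal with |- ?X = ?Y => enough (E : X - Y = 0);
    [replace X with (X - Y + Y) by ring; rewrite E; ring|] end.
  rewrite <- Cint_minus by auto.
  set (g := fun w => f w / (w - z) - F w / (w - z) / (w - z)).
  transitivity (contour g a r).
  { apply Cint_ext. intros t. unfold g, v. field. apply N. }
  apply (contour_primitive (fun w => F w / (w - z))).
  - intros t. eapply is_cderive_eq.
    + apply (is_cderive_div F (fun w => w - z)).
      * apply N.
      * apply HF, circle_in_disc. lra.
      * apply is_cderive_sub_const.
    + unfold g. field. apply N.
  - intros t.
    destruct (Hf (circle a r t) ltac:(apply circle_in_disc; lra)) as [l Hl].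
    assert (HFt : is_cderive F (circle a r t) (f (circle a r t))) by (apply HF, circle_in_disc; lra).
    assert (Hi := is_cderive_inv_sub z (circle a r t) (N t)).
    eapply is_cderive_ccontinuous. apply is_cderive_minus.
    + apply (is_cderive_mult f (fun w => / (w - z))); eassumption.
    + apply (is_cderive_mult (fun w => F w / (w - z)) (fun w => / (w - z))); [|eassumption].
      apply (is_cderive_mult F (fun w => / (w - z))); eassumption.
Qed.

(** Near [a] the quotient is itself a Cauchy kernel, with the density of [f] divided by
    [circle a r t - a], so the singularity at [a] is removable. Away from [a] it is an ordinary
    quotient. *)
Theorem difference_quotient_holomorphic U f a :
  copen U -> holomorphic_on U f -> U a ->
  exists q, holomorphic_on U q /\ forall w, f w - f a = q w * (w - a).
Proof.
  intros HU Hf Ha.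
  destruct (HU a Ha) as (R & HR & HRU).
  assert (HfR : holomorphic_on (cdisc a R) f) by (intros w Hw; apply Hf, HRU, Hw).
  set (r := (R / 2)%R). assert (Hr : (0 < r < R)%R) by (unfold r; lra).
  assert (Haa : Cmod (a - a) = 0%R) by (apply (Cmod_sub_diag a)).
  set (v := fun t => Ci * (circle a r t - a)).
  set (k := cauchy_kernel (fun t => f (circle a r t) * v t / (circle a r t - a)) a r).
  assert (Pf := path_continuous_contour f a r R Hr HfR).
  assert (P1 : path_continuous (fun t => f (circle a r t) * v t / (circle a r t - a)))
    by (apply path_continuous_div; try lra; exact Pf).
  assert (Hpi : 2 * PI * Ci <> 0).
  { pose proof PI_RGT_0. repeat apply Cmult_neq_0.
    - intros E; apply RtoC_inj in E; lra.
    - intros E; apply RtoC_inj in E; lra.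
    - intros E. apply (f_equal Cmod) in E. rewrite Cmod_Ci, Cmod_0 in E. lra. }
  assert (Hk : forall w, (Cmod (w - a) < r)%R -> f w - f a = k w / (2 * PI * Ci) * (w - a)).
  { intros w Hw.
    enough (E : 2 * PI * Ci * f w - 2 * PI * Ci * f a = (w - a) * k w).
    { replace (f w - f a) with ((2 * PI * Ci * f w - 2 * PI * Ci * f a) / (2 * PI * Ci)).
      - rewrite E. unfold Cdiv. ring.
      - field. repeat split; intros E'; apply Hpi; rewrite E'; ring. }
    rewrite <- (cauchy_formula f a r R w), <- (cauchy_formula f a r R a) by (auto; lra).
    unfold k, cauchy_kernel.
    rewrite <- Cint_scal by (apply path_continuous_div; try lra; exact P1).
    rewrite <- Cint_minus by (apply path_continuous_div; try lra; exact Pf).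
    apply Cint_ext. intros t. unfold v. field.
    split; apply circle_neq; lra. }
  exists (fun w => if excluded_middle_informative (w = a) then k w / (2 * PI * Ci)
                   else (f w - f a) / (w - a)).
  split.
  - intros w Hw. destruct (classic (w = a)) as [->|Hne].
    + eexists. eapply is_cderive_ext_near with (fun w => k w / (2 * PI * Ci)).
      * exists r. split; [lra|]. intros u Hu. cbv beta.
        destruct (excluded_middle_informative (u = a)) as [->|Hua]; auto.
        rewrite Hk by auto. field. repeat split; try (now apply Csub_neq_0);
          intros E'; apply Hpi; rewrite E'; ring.
      * apply (is_cderive_mult k (fun _ => / (2 * PI * Ci))); [|apply is_cderive_const].
        apply is_cderive_cauchy_kernel; try lra. exact P1.
    + destruct (Hf w Hw) as [l Hl]. eexists.
      apply is_cderive_ext_near with (fun u => (f u - f a) / (u - a)).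
      * exists (Cmod (w - a)). split; [now apply Cmod_sub_gt_0|]. intros u Hu.
        destruct (excluded_middle_informative (u = a)) as [->|]; auto.
        rewrite Cmod_sub_sym in Hu. lra.
      * apply (is_cderive_div (fun u => f u - f a) (fun u => u - a)).
        -- now apply Csub_neq_0.
        -- apply is_cderive_minus; [exact Hl|apply is_cderive_const].
        -- apply is_cderive_sub_const.
  - intros w. cbv beta. destruct (excluded_middle_informative (w = a)) as [->|Hne].
    + ring.
    + field. now apply Csub_neq_0.
Qed.

(** * The maximum principle and the Schwarz-Pick inequality *)

Lemma holomorphic_derive U f z : holomorphic_on U f -> U z -> exists l : C, is_cderive f z l.
Proof. intros Hf Hz. exact (Hf z Hz). Qed.

Lemma holomorphic_const U c : holomorphic_on U (fun _ => c).
Proof. intros z _. exists (RtoC 0). apply is_cderive_const. Qed.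

Lemma holomorphic_id U : holomorphic_on U (fun w => w).
Proof. intros z _. exists (RtoC 1). apply is_cderive_id. Qed.

Lemma holomorphic_plus U f g :
  holomorphic_on U f -> holomorphic_on U g -> holomorphic_on U (fun w => f w + g w).
Proof.
  intros Hf Hg z Hz. destruct (Hf z Hz) as [a Ha]. destruct (Hg z Hz) as [b Hb].
  exists (a + b). now apply is_cderive_plus.
Qed.

Lemma holomorphic_minus U f g :
  holomorphic_on U f -> holomorphic_on U g -> holomorphic_on U (fun w => f w - g w).
Proof.
  intros Hf Hg z Hz. destruct (Hf z Hz) as [a Ha]. destruct (Hg z Hz) as [b Hb].
  exists (a - b). now apply is_cderive_minus.
Qed.

Lemma holomorphic_mult U f g :
  holomorphic_on U f -> holomorphic_on U g -> holomorphic_on U (fun w => f w * g w).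
Proof.
  intros Hf Hg z Hz. destruct (Hf z Hz) as [a Ha]. destruct (Hg z Hz) as [b Hb].
  exists (a * g z + f z * b). now apply is_cderive_mult.
Qed.

Lemma holomorphic_div U f g :
  holomorphic_on U f -> holomorphic_on U g -> (forall z, U z -> g z <> 0) ->
  holomorphic_on U (fun w => f w / g w).
Proof.
  intros Hf Hg H0 z Hz. destruct (Hf z Hz) as [a Ha]. destruct (Hg z Hz) as [b Hb].
  eexists. apply is_cderive_div; eauto.
Qed.

Lemma holomorphic_comp U V f g :
  holomorphic_on V f -> holomorphic_on U g -> (forall z, U z -> V (g z)) ->
  holomorphic_on U (fun w => f (g w)).
Proof.
  intros Hf Hg H z Hz. destruct (Hg z Hz) as [b Hb]. destruct (Hf (g z) (H z Hz)) as [a Ha].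
  exists (b * a). now apply is_cderive_comp.
Qed.

Lemma holomorphic_pow U f n : holomorphic_on U f -> holomorphic_on U (fun w => f w ^ n).
Proof.
  intros Hf. induction n.
  - apply (holomorphic_const U 1).
  - apply (holomorphic_mult U f (fun w => f w ^ n)); auto.
Qed.

Lemma holomorphic_subset (U V : C -> Prop) f :
  (forall z, U z -> V z) -> holomorphic_on V f -> holomorphic_on U f.
Proof. intros H Hf z Hz. apply Hf, H, Hz. Qed.

Lemma Rle_of_pow_bounded x y c :
  (0 <= x)%R -> (0 <= y)%R -> (forall n, x ^ n <= y ^ n * c)%R -> (x <= y)%R.
Proof.
  intros Hx Hy H. apply Rnot_lt_le. intros Hlt.
  destruct Hy as [Hy|<-].
  - assert (H1 : (Rabs (x / y) > 1)%R).
    { rewrite Rabs_right; [|apply Rle_ge, Rdiv_le_0_compat; lra].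
      apply Rmult_lt_reg_r with y; auto. unfold Rdiv. rewrite Rmult_assoc, Rinv_l by lra. lra. }
    destruct (Pow_x_infinity (x / y) H1 (c + 1)%R) as [N HN]. specialize (HN N (Nat.le_refl N)).
    rewrite Rabs_right in HN by (apply Rle_ge, pow_le, Rdiv_le_0_compat; lra).
    unfold Rdiv in HN. rewrite Rpow_mult_distr, pow_inv in HN by lra.
    specialize (H N). assert (0 < y ^ N)%R by now apply pow_lt.
    apply Rge_le, Rmult_le_compat_l with (r := (y ^ N)%R) in HN; [|lra].
    replace (y ^ N * (x ^ N * / y ^ N))%R with (x ^ N)%R in HN by (field; lra). lra.
  - specialize (H 1%nat). simpl in H. lra.
Qed.

(* Cauchy's formula only gives [|f z| <= c M]; applying it to the powers of [f] removes [c]. *)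
Theorem maximum_principle f a r R M z :
  (0 < r < R)%R -> holomorphic_on (cdisc a R) f ->
  (forall t, (0 <= t <= 2 * PI)%R -> (Cmod (f (circle a r t)) <= M)%R) -> (Cmod (z - a) < r)%R -> (Cmod (f z) <= M)%R.
Proof.
  intros Hr Hf HM Hz.
  assert (HM0 : (0 <= M)%R) by (eapply Rle_trans; [apply Cmod_ge_0|apply (HM 0%R); pose proof two_PI_pos; lra]).
  apply Rle_of_pow_bounded with (c := (r / (r - Cmod (z - a)))%R); auto; [apply Cmod_ge_0|].
  intros n.
  pose proof (holomorphic_pow _ f n Hf) as Hfn.
  pose proof (cauchy_formula _ a r R z Hr Hfn Hz) as E.
  apply (f_equal Cmod) in E.
  assert (B : (Cmod (2 * PI * Ci * f z ^ n) <= (2 * PI - 0) * (M ^ n * (r / (r - Cmod (z - a)))))%R).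
  { rewrite <- E. apply Cint_bound_on.
    - apply Rlt_le, two_PI_pos.
    - apply path_continuous_div; try lra. now apply (path_continuous_contour (fun w => f w ^ n) a r R).
    - intros t Ht. rewrite Cmod_div by (apply circle_neq; lra).
      rewrite !Cmod_mult, Cmod_Ci, circle_sub, Cmod_pow by lra.
      pose proof (circle_dist a r t z ltac:(lra)) as D.
      replace (M ^ n * (r / (r - Cmod (z - a))))%R with ((M ^ n * (1 * r)) / (r - Cmod (z - a)))%R
        by (field; lra).
      apply Rmult_le_compat.
      + apply Rmult_le_pos; [apply pow_le, Cmod_ge_0|lra].
      + apply Rlt_le, Rinv_0_lt_compat. lra.
      + apply Rmult_le_compat_r; [lra|]. apply pow_incr. split; [apply Cmod_ge_0|now apply HM].
      + apply Rinv_le_contravar; lra. }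
  rewrite !Cmod_mult, !Cmod_R, Cmod_Ci, Cmod_pow, Rabs_right, Rabs_right in B
    by (pose proof PI_RGT_0; lra).
  apply Rmult_le_reg_l with (2 * PI)%R; [apply two_PI_pos|]. lra.
Qed.

Lemma minimum_principle f a r R m z :
  (0 < r < R)%R -> (0 < m)%R -> holomorphic_on (cdisc a R) f ->
  (forall w, cdisc a R w -> f w <> 0) ->
  (forall t, (0 <= t <= 2 * PI)%R -> (m <= Cmod (f (circle a r t)))%R) -> (Cmod (z - a) < r)%R -> (m <= Cmod (f z))%R.
Proof.
  intros Hr Hm Hf H0 HM Hz.
  assert (B : (Cmod (1 / f z) <= / m)%R).
  { apply (maximum_principle (fun w => 1 / f w) a r R); auto.
    - apply holomorphic_div; auto. apply holomorphic_const.
    - intros t Ht. rewrite Cmod_div by (apply H0, circle_in_disc; lra). rewrite Cmod_1.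
      unfold Rdiv. rewrite Rmult_1_l. apply Rinv_le_contravar; auto. }
  assert (Hfz : f z <> 0) by (apply H0; unfold cdisc; lra).
  rewrite Cmod_div, Cmod_1 in B by auto. unfold Rdiv in B. rewrite Rmult_1_l in B.
  apply Cmod_gt_0 in Hfz. apply Rinv_le_contravar in B; [|now apply Rinv_0_lt_compat].
  now rewrite !Rinv_inv in B.
Qed.

Lemma schwarz f z :
  holomorphic_on (cdisc 0 1) f -> (forall w, cdisc 0 1 w -> (Cmod (f w) <= 1)%R) -> f 0 = 0 ->
  cdisc 0 1 z -> (Cmod (f z) <= Cmod z)%R.
Proof.
  intros Hf Hb H0 Hz.
  assert (Ez : forall w, w - 0 = w) by (intros; ring).
  destruct (difference_quotient_holomorphic _ f 0 (exhausted_open _ (cdisc_exhausted 0 1)) Hf) as (q & Hq & Eq).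
  { unfold cdisc. rewrite Ez, Cmod_0. lra. }
  assert (Eq' : forall w, f w = q w * w) by (intros w; pose proof (Eq w) as E; rewrite H0, !Ez in E; exact E).
  unfold cdisc in Hz. rewrite Ez in Hz.
  (* Nothing is known on the unit circle, so [q] is bounded by [/ r] on smaller circles; [r] is
     pushed towards 1 only afterwards. *)
  assert (B : forall r, (Cmod z < r < 1)%R -> (Cmod (f z) * r <= Cmod z)%R).
  { intros r Hr. pose proof (Cmod_ge_0 z) as Hz0.
    assert (Hqz : (Cmod (q z) <= / r)%R).
    { apply (maximum_principle q 0 r 1); auto; [lra| |rewrite Ez; lra].
      intros t _. set (w := circle 0 r t).
      assert (Hw : Cmod w = r) by (rewrite <- (Ez w); apply circle_sub; lra).
      apply Rmult_le_reg_r with r; [lra|]. rewrite Rinv_l by lra.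
      rewrite <- Hw. rewrite <- Cmod_mult, <- Eq'. apply Hb. unfold cdisc. rewrite Ez; lra. }
    rewrite Eq', Cmod_mult. apply Rmult_le_compat_r with (r := r) in Hqz; [|lra].
    rewrite Rinv_l in Hqz by lra.
    replace (Cmod (q z) * Cmod z * r)%R with (Cmod (q z) * r * Cmod z)%R by ring. nra. }
  apply Rnot_lt_le. intros Hlt. pose proof (Cmod_ge_0 z) as Hz0.
  (* If the claim failed, this ratio would be below 1, and a radius strictly between
     [Rmax x (Cmod z)] and 1 would contradict [B]. *)
  set (x := (Cmod z / Cmod (f z))%R).
  assert (Hx : (x * Cmod (f z) = Cmod z)%R) by (unfold x; field; lra).
  assert (Hx1 : (x < 1)%R) by nra.
  set (r := ((1 + Rmax x (Cmod z)) / 2)%R).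
  pose proof (Rmax_l x (Cmod z)). pose proof (Rmax_r x (Cmod z)).
  assert (Rmax x (Cmod z) < 1)%R by (apply Rmax_lub_lt; auto).
  specialize (B r ltac:(unfold r; lra)). assert (x < r)%R by (unfold r; lra). nra.
Qed.

Lemma Cmod_sq c : (Cmod c * Cmod c = Re c * Re c + Im c * Im c)%R.
Proof. pose proof (Cmod2_alt c). simpl in H. lra. Qed.

(** For [x] and [y] in the half-plane the right side is positive, which says that the Cayley
    quotient [(x - y) / (x - Cconj y)] has modulus below 1. *)
Lemma Cmod_sub_conj_sq x y :
  (Cmod (x - Cconj y) * Cmod (x - Cconj y) - Cmod (x - y) * Cmod (x - y) = 4 * Im x * Im y)%R.
Proof. rewrite !Cmod_sq. unfold Re, Im. simpl. ring. Qed.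

(** Schwarz's lemma for [f] conjugated by the Cayley maps that send [w'] and [f w'] to 0. The second
    map requires [Im (f w') > 0]. The inequality is multiplied out so that it keeps a meaning
    without that condition. *)
Lemma schwarz_pick_pos f w w' :
  holomorphic_on upper_half_plane f -> (forall v, upper_half_plane v -> (0 <= Im (f v))%R) ->
  upper_half_plane w -> upper_half_plane w' -> (0 < Im (f w'))%R ->
  (Cmod (f w - f w') * Cmod (w - Cconj w') <= Cmod (w - w') * Cmod (f w - Cconj (f w')))%R.
Proof.
  intros Hf Hpos Hw Hw' Hb. unfold upper_half_plane in Hw, Hw'.
  set (b := f w') in *.
  assert (Nb : forall v, (0 <= Im v)%R -> v - Cconj b <> 0).
  { intros v Hv E. apply (f_equal Im) in E. unfold Im, Cconj in *. simpl in E. lra. }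
  assert (Nw : w - Cconj w' <> 0).
  { intros E. apply (f_equal Im) in E. unfold Im, Cconj in *. simpl in E. lra. }
  assert (Tle : forall v, (0 <= Im v)%R -> (Cmod ((v - b) / (v - Cconj b)) <= 1)%R).
  { intros v Hv. rewrite Cmod_div by auto.
    pose proof (proj1 (Cmod_gt_0 _) (Nb v Hv)) as Hp.
    apply Rmult_le_reg_r with (Cmod (v - Cconj b)); auto.
    unfold Rdiv. rewrite Rmult_assoc, Rinv_l by lra.
    pose proof (Cmod_sub_conj_sq v b) as E. pose proof (Cmod_ge_0 (v - b)).
    assert (0 <= 4 * Im v * Im b)%R by nra. nra. }
  assert (N1 : forall z, (Cmod z < 1)%R -> 1 - z <> 0).
  { intros z Hz E. apply (f_equal (fun u => 1 - u)) in E.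
    replace (1 - (1 - z)) with z in E by ring. rewrite E in Hz.
    replace (1 - 0) with (RtoC 1) in Hz by ring. rewrite Cmod_1 in Hz. lra. }
  (* The inverse of the Cayley map [(w - w') / (w - Cconj w')]; it sends 0 to [w']. *)
  set (phi := fun z => (w' - Cconj w' * z) / (1 - z)).
  assert (Hphi : forall z, cdisc 0 1 z -> upper_half_plane (phi z)).
  { intros z Hz. unfold cdisc in Hz. replace (z - 0) with z in Hz by ring.
    assert (E : phi z - w' = z * (phi z - Cconj w')) by (unfold phi; field; auto).
    apply (f_equal Cmod) in E. rewrite Cmod_mult in E.
    pose proof (Cmod_sub_conj_sq (phi z) w') as D.
    assert (Hp : (0 < Cmod (phi z - Cconj w'))%R).
    { destruct (Cmod_ge_0 (phi z - Cconj w')) as [|E0]; auto. exfalso.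
      rewrite <- E0, Rmult_0_r in E. symmetry in E0. apply Cmod_sub_eq_0 in E, E0.
      rewrite E in E0. apply (f_equal Im) in E0. unfold Im, Cconj in *. simpl in E0. lra. }
    unfold upper_half_plane. pose proof (Cmod_ge_0 z).
    rewrite E in D. set (p := Cmod (phi z - Cconj w')) in *. set (s := Cmod z) in *.
    assert (0 < p * p * (1 - s * s))%R by (apply Rmult_lt_0_compat; nra). nra. }
  set (F := fun z => (f (phi z) - b) / (f (phi z) - Cconj b)).
  assert (Hph : holomorphic_on (cdisc 0 1) phi).
  { apply (holomorphic_div _ (fun z => w' - Cconj w' * z) (fun z => 1 - z)).
    - apply (holomorphic_minus _ (fun _ => w')); [apply holomorphic_const|].
      apply (holomorphic_mult _ (fun _ => Cconj w')); [apply holomorphic_const|apply holomorphic_id].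
    - apply (holomorphic_minus _ (fun _ => 1)); [apply holomorphic_const|apply holomorphic_id].
    - intros z Hz. apply N1. unfold cdisc in Hz. now replace (z - 0) with z in Hz by ring. }
  assert (HF : holomorphic_on (cdisc 0 1) F).
  { assert (Hfp := holomorphic_comp _ _ f phi Hf Hph Hphi).
    apply (holomorphic_div _ (fun z => f (phi z) - b) (fun z => f (phi z) - Cconj b)).
    - apply (holomorphic_minus _ (fun z => f (phi z))); auto. apply holomorphic_const.
    - apply (holomorphic_minus _ (fun z => f (phi z))); auto. apply holomorphic_const.
    - intros z Hz. apply Nb, Hpos, Hphi, Hz. }
  set (z := (w - w') / (w - Cconj w')).
  assert (Hz1 : (Cmod z < 1)%R).
  { unfold z. rewrite Cmod_div by auto. pose proof (proj1 (Cmod_gt_0 _) Nw) as Hp.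
    apply Rmult_lt_reg_r with (Cmod (w - Cconj w')); auto.
    unfold Rdiv. rewrite Rmult_assoc, Rinv_l by lra.
    pose proof (Cmod_sub_conj_sq w w') as E. pose proof (Cmod_ge_0 (w - w')).
    assert (0 < 4 * Im w * Im w')%R by nra. nra. }
  assert (Nww : w' - Cconj w' <> 0).
  { intros E. apply (f_equal Im) in E. unfold Im, Cconj in *. simpl in E. lra. }
  assert (Ez : phi z = w).
  { unfold phi, z. field. split; auto.
    replace (w - Cconj w' - (w - w')) with (w' - Cconj w') by ring. exact Nww. }
  assert (S : (Cmod (F z) <= Cmod z)%R).
  { apply schwarz; auto.
    - intros v Hv. apply Tle, Hpos, Hphi, Hv.
    - unfold F. replace (phi 0) with w'.
      + fold b. replace (b - b) with (RtoC 0) by ring. unfold Cdiv. ring.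
      + unfold phi. field.
    - unfold cdisc. replace (z - 0) with z by ring. exact Hz1. }
  unfold F in S. rewrite Ez in S. unfold z in S.
  assert (Hfw : (0 <= Im (f w))%R) by (apply Hpos, Hw).
  rewrite !Cmod_div in S by auto.
  pose proof (proj1 (Cmod_gt_0 _) Nw) as Hp1. pose proof (proj1 (Cmod_gt_0 _) (Nb _ Hfw)) as Hp2.
  apply Rmult_le_compat_r with (r := (Cmod (w - Cconj w') * Cmod (f w - Cconj b))%R) in S; [|nra].
  replace (Cmod (f w - b) / Cmod (f w - Cconj b) * (Cmod (w - Cconj w') * Cmod (f w - Cconj b)))%R
    with (Cmod (f w - b) * Cmod (w - Cconj w'))%R in S by (field; lra).
  replace (Cmod (w - w') / Cmod (w - Cconj w') * (Cmod (w - Cconj w') * Cmod (f w - Cconj b)))%R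
    with (Cmod (w - w') * Cmod (f w - Cconj b))%R in S by (field; lra).
  exact S.
Qed.

(** Add [e * Ci] to [f] and let [e] tend to 0. Real values must be allowed because the inequality is
    applied to displacements [g w - w], which are real when [g] is a translation. *)
Theorem schwarz_pick f w w' :
  holomorphic_on upper_half_plane f -> (forall v, upper_half_plane v -> (0 <= Im (f v))%R) ->
  upper_half_plane w -> upper_half_plane w' ->
  (Cmod (f w - f w') * Cmod (w - Cconj w') <= Cmod (w - w') * Cmod (f w - Cconj (f w')))%R.
Proof.
  intros Hf Hpos Hw Hw'.
  apply le_epsilon. intros eps Heps.
  set (e := (eps / (2 * (Cmod (w - w') + 1)))%R).
  pose proof (Cmod_ge_0 (w - w')) as H0.
  assert (He : (0 < e)%R) by (apply Rdiv_lt_0_compat; lra).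
  pose proof (schwarz_pick_pos (fun v => f v + e * Ci) w w') as H. cbv beta in H.
  assert (HI : forall v, Im (f v + e * Ci) = (Im (f v) + e)%R)
    by (intros v; unfold Im, RtoC, Ci; simpl; ring).
  specialize (H ltac:(apply holomorphic_plus; auto; apply holomorphic_const)).
  specialize (H ltac:(intros v Hv; rewrite HI; specialize (Hpos v Hv); lra) Hw Hw').
  specialize (H ltac:(rewrite HI; specialize (Hpos w' Hw'); lra)). cbv beta in H.
  replace (f w + e * Ci - (f w' + e * Ci)) with (f w - f w') in H by ring.
  eapply Rle_trans; [exact H|].
  replace (f w + e * Ci - Cconj (f w' + e * Ci)) with (f w - Cconj (f w') + RtoC (2 * e) * Ci)
    by (unfold Cconj, RtoC, Ci; apply injective_projections; simpl; ring).
  apply Rle_trans with (Cmod (w - w') * (Cmod (f w - Cconj (f w')) + 2 * e))%R.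
  - apply Rmult_le_compat_l; auto. eapply Rle_trans; [apply Cmod_triangle|].
    rewrite Cmod_mult, Cmod_R, Cmod_Ci, Rabs_right by lra. lra.
  - assert (E : (e * (2 * (Cmod (w - w') + 1)) = eps)%R) by (unfold e; field; lra). nra.
Qed.

(** * Inequalities of Harnack type *)

Lemma half_plane_translate f y0 :
  holomorphic_on (fun w => (y0 < Im w)%R) f ->
  holomorphic_on upper_half_plane (fun w => f (w + y0 * Ci)).
Proof.
  intros Hf. apply (holomorphic_comp _ (fun w => (y0 < Im w)%R) f (fun w => w + y0 * Ci)); auto.
  - apply holomorphic_plus; [apply holomorphic_id|apply holomorphic_const].
  - intros z Hz. unfold upper_half_plane, Im, RtoC, Ci in *. simpl. lra.
Qed.

Lemma Im_add_imaginary w y : Im (w + RtoC y * Ci) = (Im w + y)%R.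
Proof. unfold Im, RtoC, Ci. simpl. ring. Qed.

Lemma Im_imaginary y : Im (RtoC 0 + RtoC y * Ci) = y.
Proof. rewrite Im_add_imaginary. unfold Im, RtoC. simpl. ring. Qed.

Lemma Cmod_sub_conj_self f g : (0 <= Im g)%R -> (Cmod (f - Cconj g) <= Cmod (f - g) + 2 * Im g)%R.
Proof.
  intros Hg. eapply Rle_trans; [apply (Cmod_sub_triangle g)|].
  replace (g - Cconj g) with (RtoC (2 * Im g) * Ci)
    by (unfold Cconj, RtoC, Ci, Im; apply injective_projections; simpl; ring).
  rewrite Cmod_mult, Cmod_R, Cmod_Ci, Rabs_right by lra. lra.
Qed.

(** A small imaginary part at [w'] forces a small variation around [w']. This is Schwarz-Pick above
    the line of height [y0], with the two distances to conjugate points estimated by the triangle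
    inequality. *)
Lemma harnack f y0 w w' :
  holomorphic_on (fun w => (y0 < Im w)%R) f ->
  (forall v, (y0 < Im v)%R -> (0 <= Im (f v))%R) ->
  (Cmod (w - w') < Im w' - y0)%R ->
  (Cmod (f w - f w') * (Im w' - y0 - Cmod (w - w')) <= Cmod (w - w') * Im (f w'))%R.
Proof.
  intros Hf Hpos Hww.
  pose proof (Cmod_ge_0 (w - w')) as Hs.
  assert (Hw' : (y0 < Im w')%R) by lra.
  assert (Hw : (y0 < Im w)%R).
  { pose proof (im_le_Cmod (w - w')) as H. apply Rabs_le_between in H.
    change (Im (w - w')) with (Im w - Im w')%R in H. lra. }
  set (v := w + RtoC (- y0) * Ci). set (v' := w' + RtoC (- y0) * Ci).
  assert (Ev : v + y0 * Ci = w) by (unfold v; rewrite RtoC_opp; ring).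
  assert (Ev' : v' + y0 * Ci = w') by (unfold v'; rewrite RtoC_opp; ring).
  assert (Iv : Im v = (Im w - y0)%R) by (unfold v; rewrite Im_add_imaginary; ring).
  assert (Iv' : Im v' = (Im w' - y0)%R) by (unfold v'; rewrite Im_add_imaginary; ring).
  pose proof (schwarz_pick _ v v' (half_plane_translate f y0 Hf)) as H. cbv beta in H.
  rewrite Ev, Ev' in H.
  specialize (H ltac:(intros u Hu; apply Hpos; rewrite Im_add_imaginary; unfold upper_half_plane in Hu; lra)).
  specialize (H ltac:(unfold upper_half_plane; lra) ltac:(unfold upper_half_plane; lra)).
  assert (Evv : v - v' = w - w') by (unfold v, v'; ring). rewrite Evv in H.
  pose proof (Cmod_sub_conj_self (f w) (f w') (Hpos w' Hw')) as Hc.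
  assert (HA : (2 * (Im w' - y0) - Cmod (w - w') <= Cmod (v - Cconj v'))%R).
  { pose proof (Cmod_sub_triangle v v' (Cconj v')) as T.
    replace (v' - Cconj v') with (RtoC (2 * Im v') * Ci) in T
      by (unfold Cconj, RtoC, Ci, Im; apply injective_projections; simpl; ring).
    rewrite Cmod_mult, Cmod_R, Cmod_Ci, Rabs_right, (Cmod_sub_sym v' v), Evv, Iv' in T by lra. lra. }
  pose proof (Cmod_ge_0 (f w - f w')) as Hp.
  set (p := Cmod (f w - f w')) in *. set (s := Cmod (w - w')) in *.
  assert (p * (2 * (Im w' - y0) - s) <= p * Cmod (v - Cconj v'))%R by (apply Rmult_le_compat_l; lra).
  assert (s * Cmod (f w - Cconj (f w')) <= s * (p + 2 * Im (f w')))%R by (apply Rmult_le_compat_l; lra).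
  nra.
Qed.

(** At equal heights [A * A - s * s] is exactly [4 * Im w' * Im w'], so Schwarz-Pick is multiplied
    by [A + s] instead of being estimated. Unlike [harnack], this holds even when [w'] is closer to
    the real axis than to [w]. *)
Lemma harnack_horizontal f w w' :
  holomorphic_on upper_half_plane f -> (forall v, upper_half_plane v -> (0 <= Im (f v))%R) ->
  upper_half_plane w' -> Im w = Im w' -> (Cmod (w - w') <= 1)%R ->
  (Cmod (f w - f w') * (Im w' * Im w') <= (1 + Im w') * Im (f w'))%R.
Proof.
  intros Hf Hpos Hw' Hy Hs1.
  assert (Hw : upper_half_plane w) by (unfold upper_half_plane in *; lra).
  pose proof (schwarz_pick f w w' Hf Hpos Hw Hw') as H.
  pose proof (Cmod_sub_conj_self (f w) (f w') (Hpos w' Hw')) as Hc.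
  pose proof (Cmod_sub_conj_self w w' ltac:(unfold upper_half_plane in Hw'; lra)) as HA.
  pose proof (Cmod_sub_conj_sq w w') as E. rewrite Hy in E.
  pose proof (Cmod_ge_0 (w - w')). pose proof (Cmod_ge_0 (f w - f w')).
  pose proof (Cmod_ge_0 (w - Cconj w')). pose proof (Hpos w' Hw') as Hv.
  unfold upper_half_plane in Hw'.
  set (p := Cmod (f w - f w')) in *. set (s := Cmod (w - w')) in *.
  set (A := Cmod (w - Cconj w')) in *. set (y := Im w') in *. set (v := Im (f w')) in *.
  assert (H3 : (p * (A - s) <= 2 * s * v)%R).
  { assert (s * Cmod (f w - Cconj (f w')) <= s * (p + 2 * v))%R by (apply Rmult_le_compat_l; lra). lra. }
  assert (H4 : (p * (A - s) * (A + s) <= 2 * s * v * (A + s))%R) by (apply Rmult_le_compat_r; lra).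
  replace (p * (A - s) * (A + s))%R with (p * (A * A - s * s))%R in H4 by ring. rewrite E in H4.
  assert (H5 : (2 * s * v * (A + s) <= 2 * 1 * v * (2 + 2 * y))%R).
  { apply Rmult_le_compat; try lra.
    - apply Rmult_le_pos; lra.
    - apply Rmult_le_compat_r; lra. }
  lra.
Qed.

(** * The identity theorem and inverses of injective functions *)

(** As [f] vanishes near [a], [f w / (w - a) ^ n] is holomorphic for every [n]. The maximum
    principle gives [Cmod (f z) <= (Cmod (z - a) / r) ^ n * M], which tends to 0. *)
Lemma identity_theorem_disc f a R d z :
  holomorphic_on (cdisc a R) f -> (0 < d)%R -> (forall w, cdisc a d w -> f w = 0) ->
  cdisc a R z -> f z = 0.
Proof.
  intros Hf Hd H0 Hz. unfold cdisc in Hz.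
  set (r := ((Cmod (z - a) + R) / 2)%R).
  pose proof (Cmod_ge_0 (z - a)) as Hza.
  assert (Hr : (0 < r < R)%R) by (unfold r; lra).
  assert (Hzr : (Cmod (z - a) < r)%R) by (unfold r; lra).
  destruct (path_continuous_bounded (fun t => f (circle a r t))) with (a := 0%R) (b := (2 * PI)%R)
    as [M HM].
  { apply path_continuous_comp; [|apply path_continuous_circle].
    intros t. apply (holomorphic_ccontinuous (cdisc a R)); auto. apply circle_in_disc. lra. }
  { apply Rlt_le, two_PI_pos. }
  assert (Haa : a - a = 0) by ring.
  assert (HzM : forall n, (Cmod (f z) * r ^ n <= Cmod (z - a) ^ n * M)%R).
  { intros n. destruct (classic (z = a)) as [->|Hne].
    { rewrite H0 by (unfold cdisc; rewrite Haa, Cmod_0; auto). rewrite Cmod_0, Rmult_0_l, Haa, Cmod_0.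
      apply Rmult_le_pos; [apply pow_le; lra|].
      eapply Rle_trans; [apply Cmod_ge_0|apply (HM 0%R)]. pose proof two_PI_pos. lra. }
    assert (B : (Cmod (f z / (z - a) ^ n) <= M / r ^ n)%R).
    { apply (maximum_principle (fun w => f w / (w - a) ^ n) a r R); auto.
      - intros w Hw. destruct (classic (w = a)) as [->|Hwa].
        + exists (RtoC 0). apply is_cderive_ext_near with (fun _ => 0); [|apply is_cderive_const].
          exists d. split; auto. intros v Hv. rewrite H0 by exact Hv. unfold Cdiv. ring.
        + destruct (Hf w Hw) as [l Hl].
          destruct (holomorphic_pow (cdisc a R) (fun w => w - a) n) with (z := w) as [l' Hl']; auto.
          { apply holomorphic_minus; [apply holomorphic_id|apply holomorphic_const]. }
          eexists. apply is_cderive_div; [|exact Hl|exact Hl'].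
          apply Cpow_nz. now apply Csub_neq_0.
      - intros t Ht. assert (N : circle a r t - a <> 0).
        { apply circle_neq; [lra|]. rewrite Haa, Cmod_0. lra. }
        rewrite Cmod_div by now apply Cpow_nz.
        rewrite Cmod_pow, circle_sub by lra. apply Rmult_le_compat_r; [|now apply HM].
        apply Rlt_le, Rinv_0_lt_compat, pow_lt. lra. }
    assert (N := Csub_neq_0 z a Hne). assert (N' := proj1 (Cmod_gt_0 _) N).
    rewrite Cmod_div, Cmod_pow in B by now apply Cpow_nz.
    assert (P1 : (0 < Cmod (z - a) ^ n)%R) by now apply pow_lt.
    assert (P2 : (0 < r ^ n)%R) by (apply pow_lt; lra).
    apply Rmult_le_compat_r with (r := (Cmod (z - a) ^ n * r ^ n)%R) in B; [|nra].
    replace (Cmod (f z) / Cmod (z - a) ^ n * (Cmod (z - a) ^ n * r ^ n))%R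
      with (Cmod (f z) * r ^ n)%R in B by (field; lra).
    replace (M / r ^ n * (Cmod (z - a) ^ n * r ^ n))%R
      with (Cmod (z - a) ^ n * M)%R in B by (field; lra). exact B. }
  apply NNPP. intros Hne. apply Cmod_gt_0 in Hne.
  assert (r <= Cmod (z - a))%R; [|lra].
  apply Rle_of_pow_bounded with (c := (M / Cmod (f z))%R); try lra.
  intros n. apply Rmult_le_reg_l with (Cmod (f z)); auto.
  replace (Cmod (f z) * (Cmod (z - a) ^ n * (M / Cmod (f z))))%R
    with (Cmod (z - a) ^ n * M)%R by (field; lra).
  apply HzM.
Qed.

(** The vanishing is carried from [b] to 0 along the segment in [n] steps, each shorter than the
    radius [1 - Cmod b] of discs that stay inside the unit disc. The disc about 0 then reaches every
    point. *)
Lemma identity_theorem_unit_disc f b d z :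
  holomorphic_on Disc f -> Disc b -> (0 < d)%R -> (forall w, cdisc b d w -> f w = 0) ->
  Disc z -> f z = 0.
Proof.
  intros Hf Hb Hd H0 Hz. unfold Disc in Hb, Hz.
  destruct (archimed_cor1 ((1 - Cmod b) / (Cmod b + 1))%R) as (n & Hn & Hn0).
  { apply Rdiv_lt_0_compat; pose proof (Cmod_ge_0 b); lra. }
  assert (Hn1 : (0 < INR n)%R) by now apply lt_0_INR.
  pose proof (Cmod_ge_0 b) as Hb0.
  assert (Hstep : (Cmod b / INR n < 1 - Cmod b)%R).
  { apply Rmult_lt_compat_r with (r := (Cmod b + 1)%R) in Hn; [|lra].
    replace ((1 - Cmod b) / (Cmod b + 1) * (Cmod b + 1))%R with (1 - Cmod b)%R in Hn by (field; lra).
    pose proof (Rinv_0_lt_compat _ Hn1). unfold Rdiv. nra. }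
  set (p := fun k => RtoC (1 - INR k / INR n) * b).
  assert (Hp : forall k, (k <= n)%nat -> (Cmod (p k) <= Cmod b)%R).
  { intros k Hk. unfold p. rewrite Cmod_mult, Cmod_R.
    apply le_INR in Hk. assert (0 <= INR k / INR n <= 1)%R.
    { split; [apply Rdiv_le_0_compat; auto; apply pos_INR|].
      apply Rmult_le_reg_r with (INR n); auto. unfold Rdiv. rewrite Rmult_assoc, Rinv_l by lra. lra. }
    rewrite Rabs_right by lra. nra. }
  assert (Hfd : forall c, (Cmod c <= Cmod b)%R -> holomorphic_on (cdisc c (1 - Cmod b)) f).
  { intros c Hc w Hw. apply Hf. unfold Disc, cdisc in *.
    pose proof (Cmod_triangle (w - c) c) as T. replace (w - c + c) with w in T by ring. lra. }
  assert (Hk : forall k, (k <= n)%nat -> exists e, (0 < e)%R /\ forall w, cdisc (p k) e w -> f w = 0).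
  { induction k as [|k IH]; intros Hk.
    - exists d. split; auto. replace (p 0%nat) with b; auto.
      unfold p. simpl INR. replace (1 - 0 / INR n)%R with 1%R by (unfold Rdiv; ring). ring.
    - destruct (IH ltac:(lia)) as (e & He & H1).
      exists (1 - Cmod b - Cmod b / INR n)%R. split; [lra|]. intros w Hw.
      apply identity_theorem_disc with (p k) (1 - Cmod b)%R e; auto.
      + apply Hfd, Hp. lia.
      + unfold cdisc in *. pose proof (Cmod_sub_triangle (p (S k)) w (p k)) as T.
        replace (p (S k) - p k) with (RtoC (- / INR n) * b) in T.
        * rewrite Cmod_mult, Cmod_R, Rabs_Ropp, Rabs_right in T
            by (apply Rle_ge, Rlt_le, Rinv_0_lt_compat; auto).
          unfold Rdiv in *. lra.
        * unfold p. rewrite S_INR, !RtoC_minus, RtoC_opp. unfold Rdiv. rewrite !RtoC_mult, RtoC_plus. ring. }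
  destruct (Hk n (Nat.le_refl n)) as (e & He & H1).
  apply identity_theorem_disc with (RtoC 0) 1%R e; auto.
  - intros w Hw. apply Hf. unfold Disc, cdisc in *. now replace (w - 0) with w in Hw by ring.
  - intros w Hw. apply H1. replace (p n) with (RtoC 0); auto.
    unfold p. replace (1 - INR n / INR n)%R with 0%R by (field; lra). ring.
  - unfold cdisc. now replace (z - 0) with z by ring.
Qed.

(** A quantitative form of the fact that an injective holomorphic function has nonzero derivative,
    obtained without counting zeros. The difference quotient based at a nearby [z] with nonzero
    derivative has no zero, so the minimum principle bounds it below at [a], uniformly in [z]. *)
Lemma injective_lower_bound f a R :
  (0 < R)%R -> holomorphic_on (cdisc a R) f ->
  (forall z w, cdisc a R z -> cdisc a R w -> f z = f w -> z = w) ->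
  exists m d, (0 < m)%R /\ (0 < d)%R /\
    forall z, (Cmod (z - a) < d)%R -> (m * Cmod (z - a) <= Cmod (f z - f a))%R.
Proof.
  intros HR Hf Hinj.
  set (r := (R / 2)%R). assert (Hr : (0 < r < R)%R) by (unfold r; lra).
  assert (Haa : cdisc a R a).
  { unfold cdisc. now rewrite (Cmod_sub_diag a). }
  assert (Hc : forall t, cdisc a R (circle a r t)) by (intros t; apply circle_in_disc; lra).
  assert (Hpos : forall t, f (circle a r t) - f a <> 0).
  { intros t E. apply (f_equal (fun u => u + f a)) in E.
    replace (f (circle a r t) - f a + f a) with (f (circle a r t)) in E by ring.
    replace (0 + f a) with (f a) in E by ring. apply Hinj in E; auto.
    pose proof (circle_sub a r t ltac:(lra)) as E'. rewrite E in E'.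
    replace (a - a) with (RtoC 0) in E' by ring. rewrite Cmod_0 in E'. lra. }
  destruct (path_continuous_bounded (fun t => / (f (circle a r t) - f a))) with (a := 0%R) (b := (2 * PI)%R)
    as [M HM].
  { intros t. apply (continuous_comp_path (fun w => / (f w - f a)) (circle a r)); [|apply path_continuous_circle].
    destruct (Hf _ (Hc t)) as [l Hl]. eapply is_cderive_ccontinuous.
    apply (is_cderive_comp (fun w => / w) (fun w => f w - f a)); [apply is_cderive_inv_at, Hpos|].
    apply is_cderive_minus; [exact Hl|apply is_cderive_const]. }
  { apply Rlt_le, two_PI_pos. }
  assert (HM0 : (0 < M)%R).
  { eapply Rlt_le_trans; [|apply (HM 0%R); pose proof two_PI_pos; lra].
    rewrite Cmod_inv by apply Hpos. apply Rinv_0_lt_compat. apply Cmod_gt_0, Hpos. }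
  set (m0 := (/ M)%R). assert (Hm0 : (0 < m0)%R) by now apply Rinv_0_lt_compat.
  assert (Hm : forall t, (0 <= t <= 2 * PI)%R -> (m0 <= Cmod (f (circle a r t) - f a))%R).
  { intros t Ht. specialize (HM t Ht). rewrite Cmod_inv in HM by apply Hpos.
    apply Rinv_le_contravar in HM; [|apply Rinv_0_lt_compat, Cmod_gt_0, Hpos].
    now rewrite Rinv_inv in HM. }
  destruct (holomorphic_ccontinuous _ f a Hf Haa (m0 / 2)%R) as (d1 & Hd1 & H1); [lra|].
  (* On the circle, [f] stays at least [m0 / 2] away from [f z], and [z] is at distance at most
     [2 * r] from the circle's points, so the quotient there is at least [m0 / (4 * r)]. *)
  set (m := (m0 / (4 * r))%R). assert (Hmpos : (0 < m)%R) by (apply Rdiv_lt_0_compat; lra).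
  assert (Hgood : forall z l, (Cmod (z - a) < Rmin d1 r)%R -> is_cderive f z l -> l <> 0 ->
    (m * Cmod (z - a) <= Cmod (f z - f a))%R).
  { intros z l Hz Hl Hl0.
    assert (Hz1 : (Cmod (z - a) < d1)%R) by (exact (Rlt_Rmin_l _ _ _ Hz)).
    assert (Hzr : (Cmod (z - a) < r)%R) by (exact (Rlt_Rmin_r _ _ _ Hz)).
    assert (HzR : cdisc a R z) by (unfold cdisc; lra).
    destruct (difference_quotient_holomorphic _ f z (exhausted_open _ (cdisc_exhausted a R)) Hf HzR)
      as (q & Hq & Eq).
    assert (Hqz : q z = l).
    { destruct (Hq z HzR) as [lq Hlq].
      apply is_cderive_unique with f z; auto.
      apply is_cderive_ext_near with (fun w => f z + q w * (w - z)).
      - exists 1%R. split; [lra|]. intros w _. rewrite <- Eq. ring.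
      - eapply is_cderive_eq.
        + apply is_cderive_plus; [apply is_cderive_const|].
          apply (is_cderive_mult q (fun w => w - z)); [exact Hlq|].
          apply is_cderive_sub_const.
        + ring. }
    assert (Hq0 : forall w, cdisc a R w -> q w <> 0).
    { intros w Hw E. destruct (classic (w = z)) as [->|Hne]; [congruence|].
      apply Hne, Hinj; auto. specialize (Eq w). rewrite E in Eq.
      apply Cmod_sub_eq_0. rewrite Eq. replace (0 * (w - z)) with (RtoC 0) by ring. apply Cmod_0. }
    assert (B : (m <= Cmod (q a))%R).
    { apply (minimum_principle q a r R); auto.
      - intros t Ht. specialize (Hm t Ht). specialize (H1 z Hz1).
        pose proof (Cmod_sub_triangle (f z) (f (circle a r t)) (f a)) as T.
        pose proof (Cmod_sub_triangle a (circle a r t) z) as T'.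
        rewrite circle_sub, (Cmod_sub_sym a z) in T' by lra.
        rewrite Eq, Cmod_mult in T. pose proof (Cmod_ge_0 (q (circle a r t))) as Hq'.
        assert (E : (m * (4 * r) = m0)%R) by (unfold m; field; lra).
        apply Rnot_lt_le. intros Hlt.
        assert (Cmod (q (circle a r t)) * Cmod (circle a r t - z) <= Cmod (q (circle a r t)) * (2 * r))%R
          by (apply Rmult_le_compat_l; lra).
        nra.
      - unfold cdisc in Haa. rewrite (Cmod_sub_diag a). lra. }
    rewrite (Cmod_sub_sym z a), (Cmod_sub_sym (f z)), Eq, Cmod_mult.
    apply Rmult_le_compat_r; [apply Cmod_ge_0|exact B]. }
  exists m, (Rmin d1 r). split; auto. split; [apply Rmin_glb_lt; lra|].
  intros z Hz.
  assert (HzR : cdisc a R z).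
  { unfold cdisc. pose proof (Rmin_r d1 r). lra. }
  apply Rnot_lt_le. intros Hlt.
  (* The strict failure is an open condition, and [f' <> 0] at points arbitrarily close to [z]. *)
  set (gap := (m * Cmod (z - a) - Cmod (f z - f a))%R).
  destruct (holomorphic_ccontinuous _ f z Hf HzR (gap / 2)%R) as (d2 & Hd2 & H2); [unfold gap; lra|].
  set (d3 := Rmin (Rmin d2 (gap / (2 * m))) (Rmin d1 r - Cmod (z - a))).
  assert (Hd3 : (0 < d3)%R).
  { repeat apply Rmin_glb_lt; auto; [|lra]. apply Rdiv_lt_0_compat; unfold gap; lra. }
  assert (Hd3a : (d3 <= d2)%R) by (eapply Rle_trans; [apply Rmin_l|apply Rmin_l]).
  assert (Hd3b : (d3 <= gap / (2 * m))%R) by (eapply Rle_trans; [apply Rmin_l|apply Rmin_r]).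
  assert (Hd3c : (d3 <= Rmin d1 r - Cmod (z - a))%R) by apply Rmin_r.
  assert (Hd3R : forall w, cdisc z d3 w -> (Cmod (w - a) < Rmin d1 r)%R).
  { intros w Hw. unfold cdisc in Hw. pose proof (Cmod_sub_triangle z w a). lra. }
  assert (HwR : forall w, cdisc z d3 w -> cdisc a R w).
  { intros w Hw. specialize (Hd3R w Hw). unfold cdisc. pose proof (Rmin_r d1 r). lra. }
  assert (Hzero : forall w, cdisc z d3 w -> is_cderive f w 0).
  { intros w Hw. destruct (Hf w (HwR w Hw)) as [l Hl].
    destruct (classic (l = RtoC 0)) as [->|Hl0]; [exact Hl|]. exfalso.
    pose proof (Hgood w l (Hd3R w Hw) Hl Hl0) as G. unfold cdisc in Hw.
    specialize (H2 w ltac:(lra)).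
    pose proof (Cmod_sub_triangle w z a) as T1. rewrite (Cmod_sub_sym z w) in T1.
    pose proof (Cmod_sub_triangle (f z) (f w) (f a)) as T2.
    assert (T3 : (m * Cmod (w - z) < gap / 2)%R).
    { replace (gap / 2)%R with (m * (gap / (2 * m)))%R by (field; lra). apply Rmult_lt_compat_l; lra. }
    unfold gap in *. nra. }
  assert (Hzz : cdisc z d3 z).
  { unfold cdisc. now rewrite (Cmod_sub_diag z). }
  assert (Hz2 : cdisc z d3 (z + RtoC (d3 / 2))).
  { unfold cdisc. replace (z + RtoC (d3 / 2) - z) with (RtoC (d3 / 2)) by ring.
    rewrite Cmod_R, Rabs_right; lra. }
  assert (E : z = z + RtoC (d3 / 2)).
  { apply Hinj; auto. apply constant_of_zero_derivative with (cdisc z d3); auto.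
    apply cdisc_exhausted. }
  apply (f_equal (fun u => u - z)) in E. replace (z - z) with (RtoC 0) in E by ring.
  replace (z + RtoC (d3 / 2) - z) with (RtoC (d3 / 2)) in E by ring.
  apply RtoC_inj in E. lra.
Qed.

(** Otherwise [f - v] has no zero. On the circle of radius [R / 2] it exceeds
    [m * R / 2 - m * R / 4], and the minimum principle carries this bound to [a], where it fails. *)
Lemma local_surjectivity f a R m v :
  (0 < R)%R -> (0 < m)%R -> holomorphic_on (cdisc a R) f ->
  (forall z, cdisc a R z -> (m * Cmod (z - a) <= Cmod (f z - f a))%R) ->
  (Cmod (v - f a) < m * R / 4)%R -> exists z, cdisc a R z /\ f z = v.
Proof.
  intros HR Hm Hf Hlow Hv. apply NNPP. intros Hno.
  assert (Hr : (0 < R / 2 < R)%R) by lra.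
  assert (B : (m * R / 4 <= Cmod (f a - v))%R).
  { apply (minimum_principle (fun z => f z - v) a (R / 2) R); auto.
    - nra.
    - apply holomorphic_minus; auto. apply holomorphic_const.
    - intros w Hw E. apply Hno. exists w. split; auto.
      apply Cmod_sub_eq_0. rewrite E. apply Cmod_0.
    - intros t _. pose proof (Hlow _ (circle_in_disc a (R / 2) R t ltac:(lra))) as L.
      rewrite circle_sub in L by lra.
      pose proof (Cmod_sub_triangle v (f (circle a (R / 2) t)) (f a)). lra.
    - rewrite (Cmod_sub_diag a). lra. }
  rewrite Cmod_sub_sym in B. lra.
Qed.

(** Near [f a] the function [G] is [k] composed with the inverse of [f], but the inverse is never
    constructed: each [v] near [f a] is some [f z], and the lower bound on [f z - f a] compares
    [z - a] with [v - f a]. This will make [g] holomorphic, with the Koenigs function as [f]. *)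
Theorem holomorphic_factor_through_injective V f k G a :
  copen V -> holomorphic_on V f -> holomorphic_on V k ->
  (forall z w, V z -> V w -> f z = f w -> z = w) ->
  (forall z, V z -> G (f z) = k z) -> V a -> exists l, is_cderive G (f a) l.
Proof.
  intros HV Hf Hk Hinj HG Ha.
  destruct (HV a Ha) as (R & HR & HRV).
  destruct (injective_lower_bound f a R HR) as (m & d & Hm & Hd & Hlow).
  { intros w Hw. apply Hf, HRV, Hw. }
  { intros z w Hz Hw. apply Hinj; apply HRV; assumption. }
  destruct (holomorphic_derive V f a Hf Ha) as [lf Hlf]. destruct (holomorphic_derive V k a Hk Ha) as [lk Hlk].
  assert (Hlf0 : lf <> 0).
  { intros ->. destruct (proj1 (is_cderive_eps _ _ _) Hlf (m / 2)%R) as (d' & Hd' & H'); [lra|].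
    set (s := (Rmin d d' / 2)%R). pose proof (Rmin_l d d'). pose proof (Rmin_r d d').
    assert (Hs : (0 < s)%R) by (unfold s; pose proof (Rmin_glb_lt _ _ _ Hd Hd'); lra).
    assert (E : Cmod (a + s - a) = s).
    { replace (a + s - a) with (RtoC s) by ring. rewrite Cmod_R, Rabs_right; lra. }
    specialize (H' (a + s) ltac:(rewrite E; unfold s in *; lra)).
    specialize (Hlow (a + s) ltac:(rewrite E; unfold s in *; lra)).
    replace (f (a + s) - f a - 0 * (a + s - a)) with (f (a + s) - f a) in H' by ring.
    rewrite E in *. nra. }
  exists (lk / lf). apply is_cderive_eps. intros eps Heps.
  set (c := Cmod (lk / lf)). assert (Hc : (0 <= c)%R) by apply Cmod_ge_0.
  (* The errors of [k] and [f] add up to at most [(1 + c) * e * Cmod (z - a) = eps * m * Cmod (z -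
     a)], and [m * Cmod (z - a)] is at most [Cmod (f z - f a)]. *)
  set (e := (eps * m / (1 + c))%R).
  assert (He : (0 < e)%R) by (apply Rdiv_lt_0_compat; [nra|lra]).
  destruct (proj1 (is_cderive_eps _ _ _) Hlf e He) as (d1 & Hd1 & H1).
  destruct (proj1 (is_cderive_eps _ _ _) Hlk e He) as (d2 & Hd2 & H2).
  set (R' := Rmin (Rmin R d) (Rmin d1 d2)).
  assert (HR' : (0 < R')%R) by (repeat apply Rmin_glb_lt; auto).
  assert (R'1 : (R' <= R)%R) by (eapply Rle_trans; [apply Rmin_l|apply Rmin_l]).
  assert (R'2 : (R' <= d)%R) by (eapply Rle_trans; [apply Rmin_l|apply Rmin_r]).
  assert (R'3 : (R' <= d1)%R) by (eapply Rle_trans; [apply Rmin_r|apply Rmin_l]).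
  assert (R'4 : (R' <= d2)%R) by (eapply Rle_trans; [apply Rmin_r|apply Rmin_r]).
  exists (m * R' / 4)%R. split; [nra|]. intros v Hv.
  destruct (local_surjectivity f a R' m v) as (z & Hz & <-); auto.
  { intros w Hw. apply Hf, HRV. unfold cdisc in Hw. lra. }
  { intros w Hw. apply Hlow. unfold cdisc in Hw. lra. }
  unfold cdisc in Hz. rewrite !HG by (auto; apply HRV; lra).
  specialize (H1 z ltac:(lra)). specialize (H2 z ltac:(lra)). specialize (Hlow z ltac:(lra)).
  replace (k z - k a - lk / lf * (f z - f a)) with
    ((k z - k a - lk * (z - a)) - lk / lf * (f z - f a - lf * (z - a))) by (field; auto).
  eapply Rle_trans; [apply Cmod_triangle_sub|]. rewrite Cmod_mult. fold c.
  apply Rle_trans with ((1 + c) * (e * Cmod (z - a)))%R.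
  - assert (c * Cmod (f z - f a - lf * (z - a)) <= c * (e * Cmod (z - a)))%R
      by (apply Rmult_le_compat_l; auto). lra.
  - replace ((1 + c) * (e * Cmod (z - a)))%R with (eps * (m * Cmod (z - a)))%R
      by (unfold e; field; lra).
    apply Rmult_le_compat_l; lra.
Qed.

(** * Self-maps of the half-plane commuting with the unit translation *)

Record shift_map (g : C -> C) : Prop := {
  shift_map_holomorphic : holomorphic_on upper_half_plane g;
  shift_map_maps : forall w, upper_half_plane w -> upper_half_plane (g w);
  shift_map_shift : forall w, upper_half_plane w -> g (w + 1) = g w + 1
}.

Record linearizes (g : C -> C) (c : C) (beta : C -> C) : Prop := {
  linearizes_holomorphic : holomorphic_on upper_half_plane beta;
  linearizes_shift : forall w, upper_half_plane w -> beta (w + 1) = beta w + 1;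
  linearizes_conjugacy : forall w, upper_half_plane w -> beta (g w) = beta w + c
}.

Arguments linearizes_holomorphic {g c beta}.
Arguments linearizes_shift {g c beta}.
Arguments linearizes_conjugacy {g c beta}.

Lemma Im_add_real (w : C) (s : R) : Im (w + s) = Im w.
Proof. unfold Im, RtoC. simpl. ring. Qed.

Lemma upper_add_real (w : C) (s : R) : upper_half_plane w -> upper_half_plane (w + s).
Proof. unfold upper_half_plane. now rewrite Im_add_real. Qed.

Lemma translation_multiple (f : C -> C) (s t : R) :
  (forall w, upper_half_plane w -> f (w + RtoC s) = f w + RtoC t) ->
  forall m w, upper_half_plane w -> f (w + RtoC (IZR m * s)) = f w + RtoC (IZR m * t).
Proof.
  intros H.
  assert (Hn : forall (n : nat) w, upper_half_plane w -> f (w + RtoC (INR n * s)) = f w + RtoC (INR n * t)).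
  { induction n; intros w Hw.
    - simpl INR. rewrite !Rmult_0_l. replace (w + 0) with w by ring. ring.
    - rewrite S_INR. replace (w + RtoC ((INR n + 1) * s)) with (w + RtoC (INR n * s) + s)
        by (rewrite !RtoC_mult, RtoC_plus; ring).
      rewrite H, IHn by (try apply upper_add_real; auto).
      rewrite !RtoC_mult, RtoC_plus. ring. }
  intros m w Hw. destruct (Z_le_gt_dec 0 m) as [Hm|Hm].
  - rewrite <- (Z2Nat.id m), <- INR_IZR_INZ by lia. now apply Hn.
  - specialize (Hn (Z.to_nat (- m)) (w + RtoC (IZR m * s)) (upper_add_real _ _ Hw)).
    rewrite INR_IZR_INZ, Z2Nat.id, opp_IZR in Hn by lia.
    replace (w + RtoC (IZR m * s) + RtoC (- IZR m * s)) with w in Hn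
      by (rewrite !RtoC_mult, RtoC_opp; ring).
    rewrite Hn. rewrite !RtoC_mult, RtoC_opp. ring.
Qed.

(** In Schwarz-Pick for [w + 1] and [w] the two ordinary distances are both 1. Comparing the squared
    distances to the conjugate points leaves [1 + 4 * (Im w)^2 <= 1 + 4 * (Im (g w))^2]. *)
Lemma Im_le_shift_map g w : shift_map g -> upper_half_plane w -> (Im w <= Im (g w))%R.
Proof.
  intros [Hh Hm Hs] Hw.
  pose proof (schwarz_pick g (w + 1) w Hh (fun v Hv => Rlt_le _ _ (Hm v Hv)) (upper_add_real w 1 Hw) Hw) as H.
  rewrite Hs in H by auto.
  replace (g w + 1 - g w) with (RtoC 1) in H by ring. replace (w + 1 - w) with (RtoC 1) in H by ring.
  rewrite Cmod_1, !Rmult_1_l in H.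
  pose proof (Hm w Hw) as Hg. unfold upper_half_plane in *.
  apply Rmult_le_compat with (r1 := Cmod (w + 1 - Cconj w)) (r2 := Cmod (g w + 1 - Cconj (g w))) in H as H2;
    auto using Cmod_ge_0.
  rewrite !Cmod_sq in H2. unfold Re, Im, Cconj, RtoC in *. simpl in *. nra.
Qed.

(* The mean of a periodic holomorphic function over a horizontal period, as an
   increment of a primitive; it does not depend on the height. *)
Lemma periodic_mean (d : C -> C) :
  holomorphic_on upper_half_plane d -> (forall w, upper_half_plane w -> d (w + 1) = d w) ->
  exists k : C, forall (w : C) (M : R), upper_half_plane w ->
    (forall t, (0 <= t <= 1)%R -> (Cmod (d (w + RtoC t)%C - d w) <= M)%R) -> (Cmod (k - d w) <= M)%R.
Proof.
  intros Hd Hp.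
  assert (HE : convexly_exhausted upper_half_plane) by apply (half_plane_exhausted 0).
  destruct (primitive_exists _ d HE Hd) as [D HD].
  set (inc := fun w => D (w + 1) - D w).
  assert (Hi : upper_half_plane Ci) by (unfold upper_half_plane, Im, Ci; simpl; lra).
  exists (inc Ci). intros w M Hw HM.
  rewrite (constant_of_zero_derivative upper_half_plane inc Ci w HE); auto.
  - unfold inc. replace (D (w + 1) - D w - d w) with (D (w + 1) - D w - d w * (w + 1 - w)) by ring.
    replace M with (M * Cmod (w + 1 - w))%R.
    2: { replace (w + 1 - w) with (RtoC 1) by ring. rewrite Cmod_1. ring. }
    assert (Es : forall t, segment_point w (w + 1) t = w + RtoC t) by (intros t; unfold segment_point; ring).
    apply mean_value_bound with (g := d).
    + intros t Ht. rewrite Es. apply (holomorphic_ccontinuous upper_half_plane); auto.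
      now apply upper_add_real.
    + intros t Ht. rewrite Es. apply HD. now apply upper_add_real.
    + intros t Ht. rewrite Es. auto.
  - intros z Hz. eapply is_cderive_eq.
    + apply is_cderive_minus.
      * apply (is_cderive_comp D (fun w => w + 1)).
        -- apply HD. now apply (upper_add_real z 1).
        -- apply is_cderive_plus; [apply is_cderive_id|apply is_cderive_const].
      * now apply HD.
    + rewrite Hp by auto. ring.
Qed.

(* Since [Im (g w - w) >= 0], Harnack's inequality gives this bound, which forces [g w - w]
   to tend to [k] as [Im w] tends to infinity. *)
Definition has_drift (g : C -> C) (k : C) : Prop :=
  forall w, upper_half_plane w ->
    (Cmod (k - (g w - w)) * (Im w * Im w) <= (1 + Im w) * Im (g w - w))%R.

Lemma displacement_holomorphic g : shift_map g -> holomorphic_on upper_half_plane (fun w => g w - w).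
Proof. intros [Hh _ _]. apply holomorphic_minus; auto. apply holomorphic_id. Qed.

Lemma displacement_nonneg g w : shift_map g -> upper_half_plane w -> (0 <= Im (g w - w))%R.
Proof.
  intros Hg Hw. pose proof (Im_le_shift_map g w Hg Hw).
  change (Im (g w - w)) with (Im (g w) - Im w)%R. lra.
Qed.

Lemma drift_exists g : shift_map g -> exists k, has_drift g k.
Proof.
  intros Hg. pose proof (displacement_holomorphic g Hg) as Hu.
  destruct (periodic_mean (fun w => g w - w) Hu) as [k Hk].
  { intros w Hw. cbv beta. rewrite (shift_map_shift g Hg) by auto. ring. }
  exists k. intros w Hw. assert (Hy : (0 < Im w)%R) by exact Hw.
  apply Rmult_le_reg_r with (/ (Im w * Im w))%R; [apply Rinv_0_lt_compat; nra|].
  rewrite Rmult_assoc, Rinv_r, Rmult_1_r by nra.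
  apply (Hk w); auto. intros t Ht.
  apply Rmult_le_reg_r with (Im w * Im w)%R; [nra|].
  rewrite (Rmult_assoc _ (/ _)), Rinv_l, Rmult_1_r by nra.
  apply (harnack_horizontal (fun w => g w - w) (w + t) w Hu); auto.
  - intros v Hv. now apply displacement_nonneg.
  - apply Im_add_real.
  - replace (w + t - w) with (RtoC t) by ring. rewrite Cmod_R, Rabs_right; lra.
Qed.

Lemma Im_le_Cmod_sub a b : (Im a - Im b <= Cmod (a - b))%R.
Proof.
  pose proof (im_le_Cmod (a - b)) as H. apply Rabs_le_between in H.
  change (Im (a - b)) with (Im a - Im b)%R in H. lra.
Qed.

Lemma drift_Im_nonneg g k : shift_map g -> has_drift g k -> (0 <= Im k)%R.
Proof.
  (* At height 3 the drift bound reads [9 * p <= 4 * Im (g w - w)]; the ratio is below 1, so [k]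
     cannot fall below the real axis. *)
  intros Hg Hk. set (w := RtoC 0 + RtoC 3 * Ci).
  assert (Iw : Im w = 3%R) by (unfold w; apply Im_imaginary).
  assert (Hw : upper_half_plane w) by (unfold upper_half_plane; lra).
  specialize (Hk w Hw). rewrite Iw in Hk. pose proof (displacement_nonneg g w Hg Hw).
  pose proof (Im_le_Cmod_sub (g w - w) k) as T. rewrite Cmod_sub_sym in T. lra.
Qed.

(** For real [k] the drift bound at height 3 forces the displacement at [w0] to equal [k]. A map
    into the closed half-plane with a real value is constant: Schwarz-Pick puts the same factor
    [Cmod (g w - w - k)] on both sides, against distances that differ strictly. *)
Lemma translation_of_real_drift g k :
  shift_map g -> has_drift g k -> Im k = 0%R -> forall w, upper_half_plane w -> g w = w + k.
Proof.
  intros Hg Hk Hk0 w Hw. set (w0 := RtoC 0 + RtoC 3 * Ci).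
  assert (Iw : Im w0 = 3%R) by (unfold w0; apply Im_imaginary).
  assert (Hw0 : upper_half_plane w0) by (unfold upper_half_plane; lra).
  specialize (Hk w0 Hw0). rewrite Iw in Hk.
  pose proof (Im_le_Cmod_sub (g w0 - w0) k) as T. rewrite Cmod_sub_sym in T.
  pose proof (Cmod_ge_0 (k - (g w0 - w0))).
  assert (E : k = g w0 - w0) by (apply Cmod_sub_eq_0; lra).
  pose proof (schwarz_pick (fun w => g w - w) w w0 (displacement_holomorphic g Hg)
    (fun v Hv => displacement_nonneg g v Hg Hv) Hw Hw0) as S. cbv beta in S.
  rewrite <- E in S.
  assert (Ec : Cconj k = k).
  { destruct k as [x y]. unfold Im in Hk0. simpl in Hk0. subst y. unfold Cconj. simpl. now rewrite Ropp_0. }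
  rewrite Ec in S. pose proof (Cmod_sub_conj_sq w w0) as Q. rewrite Iw in Q. unfold upper_half_plane in Hw.
  pose proof (Cmod_ge_0 (w - w0)). pose proof (Cmod_ge_0 (w - Cconj w0)).
  destruct (Cmod_ge_0 (g w - w - k)) as [Hp|Hp].
  - exfalso. assert (Cmod (w - Cconj w0) <= Cmod (w - w0))%R by nra. nra.
  - symmetry in Hp. apply Cmod_sub_eq_0 in Hp. rewrite <- Hp. ring.
Qed.

Lemma displacement_lower_bound g k y0 :
  shift_map g -> has_drift g k -> (0 < Im k)%R -> (0 < y0)%R ->
  exists c, (0 < c)%R /\ forall w, (y0 <= Im w)%R -> (Im w + c <= Im (g w))%R.
Proof.
  (* The last two terms bound [(1 + y) / (y * y)] for [y >= y0], so the drift bound gives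
     [Im k <= A * Im (g w - w)]. *)
  intros Hg Hk Hpos Hy0. set (A := (1 + / (y0 * y0) + / y0)%R).
  assert (0 < / (y0 * y0))%R by (apply Rinv_0_lt_compat; nra).
  assert (0 < / y0)%R by now apply Rinv_0_lt_compat.
  assert (HA : (0 < A)%R) by (unfold A; lra).
  exists (Im k / A)%R. split; [now apply Rdiv_lt_0_compat|]. intros w Hw.
  assert (Hw' : upper_half_plane w) by (unfold upper_half_plane; lra).
  specialize (Hk w Hw'). pose proof (displacement_nonneg g w Hg Hw') as Hu.
  pose proof (Im_le_Cmod_sub k (g w - w)) as T.
  set (y := Im w) in *. set (p := Cmod (k - (g w - w))) in *.
  assert (Hp : (p <= (/ (y0 * y0) + / y0) * Im (g w - w))%R).
  { apply Rmult_le_reg_r with (y * y)%R; [nra|]. eapply Rle_trans; [exact Hk|].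
    replace ((/ (y0 * y0) + / y0) * Im (g w - w) * (y * y))%R
      with ((y * y / (y0 * y0) + y * y / y0) * Im (g w - w))%R by (unfold Rdiv; ring).
    apply Rmult_le_compat_r; auto. apply Rplus_le_compat.
    - apply Rmult_le_reg_r with (y0 * y0)%R; [nra|]. unfold Rdiv.
      rewrite Rmult_assoc, Rinv_l by nra. nra.
    - apply Rmult_le_reg_r with y0; [nra|]. unfold Rdiv.
      rewrite Rmult_assoc, Rinv_l by lra. nra. }
  change (Im (g w - w)) with (Im (g w) - y)%R in *.
  assert (Im k / A <= Im (g w) - y)%R; [|lra].
  apply Rmult_le_reg_r with A; auto. unfold Rdiv. rewrite Rmult_assoc, Rinv_l by lra.
  unfold A. lra.
Qed.

Lemma drift_limit g k eps :
  shift_map g -> has_drift g k -> (0 < eps)%R ->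
  exists Y, (0 < Y)%R /\ forall w, (Y < Im w)%R -> (Cmod (k - (g w - w)) < eps)%R.
Proof.
  intros Hg Hk Heps. pose proof (drift_Im_nonneg g k Hg Hk) as Hk0.
  assert (0 <= 2 * Im k / eps)%R by (apply Rdiv_le_0_compat; lra).
  (* Since [Im (g w - w) <= Im k + p], the drift bound at heights above 1 becomes
     [p * (y - 2) <= 2 * Im k]; beyond this height it forces [p < eps]. *)
  exists (2 + 2 * Im k / eps)%R. split; [lra|]. intros w Hw.
  assert (Hw' : upper_half_plane w) by (unfold upper_half_plane; lra).
  specialize (Hk w Hw'). pose proof (Im_le_Cmod_sub (g w - w) k) as T. rewrite Cmod_sub_sym in T.
  set (y := Im w) in *. pose proof (Cmod_ge_0 (k - (g w - w))) as Hp.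
  set (p := Cmod (k - (g w - w))) in *.
  assert (E : (2 * Im k / eps * eps = 2 * Im k)%R) by (field; lra).
  set (q := (2 * Im k / eps)%R) in *.
  assert (H1 : (p * (y * y) <= 2 * y * (Im k + p))%R).
  { eapply Rle_trans; [exact Hk|]. apply Rle_trans with ((1 + y) * (Im k + p))%R.
    - apply Rmult_le_compat_l; lra.
    - apply Rmult_le_compat_r; lra. }
  assert (H2 : (p * y <= 2 * (Im k + p))%R) by (apply Rmult_le_reg_r with y; lra).
  assert (H3 : (p * (y - 2) <= q * eps)%R) by lra.
  apply Rnot_le_lt. intros Hge.
  assert (eps * (y - 2) <= p * (y - 2))%R by (apply Rmult_le_compat_r; lra).
  assert (eps * (y - 2) <= eps * q)%R by lra.
  apply Rmult_le_reg_l in H4; lra.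
Qed.

(** * Uniqueness of the linearization *)

Definition real_subgroup (P : R -> Prop) : Prop :=
  P 0%R /\ (forall s t, P s -> P t -> P (s + t)%R) /\ (forall s, P s -> P (- s)%R).

Lemma real_subgroup_multiple P s : real_subgroup P -> P s -> forall m, P (IZR m * s)%R.
Proof.
  intros (H0 & Hadd & Hopp) Hs.
  assert (Hn : forall n : nat, P (INR n * s)%R).
  { induction n; [simpl; now rewrite Rmult_0_l|].
    rewrite S_INR, Rmult_plus_distr_r, Rmult_1_l. auto. }
  intros m. destruct (Z_le_gt_dec 0 m) as [Hm|Hm].
  - rewrite <- (Z2Nat.id m), <- INR_IZR_INZ by lia. apply Hn.
  - replace (IZR m * s)%R with (- (INR (Z.to_nat (- m)) * s))%R; [apply Hopp, Hn|].
    rewrite INR_IZR_INZ, Z2Nat.id, opp_IZR by lia. ring.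
Qed.

Lemma floor_exists x s : (0 < s)%R -> exists m : Z, (0 <= x - IZR m * s < s)%R.
Proof.
  intros Hs. exists (Int_part (x / s)).
  destruct (base_Int_part (x / s)) as [H1 H2].
  assert (E : (x / s * s = x)%R) by (field; lra).
  split; nra.
Qed.

(* A subgroup of the reals with a least positive element consists of its multiples. *)
Lemma real_subgroup_dense P k :
  real_subgroup P -> P 1%R -> P k -> ~ rational (RtoC k) ->
  forall eps, (0 < eps)%R -> exists s, P s /\ (0 < s < eps)%R.
Proof.
  intros HP H1 Hk Hirr eps Heps. apply NNPP. intros Hno.
  assert (Hmul := fun s Hs => real_subgroup_multiple P s HP Hs).
  destruct HP as (H0 & Hadd & Hopp).
  assert (Hsep : forall s, P s -> (0 < s)%R -> (eps <= s)%R).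
  { intros s Hs Hpos. apply Rnot_lt_le. intros Hlt. apply Hno. exists s. auto. }
  (* Here [- b] is the infimum of the positive elements, taken through opposites. Distinct elements
     of [P] differ by at least [eps], so it is attained. *)
  destruct (completeness (fun x => P (- x)%R /\ (x < 0)%R)) as [b [Hub Hlub]].
  { exists 0%R. intros x [_ Hx]. lra. }
  { exists (-1)%R. split; [|lra]. replace (- -1)%R with 1%R by ring. exact H1. }
  assert (Hex : exists s, P s /\ (0 < s)%R /\ (- b <= s < - b + eps)%R).
  { apply NNPP. intros Hne.
    assert (Hc : is_upper_bound (fun x => P (- x)%R /\ (x < 0)%R) (b - eps)%R).
    { intros x [Hx Hx0]. apply Rnot_lt_le. intros Hlt. apply Hne. exists (- x)%R.
      split; auto. split; [lra|]. specialize (Hub x (conj Hx Hx0)). lra. }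
    specialize (Hlub _ Hc). lra. }
  destruct Hex as (s & Hs & Hs0 & Hsb).
  assert (Hmin : forall t, P t -> (0 < t)%R -> (s <= t)%R).
  { intros t Ht Ht0. apply Rnot_lt_le. intros Hlt.
    assert (Hbt : (- b <= t)%R).
    { assert (- t <= b)%R; [|lra]. apply Hub. split; [|lra].
      replace (- - t)%R with t by ring. exact Ht. }
    assert (Hd : P (s - t)%R) by (unfold Rminus; auto).
    specialize (Hsep _ Hd ltac:(lra)). lra. }
  assert (Hdiv : forall t, P t -> exists m, t = (IZR m * s)%R).
  { intros t Ht. destruct (floor_exists t s Hs0) as [m Hm]. exists m.
    assert (Hr : P (t - IZR m * s)%R) by (unfold Rminus; auto).
    destruct (proj1 Hm) as [Hlt|Heq]; [|lra].
    specialize (Hmin _ Hr Hlt). lra. }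
  destruct (Hdiv 1%R H1) as [m Hm]. destruct (Hdiv k Hk) as [l Hl].
  assert (Hm0 : (0 < m)%Z).
  { apply lt_IZR. apply Rnot_le_lt. intros Hle. nra. }
  apply Hirr. exists l, (Z.to_nat m). split; [lia|].
  rewrite INR_IZR_INZ, Z2Nat.id by lia. f_equal. rewrite Hl.
  assert (0 < IZR m)%R by now apply IZR_lt.
  apply Rmult_eq_reg_r with (IZR m); [|lra]. unfold Rdiv. rewrite (Rmult_assoc _ (/ _)), Rinv_l by lra.
  rewrite Rmult_assoc, (Rmult_comm s), <- Hm. ring.
Qed.

Lemma iterate_upper g n w : shift_map g -> upper_half_plane w -> upper_half_plane (Nat.iter n g w).
Proof. intros Hg Hw. induction n; auto. simpl. now apply (shift_map_maps g Hg). Qed.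

Lemma iterate_Im_le g n w : shift_map g -> upper_half_plane w -> (Im w <= Im (Nat.iter n g w))%R.
Proof.
  intros Hg Hw. induction n; [simpl; lra|]. simpl.
  pose proof (Im_le_shift_map g _ Hg (iterate_upper g n w Hg Hw)). lra.
Qed.

(** If [Im k > 0], orbits climb to infinity while [d] keeps its value along them. If [k] is real,
    [g] is the translation by the irrational [k], so the periods of [d] are dense. Then [d] is
    constant on horizontal lines and equals its mean, which is the same at every height. *)
Lemma invariant_function_zero g k d :
  shift_map g -> has_drift g k -> ~ rational k -> holomorphic_on upper_half_plane d ->
  (forall w, upper_half_plane w -> d (w + 1) = d w) ->
  (forall w, upper_half_plane w -> d (g w) = d w) ->
  (forall eps, (0 < eps)%R -> exists M, forall w, upper_half_plane w -> (M < Im w)%R -> (Cmod (d w) < eps)%R) ->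
  forall w, upper_half_plane w -> d w = 0.
Proof.
  intros Hg Hk Hirr Hd Hper Hinv Hlim w Hw.
  destruct (drift_Im_nonneg g k Hg Hk) as [Hpos|Hreal].
  - destruct (displacement_lower_bound g k (Im w) Hg Hk Hpos Hw) as (c & Hc & Hstep).
    assert (Hn : forall n, (Im w + INR n * c <= Im (Nat.iter n g w))%R /\ d (Nat.iter n g w) = d w).
    { induction n.
      - simpl. split; [lra|auto].
      - destruct IHn as [IH1 IH2]. simpl Nat.iter. split.
        + pose proof (Hstep _ (iterate_Im_le g n w Hg Hw)). rewrite S_INR. lra.
        + rewrite Hinv; auto. now apply iterate_upper. }
    apply NNPP. intros Hne. apply Cmod_gt_0 in Hne.
    destruct (Hlim _ Hne) as [M HM].
    destruct (INR_unbounded ((M - Im w) / c)) as [n Hn'].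
    destruct (Hn n) as [Hn1 Hn2].
    specialize (HM (Nat.iter n g w) (iterate_upper g n w Hg Hw)).
    assert (M < Im (Nat.iter n g w))%R.
    { apply Rmult_gt_compat_r with (r := c) in Hn'; [|lra].
      replace ((M - Im w) / c * c)%R with (M - Im w)%R in Hn' by (field; lra). lra. }
    specialize (HM H). rewrite Hn2 in HM. lra.
  - set (k0 := Re k).
    assert (Ek : k = RtoC k0).
    { destruct k as [x y]. unfold Im in Hreal. simpl in Hreal. subst y. reflexivity. }
    pose proof (translation_of_real_drift g k Hg Hk (eq_sym Hreal)) as Htr.
    set (P := fun s : R => forall w, upper_half_plane w -> d (w + s) = d w).
    assert (HP : real_subgroup P).
    { repeat split.
      - intros v Hv. f_equal. ring.
      - intros s t Hs Ht v Hv.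
        replace (v + RtoC (s + t)) with (v + s + t) by (rewrite RtoC_plus; ring).
        rewrite Ht, Hs; auto. now apply upper_add_real.
      - intros s Hs v Hv. rewrite <- (Hs (v + RtoC (- s)) (upper_add_real _ _ Hv)).
        f_equal. rewrite RtoC_opp. ring. }
    assert (HP1 : P 1%R) by exact Hper.
    assert (HPk : P k0).
    { intros v Hv. rewrite <- Ek, <- Htr by auto. now apply Hinv. }
    rewrite Ek in Hirr.
    pose proof (real_subgroup_dense P k0 HP HP1 HPk Hirr) as Hdense.
    assert (Hconst : forall v t, upper_half_plane v -> d (v + RtoC t) = d v).
    { intros v t Hv. apply Cmod_sub_eq_0, Rle_antisym; [|apply Cmod_ge_0].
      apply le_epsilon. intros eps Heps. rewrite Rplus_0_l.
      destruct (holomorphic_ccontinuous upper_half_plane d (v + RtoC t) Hd (upper_add_real v t Hv) eps Heps)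
        as (e & He & Hcont).
      destruct (Hdense e He) as (s & Hs & Hs0).
      destruct (floor_exists t s (proj1 Hs0)) as [m Hm].
      rewrite <- (real_subgroup_multiple P s HP Hs m v Hv), Cmod_sub_sym.
      apply Rlt_le, Hcont.
      replace (v + RtoC (IZR m * s) - (v + RtoC t)) with (- RtoC (t - IZR m * s))
        by (rewrite RtoC_minus; ring).
      rewrite Cmod_opp, Cmod_R, Rabs_right; lra. }
    destruct (periodic_mean d Hd Hper) as [mu Hmu].
    assert (Hmean : forall v, upper_half_plane v -> mu = d v).
    { intros v Hv. apply Cmod_sub_eq_0, Rle_antisym; [|apply Cmod_ge_0].
      apply Hmu; auto. intros t _. rewrite Hconst by auto.
      replace (d v - d v) with (RtoC 0) by ring. rewrite Cmod_0. lra. }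
    rewrite <- (Hmean w Hw). apply NNPP. intros Hne. apply Cmod_gt_0 in Hne.
    destruct (Hlim _ Hne) as [M HM].
    set (v := RtoC 0 + RtoC (Rmax M 0 + 1) * Ci).
    assert (Iv : Im v = (Rmax M 0 + 1)%R)
      by (unfold v; apply Im_imaginary).
    pose proof (Rmax_l M 0). pose proof (Rmax_r M 0).
    assert (Hv : upper_half_plane v) by (unfold upper_half_plane; lra).
    specialize (HM v Hv ltac:(lra)). rewrite <- (Hmean v Hv) in HM. lra.
Qed.

(** High up, [c = beta (g w) - beta w] is close to [g w - w], which is close to [k]. *)
Lemma drift_of_tangent g k c beta :
  shift_map g -> has_drift g k -> linearizes g c beta ->
  tangent_to_identity_at_infinity upper_half_plane beta -> k = c.
Proof.
  intros Hg Hk [_ _ Hc] Ht. apply NNPP. intros Hne. apply Cmod_sub_gt_0 in Hne.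
  set (e := (Cmod (k - c) / 3)%R). assert (He : (0 < e)%R) by (unfold e; lra).
  destruct (drift_limit g k e Hg Hk He) as (Y & HY & HY').
  destruct (Ht e He) as [M HM].
  set (w := RtoC 0 + RtoC (Rmax M Y + 1) * Ci).
  assert (Iw : Im w = (Rmax M Y + 1)%R)
    by (unfold w; apply Im_imaginary).
  pose proof (Rmax_l M Y). pose proof (Rmax_r M Y).
  assert (Hw : upper_half_plane w) by (unfold upper_half_plane; lra).
  specialize (HY' w ltac:(lra)).
  pose proof (shift_map_maps g Hg w Hw) as Hgw. pose proof (Im_le_shift_map g w Hg Hw).
  assert (B1 := HM w Hw ltac:(rewrite Rabs_right; lra)).
  assert (B2 := HM (g w) Hgw ltac:(unfold upper_half_plane in Hgw; rewrite Rabs_right; lra)).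
  rewrite Hc in B2 by auto.
  assert (T : (Cmod (k - c) < 3 * e)%R); [|unfold e in T; lra].
  replace (k - c) with ((k - (g w - w)) + ((beta w - w) - (beta w + c - g w))) by ring.
  eapply Rle_lt_trans; [apply Cmod_triangle|].
  pose proof (Cmod_triangle_sub (beta w - w) (beta w + c - g w)). lra.
Qed.

(** * Linearizers with a rational coefficient *)

Lemma bounded_on_strip b y1 y2 :
  holomorphic_on upper_half_plane b -> (forall w, upper_half_plane w -> b (w + 1) = b w) ->
  (0 < y1)%R -> exists M, forall w, (y1 <= Im w <= y2)%R -> (Cmod (b w) <= M)%R.
Proof.
  intros Hb Hper Hy1.
  destruct (Rlt_le_dec y2 y1) as [Hlt|Hle].
  { exists 0%R. intros w Hw. lra. }
  (* A disc tangent to the real axis, large enough for its interior to contain the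
     rectangle [0 <= Re w <= 1], [y1 <= Im w <= y2]. *)
  set (A := ((1 + y2 * y2) / y1)%R).
  assert (EA : (A * y1 = 1 + y2 * y2)%R) by (unfold A; field; lra).
  assert (HA : (2 <= A)%R).
  { apply Rmult_le_reg_r with y1; auto. rewrite EA.
    assert (y1 * y1 <= y2 * y2)%R by nra. pose proof (Rle_0_sqr (1 - y1)) as S. unfold Rsqr in S. lra. }
  (* Since [A * y1 = 1 + y2 * y2], points of the rectangle lie at squared distance at most
     [A * A - 1] from [a], and [r * r] is slightly larger than that while [r < A]. *)
  set (r := (A - / (2 * A))%R).
  assert (Hi : (0 < / (2 * A) < 1)%R).
  { split; [apply Rinv_0_lt_compat; lra|]. rewrite <- Rinv_1. apply Rinv_lt_contravar; lra. }
  assert (Ei : (/ (2 * A) * A = / 2)%R) by (field; lra).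
  assert (Hr : (0 < r < A)%R) by (unfold r; lra).
  assert (Hr2 : (A * A - 1 < r * r)%R) by (unfold r; nra).
  set (a := RtoC 0 + RtoC A * Ci).
  assert (Ia : Im a = A) by (unfold a; apply Im_imaginary).
  assert (Hdisc : forall w, cdisc a A w -> upper_half_plane w).
  { intros w Hw. unfold cdisc in Hw. pose proof (Im_le_Cmod_sub a w) as T.
    rewrite Cmod_sub_sym in T. unfold upper_half_plane. lra. }
  assert (HbA : holomorphic_on (cdisc a A) b) by (apply (holomorphic_subset _ _ b Hdisc), Hb).
  destruct (path_continuous_bounded (fun t => b (circle a r t))) with (a := 0%R) (b := (2 * PI)%R)
    as [M HM].
  { apply path_continuous_comp; [|apply path_continuous_circle].
    intros t. apply (holomorphic_ccontinuous (cdisc a A)); auto. apply circle_in_disc. lra. }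
  { apply Rlt_le, two_PI_pos. }
  exists M. intros w Hw.
  assert (Hwu : upper_half_plane w) by (unfold upper_half_plane; lra).
  destruct (floor_exists (Re w) 1) as [m Hm]; [lra|].
  assert (Hper' : forall w, upper_half_plane w -> b (w + RtoC 1) = b w + RtoC 0).
  { intros v Hv. rewrite Hper by auto. ring. }
  pose proof (translation_multiple b 1 0 Hper' (- m) w Hwu) as E.
  rewrite Rmult_0_r in E. replace (b w + 0) with (b w) in E by ring. rewrite <- E.
  apply (maximum_principle b a r A); auto.
  set (v := w + RtoC (IZR (- m) * 1) - a).
  assert (Rv : Re v = (Re w - IZR m * 1)%R).
  { unfold v, a, Re, RtoC, Ci. simpl. rewrite opp_IZR. ring. }
  assert (Iv : Im v = (Im w - A)%R).
  { unfold v, a, Im, RtoC, Ci. simpl. ring. }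
  pose proof (Cmod_sq v) as S. rewrite Rv, Iv in S. pose proof (Cmod_ge_0 v).
  apply Rnot_le_lt. intros Hge.
  assert (Cmod v * Cmod v >= r * r)%R by nra.
  set (x := (Re w - IZR m * 1)%R) in *. set (y := Im w) in *.
  assert (x * x <= 1)%R by nra.
  assert (y * y <= y2 * y2)%R by nra.
  assert (A * y1 <= A * y)%R by (apply Rmult_le_compat_l; lra).
  nra.
Qed.

Lemma beta_minus_id_periodic g c beta :
  linearizes g c beta ->
  holomorphic_on upper_half_plane (fun w => beta w - w) /\
  forall w, upper_half_plane w -> beta (w + 1) - (w + 1) = beta w - w.
Proof.
  intros [Hh Hs _]. split.
  - apply holomorphic_minus; auto. apply holomorphic_id.
  - intros w Hw. rewrite Hs by auto. ring.
Qed.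

(** Along the orbit of [Ci], which stays at height 1, [beta w - w] grows by [c - k] at each step,
    although periodicity makes it bounded there. *)
Lemma coefficient_of_translation g k c beta :
  linearizes g c beta -> (forall w, upper_half_plane w -> g w = w + RtoC k) -> RtoC k = c.
Proof.
  intros Hlin Hg. destruct (beta_minus_id_periodic g c beta Hlin) as [Hb Hper].
  destruct Hlin as [_ _ Hc].
  assert (H1 : (0 < 1)%R) by lra.
  destruct (bounded_on_strip (fun w => beta w - w) 1 1 Hb Hper H1) as [M HM].
  assert (Hn : forall n, let w := Ci + RtoC (INR n * k) in
    upper_half_plane w /\ Im w = 1%R /\ beta w - w = beta Ci - Ci + INR n * (c - k)).
  { induction n; cbv zeta.
    - simpl INR. rewrite Rmult_0_l. replace (Ci + 0) with Ci by ring.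
      unfold upper_half_plane, Im, Ci. simpl. repeat split; try lra. ring.
    - cbv zeta in IHn. destruct IHn as (IH1 & IH2 & IH3).
      replace (Ci + RtoC (INR (S n) * k)) with (Ci + RtoC (INR n * k) + k)
        by (rewrite S_INR, !RtoC_mult, RtoC_plus; ring).
      split; [now apply upper_add_real|]. split; [now rewrite Im_add_real|].
      rewrite <- Hg, Hc by auto. rewrite Hg by auto.
      replace (beta (Ci + RtoC (INR n * k)) + c - (Ci + RtoC (INR n * k) + k)) with
        (beta (Ci + RtoC (INR n * k)) - (Ci + RtoC (INR n * k)) + (c - k)) by ring.
      rewrite IH3, S_INR, RtoC_plus. ring. }
  apply NNPP. intros Hne.
  assert (Hpos : (0 < Cmod (c - k))%R) by (apply Cmod_sub_gt_0; auto).
  destruct (INR_unbounded (2 * M / Cmod (c - k))) as [n Hn'].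
  destruct (Hn n) as (_ & In & En).
  pose proof (HM _ ltac:(rewrite In; lra)) as B1. rewrite En in B1.
  pose proof (HM Ci ltac:(unfold Im, Ci; simpl; lra)) as B2.
  pose proof (Cmod_triangle_sub (beta Ci - Ci + INR n * (c - k)) (beta Ci - Ci)) as T.
  replace (beta Ci - Ci + INR n * (c - k) - (beta Ci - Ci)) with (INR n * (c - k)) in T by ring.
  rewrite Cmod_mult, Cmod_R, Rabs_right in T by (apply Rle_ge, pos_INR).
  apply Rmult_gt_compat_r with (r := Cmod (c - k)) in Hn'; [|lra].
  replace (2 * M / Cmod (c - k) * Cmod (c - k))%R with (2 * M)%R in Hn' by (field; lra). lra.
Qed.

(* A function with [beta (G w) = beta w] would take all its values on a compact window,
   and [Im beta] would violate the maximum principle there. *)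
Lemma no_invariant_linearizer G k beta :
  shift_map G -> has_drift G k -> (0 < Im k)%R -> ~ linearizes G 0 beta.
Proof.
  intros HG Hk Hpos Hlin.
  assert (Hinv : forall w, upper_half_plane w -> beta (G w) = beta w).
  { intros w Hw. rewrite (linearizes_conjugacy Hlin) by auto. ring. }
  destruct (drift_limit G k (Im k / 4) HG Hk ltac:(lra)) as (Y & HY & Hlim).
  set (K := Im k) in *.
  assert (Hasc : forall w, (Y < Im w)%R -> (Im w + 3 * K / 4 <= Im (G w) <= Im w + 5 * K / 4)%R).
  { intros w Hw. specialize (Hlim w Hw).
    pose proof (Im_le_Cmod_sub k (G w - w)) as T1. pose proof (Im_le_Cmod_sub (G w - w) k) as T2.
    rewrite Cmod_sub_sym in T2. change (Im (G w - w)) with (Im (G w) - Im w)%R in *. fold K in T1, T2. lra. }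
  (* Points far up have preimages: near [a = w' - k] the function [G w - w'] differs from [w - a] by
     at most [K / 4]. It is thus at least [K / 4] on the circle of radius [K / 2] and smaller than
     that at [a], so the minimum principle produces a zero. *)
  assert (Hdesc : forall w', (Y + 2 * K < Im w')%R ->
    exists w, G w = w' /\ (Im w' - 2 * K < Im w < Im w' - K / 4)%R).
  { intros w' Hw'. set (a := w' - k).
    assert (Ia : Im a = (Im w' - K)%R) by reflexivity.
    assert (Hin : forall w, cdisc a (3 * K / 4) w -> (Im a - 3 * K / 4 < Im w < Im a + 3 * K / 4)%R).
    { intros w Hw. unfold cdisc in Hw. pose proof (Im_le_Cmod_sub a w) as T1.
      pose proof (Im_le_Cmod_sub w a) as T2. rewrite Cmod_sub_sym in T1. lra. }
    apply NNPP. intros Hno.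
    assert (B : (K / 4 <= Cmod (G a - w'))%R).
    { apply (minimum_principle (fun w => G w - w') a (K / 2) (3 * K / 4)); auto; try lra.
      - apply holomorphic_minus; [|apply holomorphic_const].
        apply (holomorphic_subset _ upper_half_plane); [|apply (shift_map_holomorphic G HG)].
        intros w Hw. specialize (Hin w Hw). unfold upper_half_plane. lra.
      - intros w Hw E. apply Hno. exists w. split.
        + apply Cmod_sub_eq_0. rewrite E. apply Cmod_0.
        + specialize (Hin w Hw). lra.
      - intros t _. set (w := circle a (K / 2) t).
        assert (Hw : cdisc a (3 * K / 4) w) by (apply circle_in_disc; lra).
        assert (Ew : Cmod (w - a) = (K / 2)%R) by (apply circle_sub; lra).
        specialize (Hin w Hw). specialize (Hlim w ltac:(lra)).
        replace (G w - w') with ((w - a) - (k - (G w - w))) by (unfold a; ring).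
        pose proof (Cmod_triangle_rev (w - a) (k - (G w - w))). lra.
      - rewrite (Cmod_sub_diag a). lra. }
    specialize (Hlim a ltac:(lra)).
    replace (G a - w') with (- (k - (G a - a))) in B by (unfold a; ring).
    rewrite Cmod_opp in B. lra. }
  (* The term [2 * K] keeps preimages available; 3 leaves a margin below the window in which
     [harnack] can be applied over a unit step. The window has height [2 * K], so no step up or down
     can jump over it. *)
  set (y1 := (Y + 2 * K + 3)%R).
  set (window := fun w => (y1 <= Im w <= y1 + 2 * K)%R).
  assert (Hup : forall n w, (y1 - 3 < Im w)%R -> (y1 - INR n * (K / 2) <= Im w <= y1 + 2 * K)%R ->
    exists w0, window w0 /\ beta w0 = beta w).
  { induction n; intros w H1 H2.
    - exists w. split; auto. unfold window. simpl INR in H2. lra.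
    - destruct (Rle_dec y1 (Im w)) as [Hle|Hnle]; [exists w; split; auto; unfold window; lra|].
      pose proof (Hasc w ltac:(unfold y1 in *; lra)) as Ha. rewrite S_INR in H2.
      destruct (IHn (G w)) as (w0 & H3 & H4); [lra|lra|].
      exists w0. split; auto. rewrite H4. apply Hinv. unfold upper_half_plane, y1 in *. lra. }
  assert (Hdown : forall n w, (y1 <= Im w <= y1 + 2 * K + INR n * (K / 4))%R ->
    exists w0, window w0 /\ beta w0 = beta w).
  { induction n; intros w H1.
    - exists w. split; auto. unfold window. simpl INR in H1. lra.
    - destruct (Rle_dec (Im w) (y1 + 2 * K)) as [Hle|Hnle]; [exists w; split; auto; unfold window; lra|].
      destruct (Hdesc w ltac:(unfold y1 in *; lra)) as (v & Ev & Hv). rewrite S_INR in H1.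
      destruct (IHn v) as (w0 & H3 & H4); [lra|].
      exists w0. split; auto. rewrite H4, <- Ev. symmetry. apply Hinv.
      unfold upper_half_plane, y1 in *. lra. }
  assert (Hwin : forall w, (y1 - 3 < Im w)%R -> exists w0, window w0 /\ beta w0 = beta w).
  { intros w Hw. destruct (Rle_dec (Im w) (y1 + 2 * K)) as [Hle|Hnle].
    - destruct (INR_unbounded (3 / (K / 2))) as [n Hn]. apply (Hup n w Hw).
      apply Rmult_gt_compat_r with (r := (K / 2)%R) in Hn; [|lra].
      replace (3 / (K / 2) * (K / 2))%R with 3%R in Hn by (field; lra). lra.
    - destruct (INR_unbounded (Im w / (K / 4))) as [n Hn]. apply (Hdown n w).
      apply Rmult_gt_compat_r with (r := (K / 4)%R) in Hn; [|lra].
      replace (Im w / (K / 4) * (K / 4))%R with (Im w) in Hn by (field; lra). unfold y1 in *. lra. }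
  destruct (beta_minus_id_periodic G 0 beta Hlin) as [Hb Hper].
  destruct (bounded_on_strip _ y1 (y1 + 2 * K) Hb Hper ltac:(unfold y1; lra)) as [M HM]. cbv beta in HM.
  set (w1 := RtoC 0 + RtoC y1 * Ci).
  assert (Iw1 : Im w1 = y1) by (unfold w1; apply Im_imaginary).
  destruct (completeness (fun x => exists w, window w /\ x = Im (beta w))) as [S [HS HSl]].
  { exists (M + (y1 + 2 * K))%R. intros x (w & Hw & ->). specialize (HM w Hw).
    pose proof (im_le_Cmod (beta w - w)) as T. apply Rabs_le_between in T.
    change (Im (beta w - w)) with (Im (beta w) - Im w)%R in T. unfold window in Hw. lra. }
  { exists (Im (beta w1)), w1. split; auto. unfold window. lra. }
  assert (Hnear : exists w0, window w0 /\ (S - 1 < Im (beta w0))%R).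
  { apply NNPP. intros Hno.
    assert (HU : is_upper_bound (fun x => exists w, window w /\ x = Im (beta w)) (S - 1)%R).
    { intros x (w & Hw & ->). apply Rnot_lt_le. intros Hlt. apply Hno. eauto. }
    specialize (HSl _ HU). lra. }
  destruct Hnear as (w0 & Hw0 & Hclose).
  (* Its imaginary part is nonnegative above [y1 - 3] and below 1 at [w0], yet [f] moves by 1
     between [w0] and [w0 + 1]. With a margin of at least 3, [harnack] would give
     [2 <= S - Im (beta w0) < 1]. *)
  set (f := fun w => RtoC 0 + RtoC S * Ci - beta w).
  assert (If : forall w, Im (f w) = (S - Im (beta w))%R).
  { intros w. unfold f. change (Im (RtoC 0 + RtoC S * Ci - beta w)) with (Im (RtoC 0 + RtoC S * Ci) - Im (beta w))%R.
    rewrite Im_add_imaginary. unfold Im, RtoC. simpl. ring. }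
  pose proof (harnack f (y1 - 3) (w0 + 1) w0) as H. rewrite If in H.
  replace (w0 + 1 - w0) with (RtoC 1) in H by ring.
  assert (Ew0 : f (w0 + 1) - f w0 = - RtoC 1).
  { unfold f. rewrite (linearizes_shift Hlin); [ring|].
    unfold window, upper_half_plane, y1 in *. lra. }
  rewrite Ew0, Cmod_opp, Cmod_1 in H. unfold window in Hw0.
  assert (H' : (1 * (Im w0 - (y1 - 3) - 1) <= 1 * (S - Im (beta w0)))%R); [|lra].
  apply H; [| |lra].
  - apply (holomorphic_minus _ (fun _ => RtoC 0 + RtoC S * Ci)); [apply holomorphic_const|].
    apply (holomorphic_subset _ upper_half_plane); [|apply (linearizes_holomorphic Hlin)].
    intros w Hw. unfold upper_half_plane, y1 in *. lra.
  - intros v Hv. rewrite If. destruct (Hwin v Hv) as (v0 & Hv0 & <-).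
    assert (Im (beta v0) <= S)%R by (apply HS; eauto). lra.
Qed.

Lemma shift_map_iterate g n : shift_map g -> shift_map (fun w => Nat.iter n g w).
Proof.
  intros Hg. induction n.
  - split; auto. apply holomorphic_id.
  - split.
    + apply (holomorphic_comp _ upper_half_plane g (fun w => Nat.iter n g w)).
      * apply (shift_map_holomorphic g Hg).
      * apply (shift_map_holomorphic _ IHn).
      * apply (shift_map_maps _ IHn).
    + intros w Hw. apply (shift_map_maps g Hg), (shift_map_maps _ IHn w Hw).
    + intros w Hw. simpl. rewrite (shift_map_shift _ IHn) by auto.
      apply (shift_map_shift g Hg), (shift_map_maps _ IHn w Hw).
Qed.

(** For [Im k > 0], [beta] would be invariant under [G], because [q * c - p = 0], and [G] also has
    drift of positive imaginary part; [no_invariant_linearizer] excludes this. So [k] is real, [g]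
    is a translation, and its length is [c]. *)
Theorem translation_of_rational_coefficient g c beta :
  shift_map g -> linearizes g c beta -> rational c -> forall w, upper_half_plane w -> g w = w + c.
Proof.
  intros Hg Hlin Hrat.
  destruct (drift_exists g Hg) as [k Hk].
  destruct (drift_Im_nonneg g k Hg Hk) as [Hpos|Hreal].
  - exfalso. destruct Hrat as (p & q & Hq & Ec).
    set (G := fun w => Nat.iter q g w + RtoC (IZR (- p))).
    pose proof (shift_map_iterate g q Hg) as Hgq.
    assert (HG : shift_map G).
    { split.
      - apply (holomorphic_plus _ (fun w => Nat.iter q g w)); [apply (shift_map_holomorphic _ Hgq)|].
        apply holomorphic_const.
      - intros w Hw. apply upper_add_real, (shift_map_maps _ Hgq w Hw).
      - intros w Hw. unfold G. rewrite (shift_map_shift _ Hgq) by auto. ring. }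
    destruct (drift_exists G HG) as [k' Hk'].
    assert (Hi : upper_half_plane Ci) by (unfold upper_half_plane, Im, Ci; simpl; lra).
    assert (Hk'pos : (0 < Im k')%R).
    (* A real drift would make [G] a translation, which preserves heights. But one application of
       [g] raises [Ci] by at least [e], and the other iterates never lower a point. *)
    { destruct (drift_Im_nonneg G k' HG Hk') as [|E]; auto. exfalso.
      pose proof (translation_of_real_drift G k' HG Hk' (eq_sym E) Ci Hi) as E'.
      apply (f_equal Im) in E'. unfold G in E'. rewrite Im_add_real in E'.
      replace (Im (Ci + k')) with (Im Ci + Im k')%R in E' by reflexivity.
      destruct (displacement_lower_bound g k 1 Hg Hk Hpos ltac:(lra)) as (e & He & Hstep).
      destruct q as [|q]; [lia|].
      rewrite Nat.iter_succ_r in E'.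
      pose proof (Hstep Ci ltac:(unfold Im, Ci; simpl; lra)).
      pose proof (iterate_Im_le g q (g Ci) Hg (shift_map_maps g Hg Ci Hi)). lra. }
    apply (no_invariant_linearizer G k' beta HG Hk' Hk'pos).
    split; [apply (linearizes_holomorphic Hlin)|apply (linearizes_shift Hlin)|].
    intros w Hw. unfold G.
    assert (Hn : forall n, beta (Nat.iter n g w) = beta w + INR n * c).
    { induction n; [simpl; ring|]. simpl Nat.iter.
      rewrite (linearizes_conjugacy Hlin) by (now apply iterate_upper).
      rewrite IHn, S_INR, RtoC_plus. ring. }
    replace (IZR (- p)) with (IZR (- p) * 1)%R by ring.
    rewrite (translation_multiple beta 1 1 (linearizes_shift Hlin)) by (now apply iterate_upper).
    assert (Hq0 : INR q <> 0%R) by (apply not_0_INR; lia).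
    rewrite Hn, Ec, opp_IZR, !RtoC_mult, RtoC_opp, RtoC_div by auto.
    field. intros E. apply RtoC_inj in E. auto.
  - pose proof (translation_of_real_drift g k Hg Hk (eq_sym Hreal)) as Htr.
    assert (Ek : k = RtoC (Re k)).
    { destruct k as [x y]. unfold Im in Hreal. simpl in Hreal. subst y. reflexivity. }
    rewrite Ek in Htr. rewrite (coefficient_of_translation g (Re k) c beta Hlin Htr) in Htr. exact Htr.
Qed.

(** * Commutation and linearizers on the half-plane *)

Lemma tangent_injective beta :
  holomorphic_on upper_half_plane beta -> tangent_to_identity_at_infinity upper_half_plane beta ->
  exists Y, (0 < Y)%R /\ forall w w', (Y < Im w)%R -> (Y < Im w')%R -> beta w = beta w' -> w = w'.
Proof.
  (* With [beta] within 1/8 of the identity, points with equal images are at most 1/4 apart, and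
     [beta v - v], raised by [Ci / 8], has imaginary part between 0 and 1/4. At a margin of 2 above
     [Y0], [harnack] yields [s * (2 - s) <= s / 4] for their distance [s], hence [s = 0]. *)
  intros Hb Ht. destruct (Ht (1 / 8)%R ltac:(lra)) as [M HM].
  set (Y0 := Rmax M 0). pose proof (Rmax_l M 0) as HM0. pose proof (Rmax_r M 0) as HY0. fold Y0 in HM0, HY0.
  assert (Hclose : forall w, (Y0 < Im w)%R -> (Cmod (beta w - w) < 1 / 8)%R).
  { intros w Hw. apply HM; [unfold upper_half_plane; lra|]. rewrite Rabs_right; lra. }
  exists (Y0 + 2)%R. split; [lra|]. intros w w' Hw Hw' E.
  pose proof (Hclose w ltac:(lra)) as B1. pose proof (Hclose w' ltac:(lra)) as B2.
  assert (Hww : (Cmod (w - w') <= 1 / 4)%R).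
  { replace (w - w') with ((beta w' - w') - (beta w - w)) by (rewrite E; ring).
    eapply Rle_trans; [apply Cmod_triangle_sub|]. lra. }
  set (f := fun v => beta v - v + RtoC (1 / 8) * Ci).
  assert (If : forall v, (Y0 < Im v)%R -> (0 <= Im (f v) <= 1 / 4)%R).
  { intros v Hv. unfold f. rewrite Im_add_imaginary. specialize (Hclose v Hv).
    pose proof (im_le_Cmod (beta v - v)) as T. apply Rabs_le_between in T. lra. }
  pose proof (harnack f Y0 w w') as H.
  replace (f w - f w') with (- (w - w')) in H by (unfold f; rewrite E; ring). rewrite Cmod_opp in H.
  assert (H' : (Cmod (w - w') * (Im w' - Y0 - Cmod (w - w')) <= Cmod (w - w') * Im (f w'))%R).
  { apply H; [| |lra].
    - apply holomorphic_plus; [apply holomorphic_minus|].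
      + apply (holomorphic_subset _ upper_half_plane); auto. intros v Hv. unfold upper_half_plane. lra.
      + apply holomorphic_id.
      + apply holomorphic_const.
    - intros v Hv. now apply If. }
  pose proof (If w' ltac:(lra)) as I. pose proof (Cmod_ge_0 (w - w')).
  apply Cmod_sub_eq_0. nra.
Qed.

(** What remains of one [psi] after passage to the half-plane. For rational [c] the function [beta]
    is the identity by convention and says nothing about [g]; the link between [g] and [c] is then
    [datum_coefficient]. *)
Record linearization_datum (g : C -> C) (c : C) (beta : C -> C) : Prop := {
  datum_shift_map : shift_map g;
  datum_coefficient : exists beta0, linearizes g c beta0;
  datum_rational : rational c -> forall w, upper_half_plane w -> beta w = w;
  datum_irrational : ~ rational c ->
    linearizes g c beta /\ tangent_to_identity_at_infinity upper_half_plane beta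
}.

Arguments datum_shift_map {g c beta}.
Arguments datum_coefficient {g c beta}.
Arguments datum_rational {g c beta}.
Arguments datum_irrational {g c beta}.

Lemma datum_translation g c beta :
  linearization_datum g c beta -> rational c -> forall w, upper_half_plane w -> g w = w + c.
Proof.
  intros H Hc. destruct (datum_coefficient H) as [b Hb].
  exact (translation_of_rational_coefficient g c b (datum_shift_map H) Hb Hc).
Qed.

Lemma datum_drift g c beta :
  linearization_datum g c beta -> ~ rational c -> has_drift g c.
Proof.
  intros H Hc. destruct (datum_irrational H Hc) as [Hl Ht].
  destruct (drift_exists g (datum_shift_map H)) as [k Hk].
  now rewrite <- (drift_of_tangent g k c beta (datum_shift_map H) Hk Hl Ht).
Qed.

Lemma rational_lowest_terms c : rational c ->
  exists (p : Z) (q : nat), (0 < q)%nat /\ rel_prime p (Z.of_nat q) /\ c = RtoC (IZR p / INR q).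
Proof.
  intros (p & q & Hq & ->).
  set (d := Z.gcd p (Z.of_nat q)).
  assert (Hd : (0 < d)%Z).
  { assert (d <> 0)%Z by (intros E; apply Z.gcd_eq_0 in E; lia). pose proof (Z.gcd_nonneg p (Z.of_nat q)). unfold d in *. lia. }
  destruct (Z.gcd_divide_l p (Z.of_nat q)) as [p' Hp']. destruct (Z.gcd_divide_r p (Z.of_nat q)) as [q' Hq'].
  fold d in Hp', Hq'.
  assert (Hq'0 : (0 < q')%Z) by nia.
  exists p', (Z.to_nat q'). split; [lia|]. rewrite Z2Nat.id by lia. split.
  - apply Zgcd_1_rel_prime.
    assert (E : (Z.gcd (p' * d) (q' * d) = d)%Z) by (rewrite <- Hp', <- Hq'; reflexivity).
    rewrite Z.gcd_mul_mono_r, Z.abs_eq in E by lia. nia.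
  - f_equal. rewrite !INR_IZR_INZ, Z2Nat.id by lia. rewrite Hp', Hq', !mult_IZR.
    apply IZR_lt in Hd, Hq'0. field. lra.
Qed.

(** By Bezout, commuting with the translations by 1 and by [p / q] means commuting with the one by
    [1 / q]. The defect of the desired identity is then a periodic, [g]-invariant function that
    tends to 0. *)
Lemma commuting_with_rational_translation g c beta p q :
  linearization_datum g c beta -> ~ rational c -> (0 < q)%nat -> rel_prime p (Z.of_nat q) ->
  (forall w, upper_half_plane w -> g (w + RtoC (IZR p / INR q)) = g w + RtoC (IZR p / INR q)) ->
  forall w, upper_half_plane w -> beta (w + RtoC (1 / INR q)) = beta w + RtoC (1 / INR q).
Proof.
  intros H Hc Hq Hrel Hcomm.
  pose proof (datum_shift_map H) as Hg.
  destruct (datum_irrational H Hc) as [Hl Ht].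
  assert (Hq0 : (0 < INR q)%R) by now apply lt_0_INR.
  assert (Hgq : forall w, upper_half_plane w -> g (w + RtoC (1 / INR q)) = g w + RtoC (1 / INR q)).
  { intros w Hw. apply rel_prime_bezout in Hrel. destruct Hrel as [a b Hab].
    assert (E : RtoC (1 / INR q) = RtoC (IZR a * (IZR p / INR q)) + RtoC (IZR b * 1)).
    { rewrite <- RtoC_plus. f_equal. apply (f_equal IZR) in Hab.
      rewrite plus_IZR, !mult_IZR, <- INR_IZR_INZ in Hab. rewrite <- Hab at 1. field. lra. }
    rewrite E, Cplus_assoc, (translation_multiple g 1 1 (shift_map_shift g Hg)) by (now apply upper_add_real).
    rewrite (translation_multiple g _ _ Hcomm) by auto. ring. }
  intros w Hw. set (s := (1 / INR q)%R) in *.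
  set (d := fun w => beta (w + RtoC s) - RtoC s - beta w).
  assert (Ed : d w = 0).
  { apply (invariant_function_zero g c d Hg (datum_drift _ _ _ H Hc) Hc); auto.
    - apply holomorphic_minus; [|apply (linearizes_holomorphic Hl)].
      apply (holomorphic_minus _ (fun w => beta (w + RtoC s))); [|apply holomorphic_const].
      apply (holomorphic_comp _ upper_half_plane beta (fun w => w + RtoC s)).
      + apply (linearizes_holomorphic Hl).
      + apply holomorphic_plus; [apply holomorphic_id|apply holomorphic_const].
      + intros v Hv. now apply upper_add_real.
    - intros v Hv. unfold d. replace (v + 1 + RtoC s) with (v + RtoC s + 1) by ring.
      rewrite !(linearizes_shift Hl) by (try apply upper_add_real; auto). ring.
    - intros v Hv. unfold d. rewrite <- Hgq by auto.
      rewrite !(linearizes_conjugacy Hl) by (try apply upper_add_real; auto). ring.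
    - intros eps Heps. destruct (Ht (eps / 2)%R ltac:(lra)) as [M HM].
      exists M. intros v Hv HvM. unfold d. assert (Hv' := Hv). unfold upper_half_plane in Hv'.
      pose proof (HM v Hv ltac:(rewrite Rabs_right; lra)) as B1.
      pose proof (HM (v + RtoC s) (upper_add_real v s Hv) ltac:(rewrite Im_add_real, Rabs_right; lra)) as B2.
      replace (beta (v + RtoC s) - RtoC s - beta v) with
        ((beta (v + RtoC s) - (v + RtoC s)) - (beta v - v)) by ring.
      eapply Rle_lt_trans; [apply Cmod_triangle_sub|]. lra. }
  unfold d in Ed. replace (beta (w + RtoC s)) with (beta (w + RtoC s) - RtoC s - beta w + beta w + RtoC s) by ring.
  rewrite Ed. ring.
Qed.

(** The vanishing of invariant functions is used twice: for [g1], on the defect of [beta1] as a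
    linearizer of [g2], which is [g1]-invariant by commutation; then for [g2], on
    [beta1 - beta2]. *)
Lemma linearizers_of_commuting_agree g1 g2 c1 c2 beta1 beta2 :
  linearization_datum g1 c1 beta1 -> linearization_datum g2 c2 beta2 ->
  ~ rational c1 -> ~ rational c2 ->
  (forall w, upper_half_plane w -> g1 (g2 w) = g2 (g1 w)) ->
  forall w, upper_half_plane w -> beta1 w = beta2 w.
Proof.
  intros D1 D2 N1 N2 Hcomm.
  pose proof (datum_shift_map D1) as Hg1. pose proof (datum_shift_map D2) as Hg2.
  destruct (datum_irrational D1 N1) as [L1 T1]. destruct (datum_irrational D2 N2) as [L2 T2].
  pose proof (datum_drift _ _ _ D1 N1) as K1. pose proof (datum_drift _ _ _ D2 N2) as K2.
  pose proof (shift_map_maps g1 Hg1) as M1. pose proof (shift_map_maps g2 Hg2) as M2.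
  assert (H12 : forall w, upper_half_plane w -> beta1 (g2 w) = beta1 w + c2).
  { intros w Hw. set (d := fun w => beta1 (g2 w) - c2 - beta1 w).
    assert (Ed : d w = 0).
    { apply (invariant_function_zero g1 c1 d Hg1 K1 N1); auto.
      - apply holomorphic_minus; [|apply (linearizes_holomorphic L1)].
        apply (holomorphic_minus _ (fun w => beta1 (g2 w))); [|apply holomorphic_const].
        apply (holomorphic_comp _ upper_half_plane beta1 g2); auto.
        + apply (linearizes_holomorphic L1).
        + apply (shift_map_holomorphic g2 Hg2).
      - intros v Hv. unfold d. rewrite (shift_map_shift g2 Hg2), !(linearizes_shift L1) by auto. ring.
      - intros v Hv. unfold d. rewrite <- Hcomm by auto.
        rewrite !(linearizes_conjugacy L1) by auto. ring.
      - intros eps Heps. destruct (T1 (eps / 3)%R ltac:(lra)) as [M HM].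
        destruct (drift_limit g2 c2 (eps / 3) Hg2 K2 ltac:(lra)) as (Y & HY & HYl).
        exists (Rmax M Y). intros v Hv HvM. unfold d. assert (Hv' := Hv). unfold upper_half_plane in Hv'.
        pose proof (Rmax_l M Y). pose proof (Rmax_r M Y).
        pose proof (Im_le_shift_map g2 v Hg2 Hv).
        pose proof (HM v Hv ltac:(rewrite Rabs_right; lra)) as B1.
        pose proof (HM (g2 v) (M2 v Hv) ltac:(rewrite Rabs_right; lra)) as B2.
        specialize (HYl v ltac:(lra)).
        replace (beta1 (g2 v) - c2 - beta1 v) with
          ((beta1 (g2 v) - g2 v) - (beta1 v - v) - (c2 - (g2 v - v))) by ring.
        eapply Rle_lt_trans; [apply Cmod_triangle_sub|].
        pose proof (Cmod_triangle_sub (beta1 (g2 v) - g2 v) (beta1 v - v)). lra. }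
    unfold d in Ed. replace (beta1 (g2 w)) with (beta1 (g2 w) - c2 - beta1 w + beta1 w + c2) by ring.
    rewrite Ed. ring. }
  intros w Hw. apply Cmod_sub_eq_0.
  assert (Ed : beta1 w - beta2 w = 0); [|rewrite Ed; apply Cmod_0].
  apply (invariant_function_zero g2 c2 (fun w => beta1 w - beta2 w) Hg2 K2 N2); auto.
  - apply holomorphic_minus; [apply (linearizes_holomorphic L1)|apply (linearizes_holomorphic L2)].
  - intros v Hv. rewrite (linearizes_shift L1), (linearizes_shift L2) by auto. ring.
  - intros v Hv. rewrite H12, (linearizes_conjugacy L2) by auto. ring.
  - intros eps Heps. destruct (T1 (eps / 2)%R ltac:(lra)) as [M HM].
    destruct (T2 (eps / 2)%R ltac:(lra)) as [M' HM'].
    exists (Rmax M M'). intros v Hv HvM. assert (Hv' := Hv). unfold upper_half_plane in Hv'.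
    pose proof (Rmax_l M M'). pose proof (Rmax_r M M').
    pose proof (HM v Hv ltac:(rewrite Rabs_right; lra)) as B1.
    pose proof (HM' v Hv ltac:(rewrite Rabs_right; lra)) as B2.
    replace (beta1 v - beta2 v) with ((beta1 v - v) - (beta2 v - v)) by ring.
    eapply Rle_lt_trans; [apply Cmod_triangle_sub|]. lra.
Qed.

Theorem condition_of_commuting g1 g2 c1 c2 beta1 beta2 :
  linearization_datum g1 c1 beta1 -> linearization_datum g2 c2 beta2 ->
  (forall w, upper_half_plane w -> g1 (g2 w) = g2 (g1 w)) ->
  (forall w, upper_half_plane w -> beta1 w = beta2 w) \/
  rational_with_compatible_shift upper_half_plane c1 beta2 \/
  rational_with_compatible_shift upper_half_plane c2 beta1.
Proof.
  intros D1 D2 Hcomm.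
  assert (Hmixed : forall g1 g2 c1 c2 beta1 beta2,
    linearization_datum g1 c1 beta1 -> linearization_datum g2 c2 beta2 ->
    (forall w, upper_half_plane w -> g1 (g2 w) = g2 (g1 w)) -> rational c1 -> ~ rational c2 ->
    rational_with_compatible_shift upper_half_plane c1 beta2).
  { clear. intros g1 g2 c1 c2 beta1 beta2 D1 D2 Hcomm R1 N2.
    destruct (rational_lowest_terms c1 R1) as (p & q & Hq & Hrel & Ec).
    exists p, q. do 3 (split; [assumption|]).
    apply (commuting_with_rational_translation g2 c2 beta2 p q); auto.
    intros w Hw. pose proof (datum_translation _ _ _ D1 R1) as E.
    rewrite <- Ec, <- !E; auto. now rewrite Hcomm.
    apply (shift_map_maps g2 (datum_shift_map D2)); auto. }
  (* When both coefficients are rational, both functions are the identity and the first alternative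
     holds whether or not the maps commute. *)
  destruct (classic (rational c1)) as [R1|N1]; destruct (classic (rational c2)) as [R2|N2].
  - left. intros w Hw. now rewrite (datum_rational D1 R1), (datum_rational D2 R2).
  - right; left. now apply (Hmixed g1 g2 c1 c2 beta1 beta2).
  - right; right. apply (Hmixed g2 g1 c2 c1 beta2 beta1); auto. intros w Hw. now rewrite Hcomm.
  - left. now apply (linearizers_of_commuting_agree g1 g2 c1 c2 beta1 beta2).
Qed.

Definition commute_near_infinity (g1 g2 : C -> C) : Prop :=
  exists Y, (0 < Y)%R /\ forall w, (Y < Im w)%R -> g1 (g2 w) = g2 (g1 w).

(** Shift maps never lower a point, so above [Y] both compositions remain where [beta] is
    injective. *)
Lemma commute_near_infinity_of_linearizer g1 g2 beta :
  shift_map g1 -> shift_map g2 -> holomorphic_on upper_half_plane beta ->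
  tangent_to_identity_at_infinity upper_half_plane beta ->
  (forall w, upper_half_plane w -> beta (g1 (g2 w)) = beta (g2 (g1 w))) -> commute_near_infinity g1 g2.
Proof.
  intros H1 H2 Hb Ht Hcomm. destruct (tangent_injective beta Hb Ht) as (Y & HY & Hinj).
  exists Y. split; auto. intros w Hw.
  assert (Hw' : upper_half_plane w) by (unfold upper_half_plane; lra).
  pose proof (shift_map_maps g1 H1 w Hw'). pose proof (shift_map_maps g2 H2 w Hw').
  pose proof (Im_le_shift_map g1 w H1 Hw'). pose proof (Im_le_shift_map g2 w H2 Hw').
  pose proof (Im_le_shift_map g1 (g2 w) H1 ltac:(auto)). pose proof (Im_le_shift_map g2 (g1 w) H2 ltac:(auto)).
  apply Hinj; auto; lra.
Qed.

Lemma commute_of_translations g1 g2 c1 c2 :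
  shift_map g1 -> shift_map g2 ->
  (forall w, upper_half_plane w -> g1 w = w + c1) -> (forall w, upper_half_plane w -> g2 w = w + c2) ->
  commute_near_infinity g1 g2.
Proof.
  intros H1 H2 E1 E2. exists 1%R. split; [lra|]. intros w Hw.
  assert (Hw' : upper_half_plane w) by (unfold upper_half_plane; lra).
  rewrite E1, E2, E2, E1; auto; [ring| |].
  - now apply (shift_map_maps g1 H1).
  - now apply (shift_map_maps g2 H2).
Qed.

Theorem commuting_of_condition g1 g2 c1 c2 beta1 beta2 :
  linearization_datum g1 c1 beta1 -> linearization_datum g2 c2 beta2 ->
  (forall w, upper_half_plane w -> beta1 w = beta2 w) \/
  rational_with_compatible_shift upper_half_plane c1 beta2 \/
  rational_with_compatible_shift upper_half_plane c2 beta1 ->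
  commute_near_infinity g1 g2.
Proof.
  intros D1 D2 Hcond.
  assert (Hsym : forall g1 g2, commute_near_infinity g1 g2 -> commute_near_infinity g2 g1).
  { clear. intros g1 g2 (Y & HY & H). exists Y. split; auto. intros w Hw. now rewrite H. }
  (* If just one coefficient is rational, the common function is the identity, and the conjugacy
     relation for the other map says that it is a translation too. *)
  assert (Hid : forall g1 g2 c1 c2 beta1 beta2,
    linearization_datum g1 c1 beta1 -> linearization_datum g2 c2 beta2 ->
    (forall w, upper_half_plane w -> beta1 w = beta2 w) -> rational c1 -> ~ rational c2 ->
    commute_near_infinity g1 g2).
  { clear. intros g1 g2 c1 c2 beta1 beta2 D1 D2 E R1 N2.
    apply (commute_of_translations g1 g2 c1 c2); try eapply datum_shift_map; eauto.
    - now apply (datum_translation _ _ _ D1).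
    - destruct (datum_irrational D2 N2) as [L2 _].
      assert (Eb : forall w, upper_half_plane w -> beta2 w = w).
      { intros w Hw. rewrite <- E by auto. now apply (datum_rational D1). }
      intros w Hw. pose proof (linearizes_conjugacy L2 w Hw) as Ec.
      rewrite !Eb in Ec; auto. apply (shift_map_maps g2 (datum_shift_map D2)); auto. }
  (* Here [g1] is the translation by a multiple of [1 / q], which [beta2] respects, while [beta2]
     turns [g2] into the translation by [c2]; two translations commute. *)
  assert (Hb : forall g1 g2 c1 c2 beta1 beta2,
    linearization_datum g1 c1 beta1 -> linearization_datum g2 c2 beta2 ->
    rational_with_compatible_shift upper_half_plane c1 beta2 -> commute_near_infinity g1 g2).
  { clear. intros g1 g2 c1 c2 beta1 beta2 D1 D2 (p & q & Hq & Hrel & Ec & Hs).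
    assert (R1 : rational c1) by (exists p, q; split; assumption).
    pose proof (datum_translation _ _ _ D1 R1) as E1.
    pose proof (datum_shift_map D1) as Hg1. pose proof (datum_shift_map D2) as Hg2.
    destruct (classic (rational c2)) as [R2|N2].
    - apply (commute_of_translations g1 g2 c1 c2); auto. now apply (datum_translation _ _ _ D2).
    - destruct (datum_irrational D2 N2) as [L2 T2].
      apply (commute_near_infinity_of_linearizer g1 g2 beta2 Hg1 Hg2 (linearizes_holomorphic L2) T2).
      assert (Hc1 : forall w, upper_half_plane w -> beta2 (w + c1) = beta2 w + c1).
      { intros w Hw. rewrite Ec. replace (IZR p / INR q)%R with (IZR p * (1 / INR q))%R by (unfold Rdiv; ring).
        now apply translation_multiple. }
      intros w Hw. pose proof (shift_map_maps g1 Hg1 w Hw). pose proof (shift_map_maps g2 Hg2 w Hw).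
      rewrite (linearizes_conjugacy L2 (g1 w)), !E1, !Hc1, (linearizes_conjugacy L2) by auto. ring. }
  destruct Hcond as [E|[H1|H2]].
  - destruct (classic (rational c1)) as [R1|N1]; destruct (classic (rational c2)) as [R2|N2].
    + apply (commute_of_translations g1 g2 c1 c2); try (eapply datum_shift_map; eauto).
      * now apply (datum_translation _ _ _ D1).
      * now apply (datum_translation _ _ _ D2).
    + now apply (Hid g1 g2 c1 c2 beta1 beta2).
    + apply Hsym. apply (Hid g2 g1 c2 c1 beta2 beta1); auto. intros w Hw. now rewrite E.
    + pose proof (datum_shift_map D1) as Hg1. pose proof (datum_shift_map D2) as Hg2.
      destruct (datum_irrational D1 N1) as [L1 T1]. destruct (datum_irrational D2 N2) as [L2 _].
      apply (commute_near_infinity_of_linearizer g1 g2 beta1 Hg1 Hg2 (linearizes_holomorphic L1) T1).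
      intros w Hw. pose proof (shift_map_maps g1 Hg1 w Hw). pose proof (shift_map_maps g2 Hg2 w Hw).
      rewrite (linearizes_conjugacy L1) by auto.
      rewrite (E (g2 w)), (E (g2 (g1 w))) by (auto; apply (shift_map_maps g2 Hg2); auto).
      rewrite !(linearizes_conjugacy L2) by auto.
      rewrite <- !E, (linearizes_conjugacy L1) by auto. ring.
  - now apply (Hb g1 g2 c1 c2 beta1 beta2).
  - apply Hsym. now apply (Hb g2 g1 c2 c1 beta2 beta1).
Qed.

(** * Transfer through the canonical model *)

Lemma planar_domain_copen V : planar_domain V -> copen V.
Proof. intros [Ho _] z Hz. apply locally_C_iff. now apply Ho. Qed.

Lemma iterate_Disc phi n z : holomorphic_self_map phi -> Disc z -> Disc (iterate phi n z).
Proof. intros [_ H] Hz. induction n; [exact Hz|]. simpl. now apply H. Qed.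

Lemma iterate_add phi m n z : iterate phi (m + n) z = iterate phi m (iterate phi n z).
Proof. apply Nat.iter_add. Qed.

Lemma centralizer_iterate phi psi n z :
  holomorphic_self_map phi -> in_centralizer phi psi -> Disc z ->
  psi (iterate phi n z) = iterate phi n (psi z).
Proof.
  intros Hphi [_ Hc] Hz. induction n; auto. simpl.
  change (Nat.iter n phi z) with (iterate phi n z). rewrite Hc by now apply iterate_Disc.
  now rewrite IHn.
Qed.

Lemma model_iterate phi S h n z :
  holomorphic_self_map phi -> is_canonical_model phi S h -> Disc z ->
  h (iterate phi n z) = h z + INR n.
Proof.
  intros Hphi M Hz. induction n.
  - simpl. ring.
  - simpl iterate. rewrite S_INR, RtoC_plus.
    change (iterate phi (Datatypes.S n) z) with (phi (iterate phi n z)).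
    rewrite (model_abel _ _ _ M) by now apply iterate_Disc. rewrite IHn. ring.
Qed.

Lemma absorbed_iterate phi V z n m :
  absorbing_domain phi V -> V (iterate phi n z) -> V (iterate phi (m + n) z).
Proof.
  intros (_ & _ & Hinv & _) H. induction m; auto. simpl. now apply Hinv.
Qed.

Lemma common_absorption phi V x y :
  absorbing_domain phi V -> Disc x -> Disc y ->
  exists k, V (iterate phi k x) /\ V (iterate phi k y).
Proof.
  intros HV Hx Hy. pose proof HV as (_ & _ & _ & Habs).
  destruct (Habs x Hx) as [i Hi]. destruct (Habs y Hy) as [j Hj].
  exists (j + i)%nat. split; [now apply absorbed_iterate|].
  rewrite Nat.add_comm. now apply absorbed_iterate.
Qed.

(** This makes the induced map well defined. Equal values [h z - n] mean, by injectivity on the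
    absorbing domain, that suitable iterates of [z1] and [z2] coincide; applying [psi], which
    commutes with [phi], and reading the result through [h] gives the claim. *)
Lemma model_shift_eq phi psi S h z1 z2 (n1 n2 : nat) :
  holomorphic_self_map phi -> in_centralizer phi psi -> is_canonical_model phi S h ->
  Disc z1 -> Disc z2 -> h z1 - INR n1 = h z2 - INR n2 -> h (psi z1) - INR n1 = h (psi z2) - INR n2.
Proof.
  intros Hphi Hpsi M Hz1 Hz2 E.
  destruct (model_injective _ _ _ M) as (V & HV & Hinj).
  destruct (common_absorption phi V (iterate phi n2 z1) (iterate phi n1 z2) HV) as (k & V1 & V2);
    try now apply iterate_Disc.
  rewrite <- !iterate_add in V1, V2.
  assert (Eq : iterate phi (k + n2) z1 = iterate phi (k + n1) z2).
  { apply Hinj; auto. rewrite !(model_iterate phi S h) by auto. rewrite !plus_INR, !RtoC_plus.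
    replace (h z1) with (h z1 - INR n1 + INR n1) by ring. rewrite E. ring. }
  apply (f_equal (fun z => h (psi z))) in Eq.
  rewrite !(centralizer_iterate phi psi) in Eq by auto.
  destruct Hpsi as [[_ Hpsi] _].
  rewrite !(model_iterate phi S h) in Eq by auto. rewrite !plus_INR, !RtoC_plus in Eq.
  apply (f_equal (fun x => x - INR k - INR n1 - INR n2)) in Eq.
  replace (h (psi z1) - INR n1) with (h (psi z1) + (INR k + INR n2) - INR k - INR n1 - INR n2) by ring.
  rewrite Eq. ring.
Qed.

(** For [n = 0] the first field is the semiconjugacy of [psi] and [g] by [h]. Larger [n] determine
    [g] on the translates of the image of [h], which exhaust [S]. *)
Record induced_map (psi : C -> C) (S : C -> Prop) (h g : C -> C) : Prop := {
  induced_value : forall z (n : nat), Disc z -> g (h z - INR n) = h (psi z) - INR n;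
  induced_holomorphic : holomorphic_on S g;
  induced_maps : forall w, S w -> S (g w);
  induced_shift : forall w, S w -> g (w + 1) = g w + 1
}.

Lemma induced_map_exists phi psi S h :
  holomorphic_self_map phi -> in_centralizer phi psi -> is_canonical_model phi S h ->
  exists g, induced_map psi S h g.
Proof.
  intros Hphi Hpsi M.
  set (R := fun w v => exists z (n : nat), Disc z /\ w = h z - INR n /\ v = h (psi z) - INR n).
  set (g := fun w => epsilon (inhabits (RtoC 0)) (R w)).
  assert (Hg : forall z (n : nat), Disc z -> g (h z - INR n) = h (psi z) - INR n).
  { intros z n Hz. assert (HR : R (h z - INR n) (g (h z - INR n))).
    { apply epsilon_spec. exists (h (psi z) - INR n), z, n. auto. }
    destruct HR as (z' & n' & Hz' & E & ->).
    apply (model_shift_eq phi psi S h); auto. }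
  pose proof Hpsi as [[Hpsih Hpsim] Hcomm].
  exists g. split; auto.
  - intros w Hw. apply (model_exhausts _ _ _ M) in Hw. destruct Hw as (n & z & Hz & ->).
    (* Holomorphy at [w]: a further iterate [a] of [z] lies in [V], where [h] is injective, and
       [w = h a - m] for a larger [m]. There the translated [g] factors [h (psi z)] through [h]. *)
    destruct (model_injective _ _ _ M) as (V & HV & Hinj).
    pose proof HV as (Hdom & HVD & _ & Habs). destruct (Habs z Hz) as [k Hk].
    set (a := iterate phi k z) in *. set (m := (n + k)%nat).
    assert (Ea : h z - INR n = h a - INR m).
    { unfold a, m. rewrite (model_iterate phi S h) by auto. rewrite plus_INR, RtoC_plus. ring. }
    destruct (holomorphic_factor_through_injective V h (fun z => h (psi z)) (fun v => g (v - INR m) + INR m) a)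
      as [l Hl]; auto.
    + now apply planar_domain_copen.
    + apply (holomorphic_subset _ Disc); auto. apply (model_holomorphic _ _ _ M).
    + apply (holomorphic_subset _ Disc); auto.
      apply (holomorphic_comp _ Disc h psi); auto. apply (model_holomorphic _ _ _ M).
    + intros v Hv. cbv beta. rewrite Hg by auto. ring.
    + rewrite Ea. exists (1 * l - 0).
      apply is_cderive_ext_near with (fun v => (g ((v + INR m) - INR m) + INR m) - INR m).
      * exists 1%R. split; [lra|]. intros v _.
        replace (v + INR m - INR m) with v by ring. ring.
      * apply is_cderive_minus; [|apply is_cderive_const].
        apply (is_cderive_comp (fun v => g (v - INR m) + INR m) (fun v => v + INR m)).
        -- replace (h a - INR m + INR m) with (h a) by ring. exact Hl.
        -- eapply is_cderive_eq.
           ++ apply is_cderive_plus; [apply is_cderive_id|apply is_cderive_const].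
           ++ ring.
  - intros w Hw. apply (model_exhausts _ _ _ M) in Hw. destruct Hw as (n & z & Hz & ->).
    rewrite Hg by auto. apply (model_exhausts _ _ _ M). exists n, (psi z). auto.
  - intros w Hw. apply (model_exhausts _ _ _ M) in Hw. destruct Hw as (n & z & Hz & ->).
    replace (h z - INR n + 1) with (h (phi z) - INR n)
      by (rewrite (model_abel _ _ _ M) by auto; ring).
    pose proof Hphi as [_ Hphim].
    rewrite !Hg, Hcomm, (model_abel _ _ _ M) by auto. ring.
Qed.

Lemma half_plane_pred S w : S = upper_half_plane \/ S = lower_half_plane -> S w -> S (w - 1).
Proof.
  intros [-> | ->] Hw; unfold upper_half_plane, lower_half_plane, Im, RtoC in *; simpl; lra.
Qed.

(** The relation for [psi] holds on the image of [h]. Points of [S] are translates of it to the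
    left, so the translation property of [beta] is run backwards, which is possible because [S] is
    closed under [w - 1]. *)
Lemma induced_conjugacy phi psi S h g c beta :
  holomorphic_self_map phi -> in_centralizer phi psi -> is_canonical_model phi S h ->
  induced_map psi S h g -> solves_linearization_system phi psi S h c beta ->
  forall w, S w -> beta (g w) = beta w + c.
Proof.
  intros Hphi [[_ Hpsi] _] M Hg L.
  assert (Hn : forall (n : nat) w, S w -> S (w - INR n) /\ beta (w - INR n) = beta w - INR n).
  { induction n; intros w Hw.
    - simpl INR. replace (w - 0) with w by ring. split; auto. ring.
    - destruct (IHn w Hw) as [H1 H2].
      pose proof (half_plane_pred S _ (model_base _ _ _ M) H1) as H3.
      rewrite S_INR, RtoC_plus. replace (w - (INR n + 1)) with (w - INR n - 1) by ring.
      split; auto. pose proof (lin_translation _ _ _ _ _ _ L _ H3) as E.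
      replace (w - INR n - 1 + 1) with (w - INR n) in E by ring. rewrite H2 in E.
      replace (beta w - (INR n + 1)) with (beta w - INR n - 1) by ring. rewrite E. ring. }
  intros w Hw. apply (model_exhausts _ _ _ M) in Hw. destruct Hw as (n & z & Hz & ->).
  pose proof (model_maps_to _ _ _ M) as Hmap.
  rewrite (induced_value _ _ _ _ Hg) by auto.
  rewrite (proj2 (Hn n (h (psi z)) (Hmap _ (Hpsi _ Hz)))), (proj2 (Hn n (h z) (Hmap _ Hz))).
  rewrite (lin_psi _ _ _ _ _ _ L) by auto. ring.
Qed.

Lemma datum_upper phi psi h g c beta :
  holomorphic_self_map phi -> in_centralizer phi psi -> is_canonical_model phi upper_half_plane h ->
  induced_map psi upper_half_plane h g ->
  is_linearization_coefficient phi psi upper_half_plane h c ->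
  is_linearization_function phi psi upper_half_plane h c beta -> linearization_datum g c beta.
Proof.
  intros Hphi Hpsi M Hg [b Hb] [Hrat Hirr].
  assert (Hlin : forall b, solves_linearization_system phi psi upper_half_plane h c b -> linearizes g c b).
  { intros b' L. split; [apply (lin_holomorphic _ _ _ _ _ _ L)|apply (lin_translation _ _ _ _ _ _ L)|].
    now apply (induced_conjugacy phi psi upper_half_plane h). }
  split; auto.
  - destruct Hg. now split.
  - exists b. auto.
  - intros Hc. destruct (Hirr Hc). auto.
Qed.

(* Conjugation by [w |-> - w] reduces the lower half-plane to the upper one: it turns the
   translation [w + 1] into its inverse and [c] into [- c]. *)
Definition reflect (f : C -> C) (w : C) : C := - f (- w).

Lemma lower_opp w : upper_half_plane w <-> lower_half_plane (- w).
Proof. unfold upper_half_plane, lower_half_plane, Im. simpl. split; lra. Qed.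

Lemma upper_opp w : lower_half_plane w <-> upper_half_plane (- w).
Proof. unfold upper_half_plane, lower_half_plane, Im. simpl. split; lra. Qed.

Lemma reflect_holomorphic f :
  holomorphic_on lower_half_plane f -> holomorphic_on upper_half_plane (reflect f).
Proof.
  intros Hf z Hz. destruct (holomorphic_derive _ f (- z) Hf) as [l Hl]; [now apply lower_opp|].
  exists (- (- RtoC 1 * l)). apply is_cderive_opp, (is_cderive_comp f (fun w => - w)); auto.
  apply is_cderive_opp, is_cderive_id.
Qed.

Lemma reflect_shift f :
  (forall w, lower_half_plane w -> f (w + 1) = f w + 1) ->
  forall w, upper_half_plane w -> reflect f (w + 1) = reflect f w + 1.
Proof.
  intros H w Hw. unfold reflect. specialize (H (- w - 1)).
  replace (- w - 1 + 1) with (- w) in H by ring. rewrite H.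
  - replace (- (w + 1)) with (- w - 1) by ring. ring.
  - unfold upper_half_plane, lower_half_plane, Im, RtoC in *. simpl. lra.
Qed.

Lemma rational_opp c : rational (- c) -> rational c.
Proof.
  intros (p & q & Hq & E). exists (- p)%Z, q. split; auto.
  replace c with (- - c) by ring. rewrite E, <- RtoC_opp, opp_IZR. f_equal. unfold Rdiv. ring.
Qed.

Lemma rational_opp_iff c : rational (- c) <-> rational c.
Proof.
  split; [apply rational_opp|]. intros H. apply rational_opp. now replace (- - c) with c by ring.
Qed.

Lemma compatible_shift_reflect c beta :
  rational_with_compatible_shift lower_half_plane c beta <->
  rational_with_compatible_shift upper_half_plane (- c) (reflect beta).
Proof.
  split; intros (p & q & Hq & Hrel & E & Hs); exists (- p)%Z, q; (split; [exact Hq|]);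
    (split; [apply Zgcd_1_rel_prime; rewrite Z.gcd_opp_l; now apply Zgcd_1_rel_prime|]).
  - split; [rewrite E, <- RtoC_opp, opp_IZR; f_equal; unfold Rdiv; ring|].
    intros w Hw. unfold reflect.
    (* Reflection reverses translations, so the shift relation is used one step to the left of
       [- w]. *)
    specialize (Hs (- w - RtoC (1 / INR q))).
    replace (- w - RtoC (1 / INR q) + RtoC (1 / INR q)) with (- w) in Hs by ring.
    rewrite Hs; [replace (- (w + RtoC (1 / INR q))) with (- w - RtoC (1 / INR q)) by ring; ring|].
    unfold upper_half_plane, lower_half_plane, Im, RtoC in *. simpl. lra.
  - split; [replace c with (- - c) by ring; rewrite E, <- RtoC_opp, opp_IZR; f_equal; unfold Rdiv; ring|].
    intros w Hw. specialize (Hs (- w - RtoC (1 / INR q))). unfold reflect in Hs.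
    replace (- (- w - RtoC (1 / INR q) + RtoC (1 / INR q))) with w in Hs by ring.
    replace (- (- w - RtoC (1 / INR q))) with (w + RtoC (1 / INR q)) in Hs by ring.
    assert (Hw' : upper_half_plane (- w - RtoC (1 / INR q)))
      by (unfold upper_half_plane, lower_half_plane, Im, RtoC in *; simpl; lra).
    specialize (Hs Hw'). replace (beta w) with (- - beta w) by ring. rewrite Hs. ring.
Qed.

Lemma datum_lower phi psi h g c beta :
  holomorphic_self_map phi -> in_centralizer phi psi -> is_canonical_model phi lower_half_plane h ->
  induced_map psi lower_half_plane h g ->
  is_linearization_coefficient phi psi lower_half_plane h c ->
  is_linearization_function phi psi lower_half_plane h c beta ->
  linearization_datum (reflect g) (- c) (reflect beta).
Proof.
  intros Hphi Hpsi M Hg [b Hb] [Hrat Hirr].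
  assert (Hlin : forall b, solves_linearization_system phi psi lower_half_plane h c b ->
    linearizes (reflect g) (- c) (reflect b)).
  { intros b' L. split.
    - apply reflect_holomorphic, (lin_holomorphic _ _ _ _ _ _ L).
    - apply reflect_shift, (lin_translation _ _ _ _ _ _ L).
    - intros w Hw. unfold reflect. replace (- - g (- w)) with (g (- w)) by ring.
      rewrite (induced_conjugacy phi psi lower_half_plane h g c b') by (auto; now apply lower_opp). ring. }
  split.
  - split.
    + apply reflect_holomorphic, (induced_holomorphic _ _ _ _ Hg).
    + intros w Hw. apply upper_opp, (induced_maps _ _ _ _ Hg). now apply lower_opp.
    + apply reflect_shift, (induced_shift _ _ _ _ Hg).
  - exists (reflect b). auto.
  - intros Hc w Hw. unfold reflect. rewrite Hrat; [ring|now apply rational_opp|now apply lower_opp].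
  - intros Hc. destruct Hirr as [L T]; [now rewrite <- rational_opp_iff|]. split; auto.
    intros eps Heps. destruct (T eps Heps) as [Y HY]. exists Y. intros w Hw Hwy.
    unfold reflect. replace (- beta (- w) - w) with (- (beta (- w) - - w)) by ring. rewrite Cmod_opp.
    apply HY; [now apply lower_opp|]. unfold Im in *. simpl. now rewrite Rabs_Ropp.
Qed.

Lemma induced_maps_commute psi1 psi2 phi S h g1 g2 :
  is_canonical_model phi S h -> induced_map psi1 S h g1 -> induced_map psi2 S h g2 ->
  (forall z, Disc z -> Disc (psi1 z)) -> (forall z, Disc z -> Disc (psi2 z)) ->
  (forall z, Disc z -> psi1 (psi2 z) = psi2 (psi1 z)) ->
  forall w, S w -> g1 (g2 w) = g2 (g1 w).
Proof.
  intros M H1 H2 D1 D2 Hc w Hw. apply (model_exhausts _ _ _ M) in Hw. destruct Hw as (n & z & Hz & ->).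
  rewrite (induced_value _ _ _ _ H2 z), (induced_value _ _ _ _ H1 z) by auto.
  rewrite (induced_value _ _ _ _ H1), (induced_value _ _ _ _ H2) by auto. now rewrite Hc.
Qed.

(* The two compositions agree near a point that [phi] has pushed far enough for both images
   to lie in the absorbing domain, hence everywhere by the identity theorem. *)
Lemma commute_of_induced phi psi1 psi2 S h g1 g2 Y :
  holomorphic_self_map phi -> in_centralizer phi psi1 -> in_centralizer phi psi2 ->
  is_canonical_model phi S h -> induced_map psi1 S h g1 -> induced_map psi2 S h g2 ->
  (forall w, S w -> (Y < Rabs (Im w))%R -> g1 (g2 w) = g2 (g1 w)) ->
  forall z, Disc z -> psi1 (psi2 z) = psi2 (psi1 z).
Proof.
  intros Hphi Hpsi1 Hpsi2 M H1 H2 Hcomm.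
  pose proof Hpsi1 as [[Hh1 Hm1] _]. pose proof Hpsi2 as [[Hh2 Hm2] _].
  (* Subtracting integers does not change heights, so any point of [S] beyond [Y] yields a point of
     the disc whose image under [h] lies beyond [Y], and iterating [phi] keeps it there. *)
  assert (Hex : exists w, S w /\ (Y < Rabs (Im w))%R).
  { pose proof (Rmax_l Y 0). pose proof (Rmax_r Y 0).
    destruct (model_base _ _ _ M) as [-> | ->].
    - exists (RtoC 0 + RtoC (Rmax Y 0 + 1) * Ci). unfold upper_half_plane.
      rewrite Im_add_imaginary. unfold Im, RtoC; simpl. rewrite Rabs_right; lra.
    - exists (RtoC 0 + RtoC (- (Rmax Y 0 + 1)) * Ci). unfold lower_half_plane.
      rewrite Im_add_imaginary. unfold Im, RtoC; simpl. rewrite Rabs_left; lra. }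
  destruct Hex as (w0 & Hw0 & HY).
  apply (model_exhausts _ _ _ M) in Hw0. destruct Hw0 as (n & z & Hz & ->).
  destruct (model_injective _ _ _ M) as (V & HV & Hinj).
  destruct (common_absorption phi V (psi1 (psi2 z)) (psi2 (psi1 z)) HV) as (k & V1 & V2); auto.
  rewrite <- !(centralizer_iterate phi) in V1, V2 by auto.
  set (a := iterate phi k z) in *.
  assert (Ha : Disc a) by now apply iterate_Disc.
  assert (Ia : (Y < Rabs (Im (h a)))%R).
  { unfold a. rewrite (model_iterate phi S h) by auto. rewrite Im_add_real.
    replace (Im (h z - INR n)) with (Im (h z)) in HY by (unfold Im, RtoC; simpl; ring). exact HY. }
  pose proof HV as (Hdom & _ & _ & _). pose proof (planar_domain_copen V Hdom) as HVo.
  assert (H12 : holomorphic_on Disc (fun z => psi1 (psi2 z))) by (apply (holomorphic_comp _ Disc psi1 psi2); auto).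
  assert (H21 : holomorphic_on Disc (fun z => psi2 (psi1 z))) by (apply (holomorphic_comp _ Disc psi2 psi1); auto).
  destruct (HVo _ V1) as (e1 & He1 & B1). destruct (HVo _ V2) as (e2 & He2 & B2).
  destruct (holomorphic_ccontinuous _ _ a H12 Ha e1 He1) as (d1 & Hd1 & C1).
  destruct (holomorphic_ccontinuous _ _ a H21 Ha e2 He2) as (d2 & Hd2 & C2).
  destruct (holomorphic_ccontinuous _ _ a (model_holomorphic _ _ _ M) Ha (Rabs (Im (h a)) - Y)%R)
    as (d3 & Hd3 & C3); [lra|].
  set (d4 := (1 - Cmod a)%R). assert (Hd4 : (0 < d4)%R) by (unfold d4, Disc in *; lra).
  set (d := Rmin (Rmin d1 d2) (Rmin d3 d4)).
  assert (Hd : (0 < d)%R) by (repeat apply Rmin_glb_lt; auto).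
  assert (L1 : (d <= d1)%R) by (eapply Rle_trans; apply Rmin_l).
  assert (L2 : (d <= d2)%R) by (eapply Rle_trans; [apply Rmin_l|apply Rmin_r]).
  assert (L3 : (d <= d3)%R) by (eapply Rle_trans; [apply Rmin_r|apply Rmin_l]).
  assert (L4 : (d <= d4)%R) by (eapply Rle_trans; apply Rmin_r).
  intros v Hv. apply Cmod_sub_eq_0.
  rewrite (identity_theorem_unit_disc (fun z => psi1 (psi2 z) - psi2 (psi1 z)) a d v); auto.
  - apply Cmod_0.
  - now apply holomorphic_minus.
  - intros w Hw. unfold cdisc in Hw.
    assert (HwD : Disc w).
    { unfold Disc. pose proof (Cmod_triangle (w - a) a) as T.
      replace (w - a + a) with w in T by ring. unfold d4 in L4. lra. }
    specialize (C1 w ltac:(lra)). specialize (C2 w ltac:(lra)). specialize (C3 w ltac:(lra)).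
    enough (E : psi1 (psi2 w) = psi2 (psi1 w)) by (rewrite E; ring).
    apply Hinj; [now apply B1|now apply B2|].
    assert (Hval : forall psi g x, induced_map psi S h g -> Disc x -> g (h x) = h (psi x)).
    { intros psi g x Hg Hx. pose proof (induced_value _ _ _ _ Hg x 0 Hx) as E. simpl INR in E.
      replace (h x - 0) with (h x) in E by ring. rewrite E. ring. }
    rewrite <- (Hval psi1 g1), <- (Hval psi2 g2), <- (Hval psi2 g2 (psi1 w)), <- (Hval psi1 g1 w); auto.
    apply Hcomm; [now apply (model_maps_to _ _ _ M)|].
    pose proof (im_le_Cmod (h w - h a)) as T. change (Im (h w - h a)) with (Im (h w) - Im (h a))%R in T.
    pose proof (Rabs_triang_inv (Im (h a)) (Im (h w))) as T'. rewrite Rabs_minus_sym in T'. lra.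
Qed.

Theorem theorem4p28 (phi psi1 psi2 : C -> C)
  (phi_self_map : holomorphic_self_map phi)
  (phi_parabolic : parabolic phi)
  (phi_step : positive_hyperbolic_step phi)
  (psi1_centralizer : in_centralizer phi psi1)
  (psi2_centralizer : in_centralizer phi psi2)
  (Sphi : C -> Prop) (h : C -> C)
  (model : is_canonical_model phi Sphi h)
  (c1 c2 : C)
  (c1_coefficient : is_linearization_coefficient phi psi1 Sphi h c1)
  (c2_coefficient : is_linearization_coefficient phi psi2 Sphi h c2)
  (beta1 beta2 : C -> C)
  (beta1_function : is_linearization_function phi psi1 Sphi h c1 beta1)
  (beta2_function : is_linearization_function phi psi2 Sphi h c2 beta2) :
  (forall z, Disc z -> psi1 (psi2 z) = psi2 (psi1 z)) <->
  ((forall w, Sphi w -> beta1 w = beta2 w) \/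
   rational_with_compatible_shift Sphi c1 beta2 \/
   rational_with_compatible_shift Sphi c2 beta1).
Proof.
  destruct (induced_map_exists phi psi1 Sphi h phi_self_map psi1_centralizer model) as [g1 H1].
  destruct (induced_map_exists phi psi2 Sphi h phi_self_map psi2_centralizer model) as [g2 H2].
  pose proof (proj2 (proj1 psi1_centralizer)) as D1. pose proof (proj2 (proj1 psi2_centralizer)) as D2.
  pose proof (induced_maps_commute psi1 psi2 phi Sphi h g1 g2 model H1 H2 D1 D2) as Hfwd.
  pose proof (commute_of_induced phi psi1 psi2 Sphi h g1 g2) as Hbwd.
  destruct (model_base _ _ _ model) as [-> | ->].
  - pose proof (datum_upper phi psi1 h g1 c1 beta1 phi_self_map psi1_centralizer model H1
      c1_coefficient beta1_function) as L1.
    pose proof (datum_upper phi psi2 h g2 c2 beta2 phi_self_map psi2_centralizer model H2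
      c2_coefficient beta2_function) as L2.
    split.
    + intros Hc. now apply (condition_of_commuting g1 g2 c1 c2 beta1 beta2 L1 L2), Hfwd.
    + intros Hcond. destruct (commuting_of_condition g1 g2 c1 c2 beta1 beta2 L1 L2 Hcond) as (Y & HY & Hc).
      apply (Hbwd Y); auto. intros w Hw Hwy. apply Hc. unfold upper_half_plane in Hw.
      rewrite Rabs_right in Hwy; lra.
  - pose proof (datum_lower phi psi1 h g1 c1 beta1 phi_self_map psi1_centralizer model H1
      c1_coefficient beta1_function) as L1.
    pose proof (datum_lower phi psi2 h g2 c2 beta2 phi_self_map psi2_centralizer model H2
      c2_coefficient beta2_function) as L2.
    rewrite (compatible_shift_reflect c1), (compatible_shift_reflect c2).
    assert (Heq : (forall w, lower_half_plane w -> beta1 w = beta2 w) <->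
      (forall w, upper_half_plane w -> reflect beta1 w = reflect beta2 w)).
    { unfold reflect. split; intros H w Hw.
      - rewrite H; auto. now apply lower_opp.
      - apply upper_opp in Hw. specialize (H (- w) Hw). replace (- - w) with w in H by ring.
        replace (beta1 w) with (- - beta1 w) by ring. rewrite H. ring. }
    rewrite Heq. split.
    + intros Hc. apply (condition_of_commuting (reflect g1) (reflect g2)); auto.
      intros w Hw. unfold reflect.
      replace (- - g2 (- w)) with (g2 (- w)) by ring. replace (- - g1 (- w)) with (g1 (- w)) by ring.
      rewrite Hfwd; auto. now apply lower_opp.
    + intros Hcond. destruct (commuting_of_condition _ _ _ _ _ _ L1 L2 Hcond) as (Y & HY & Hc).
      apply (Hbwd Y); auto. intros w Hw Hwy. unfold lower_half_plane in Hw.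
      rewrite Rabs_left in Hwy by lra.
      specialize (Hc (- w)). unfold reflect in Hc. replace (- - w) with w in Hc by ring.
      replace (- - g2 w) with (g2 w) in Hc by ring. replace (- - g1 w) with (g1 w) in Hc by ring.
      replace (g1 (g2 w)) with (- - g1 (g2 w)) by ring. rewrite Hc; [ring|].
      unfold Im in *. simpl. lra.
Qed.
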